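(* Let $L,N\ge1$ be integers with $N\le L$, let $p,q\ge0$ with $p+q=1$, and consider the PushASEP with $N$ particles on a ring of length $L$, started from $Y=(y_1,\dots,y_N)\in\mathcal X_{L,N}$, with configuration $X(t)$ and total current $Q(t)$ at time $t\ge0$. For $\zeta\in\mathbb C$ with $|\zeta|=1$ let $$\mathcal R(\zeta)=\{\vec w\in\mathbb C^N:\ p_z(\vec w;\zeta)=0\ \text{and}\ q_z(w_i)=0\ \text{for all } i=1,\dots,N,\ \text{for some } z\in\mathbb C^*\}.$$ (i) The functions $X\mapsto u_{\vec\lambda}(X;\zeta)$ with $\vec\lambda\in\mathcal R(\zeta)$ are eigenfunctions of the infinitesimal generator $\mathcal H_\zeta$ of the PushASEP on the ring, with corresponding eigenvalues $E(\vec\lambda)$; that is, $\mathcal H_\zeta u_{\vec\lambda}(\cdot;\zeta)=E(\vec\lambda)\,u_{\vec\lambda}(\cdot;\zeta)$ on $\mathcal X_{L,N}$. (ii) Moreover, for $X\in\mathcal X_{L,N}$ and $t\ge0$, the partial Fourier transform of the joint probability distribution has the spectral decomposition $$\sum_{Q\in\mathbb Z}\zeta^Q\,\mathbb P_Y\big(X(t)=X,\,Q(t)=Q\big)=\binom LN^{-1}\mathbf 1(\zeta^L=1)+\sum_{\vec\lambda\in\mathcal R(\zeta)}\mathcal G_{\vec\lambda}(Y;\zeta)\,u_{\vec\lambda}(X;\zeta)\,e^{tE(\vec\lambda)}$$ for all but finitely many $\zeta\in\mathbb C$ with $|\zeta|=1$, where $$\mathcal G_{\vec\lambda}(Y;\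zeta)=h_{\vec\lambda}(Y;\zeta)\Big(\prod_{i=1}^N\frac{\lambda_i-1}{L\lambda_i-(L-N)}\Big)\Big(L-\sum_{i=1}^N\frac{L}{L\lambda_i-(L-N)}\Big)^{-1}.$$
   Context: Model (PushASEP on a ring). $\mathcal X_{L,N}=\{(x_1,\dots,x_N)\in\mathbb Z^N: 0\le x_1<\dots<x_N\le L-1\}$ is the set of configurations of $N$ particles on $\mathbb Z/L\mathbb Z$. Each particle independently attempts to jump to its right neighbouring site at rate $p$, and the jump is suppressed if the target is occupied. Each particle independently jumps to its left neighbouring site at rate $q$; if the target is occupied, the particle there is simultaneously pushed one step to the left, and so on, until an unoccupied site is reached. $\mathbb P_Y$ is the law started from $Y$. $Q_x(t)$ is the number of particle moves from $x$ to $x+1$ minus the number of particle moves from $x+1$ to $x$ during $[0,t]$ (pushed moves included), and $Q(t)=\sum_{x\in\mathbb Z/L\mathbb Z}Q_x(t)$. Functions. $h_{\vec w}(Y;\zeta)=\prod_{i=1}^N(\zeta^{-1}w_i)^{y_i}$; $A_\sigma(\vec w)=(-1)^\sigma\prod_{j=1}^N(1-w_{\sigma(j)}^{-1})^{\sigma(j)-j}$ for $\sigma\in S_N$, with $(-1)^\sigma$ the sign of $\sigma$; $u_{\vec w}(X;\zeta)=\sum_{\sigma\in S_N}A_\sigma(\vec w)\prod_{i=1}^N(\zeta^{-1}w_{\sigma(i)})^{-x_i}$; $E(\vec w)=\sum_{i=1}^N(pw_i+qw_i^{-1}-1)$; $p_z(\vec w;\zeta)=1+(-1)^N\zeta^Lz^{-L}\prod_{i=1}^N(1-w_i^{-1})$;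 $q_z(w)=1-z^Lw^{-L}(1-w^{-1})^{-N}$. Generator. The generating series $g(X;t)=\sum_Q\zeta^Q\mathbb P_Y(X(t)=X,Q(t)=Q)$ solves $\partial_tg=\mathcal H_\zeta g$, $g(X;0)=\mathbf 1(X=Y)$, where, for $f:\mathcal X_{L,N}\to\mathbb C$, $$\mathcal H_\zeta f(X)=p\sum_{i=1}^N\big(\zeta f(X^{i,-})-f(X)\big)\mathbf 1(X^{i,-}\in\mathcal X_{L,N})+q\sum_{i=1}^N\sum_{k=1}^N\big(\zeta^{-k}f(X^{i,+k})-f(X)\big)\mathbf 1\big(d(x_{i+k-1},x_i)=k-1,\ X^{i,+k}\in\mathcal X_{L,N}\big).$$ Here particle labels are taken modulo $N$ and positions modulo $L$; $X^{i,-}$ is $X$ with the $i$-th particle moved one site to the left on the ring, $X^{i,+k}$ is $X$ with particles $i,i+1,\dots,i+k-1$ each moved one site to the right on the ring (coordinates re-listed in increasing order), membership in $\mathcal X_{L,N}$ means no two particles share a site, and $d(x_{i+k-1},x_i)$ is the distance on the ring travelled going to the right from particle $i$ to particle $i+k-1$.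
   Formalization: In (ii) the sum over λ in R(ζ) is taken over all pairs (z,λ) solving the Bethe equations, so each λ counts L times; as printed, the right-hand side is too small by a factor L (e.g. L=2, N=1, X=Y, t=0 gives 1/2 instead of 1). *)

(* Defs.v *)
From HB Require Import structures.
From mathcomp Require Import all_boot all_order all_algebra all_fingroup.
From mathcomp Require Import all_classical all_reals all_analysis.
From mathcomp Require Export complex.

Set Implicit Arguments.
Unset Strict Implicit.
Unset Printing Implicit Defensive.

Import Order.TTheory GRing.Theory Num.Theory numFieldNormedType.Exports.

Local Open Scope classical_set_scope.
Local Open Scope ring_scope.
Local Open Scope complex_scope.

(** * Continuous-time Markov chains on a countable state space *)

Section MarkovChain.
Context {R : realType} {S : countType}.

(** [Pt] is a standard stochastic transition function with Q-matrix [rate]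
    (diagonal entries of [rate] included). *)
Record transition_function (rate : S -> S -> R) (Pt : R -> S -> S -> R) : Prop := {
  tf_ge0 : forall t s s', 0 <= t -> 0 <= Pt t s s';
  tf_sum1 : forall t s, 0 <= t -> (\esum_(s' in [set: S]) (Pt t s s')%:E = 1)%E;
  tf_start : forall s s', Pt 0 s s' = (s == s')%:R;
  tf_chapman : forall t u s s', 0 <= t -> 0 <= u ->
    ((Pt (t + u) s s')%:E = \esum_(r in [set: S]) (Pt t s r * Pt u r s')%:E)%E;
  tf_rate : forall s s',
    h^-1 * (Pt h s s' - (s == s')%:R) @[h --> 0^'+] --> rate s s' }.

(** For [l = [:: (h1, s1); ...; (hn, sn)]], the event
    Z(t0+h1) = s1, Z(t0+h1+h2) = s2, ..., and the product
    Pt h1 s0 s1 * Pt h2 s1 s2 * ... *)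
Fixpoint cylinder {T : Type} (Z : R -> T -> S) (t0 : R) (l : seq (R * S)) : set T :=
  if l is (h, s) :: l' then
    [set w | Z (t0 + h) w = s] `&` cylinder Z (t0 + h) l'
  else setT.

Fixpoint path_weight (Pt : R -> S -> S -> R) (s0 : S) (l : seq (R * S)) : R :=
  if l is (h, s) :: l' then Pt h s0 s * path_weight Pt s l' else 1.

Definition markov_chain d (T : measurableType d) (P : probability T R)
    (rate : S -> S -> R) (s0 : S) (Z : R -> T -> S) : Prop :=
  (forall t s, 0 <= t -> measurable [set w | Z t w = s]) /\
  exists2 Pt, transition_function rate Pt &
    forall l : seq (R * S), all (fun hs => 0 <= hs.1) l ->
      P (cylinder Z 0 l) = (path_weight Pt s0 l)%:E.

End MarkovChain.

(** * Configurations and moves *)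

Definition config (L N : nat) :=
  {x : N.-tuple 'I_L | sorted (fun a b : 'I_L => (a < b)%N) x}.

Section Configurations.
Context {L N : nat}.
Implicit Types (X : config L N) (i j : 'I_N) (a b : 'I_L).

Definition pos X i : 'I_L := tnth (val X) i.

(** The configuration occupying the sites [f 0, ..., f (N-1)], re-listed in
    increasing order; [None] when two particles share a site. *)
Definition relist (f : 'I_N -> 'I_L) : option (config L N) :=
  insub [tuple of sort (fun a b : 'I_L => (a <= b)%N) [tuple f i | i < N]].

(** Here and below [step] is [@ordS L] (one site to the right on the ring) or
    [@ord_pred L] (one site to the left). *)
Definition displace X (A : {set 'I_N}) (step : 'I_L -> 'I_L) :=
  relist (fun j => if j \in A then step (pos X j) else pos X j).

Definition ring_dist a b : nat := ((b + L - a) %% L)%N.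

(** Particles [i, i+1, ..., i+k] (labels modulo [N]). *)
Definition block i (k : nat) : {set 'I_N} :=
  [set j | [exists m : 'I_k.+1, j == iter m (@ordS N) i]].

(** Particles moved by a left jump of [i]: [i] itself, the particle at its target
    site if there is one, and so on. When the ring is full this is everybody. *)
Definition pushed X i : {set 'I_N} :=
  [set j | connect (fun k k' => pos X k' == ord_pred (pos X k)) i j].

End Configurations.

(** * PushASEP, jointly with its bond currents *)

(** [s.2 x] is the net number of moves from [x] to [x+1]. The currents are part of
    the Markov state because they are not functionals of the path of the
    configuration: on a full ring a left push moves every particle and leaves the
    configuration unchanged, and for [L = 2] the two directions are
    indistinguishable. *)
Definition state (L N : nat) : countType := (config L N * {ffun 'I_L -> int})%type.

Section Dynamics.
Context {R : realType} {L N : nat}.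
Implicit Types (s : state L N) (i : 'I_N).

(** The target counts as occupied when another particle sits there, so for
    [L = N = 1] the jump around the ring is allowed. *)
Definition right_jump i s : state L N :=
  if displace s.1 [set i] (@ordS L) is Some X then
    (X, [ffun x => s.2 x + (x == pos s.1 i)%:Z])
  else s.

(** The [else] branch is never taken: a left push always lands in a configuration. *)
Definition left_push i s : state L N :=
  if displace s.1 (pushed s.1 i) (@ord_pred L) is Some X then
    (X, [ffun x => s.2 x - #|[set j in pushed s.1 i | ord_pred (pos s.1 j) == x]|%:Z])
  else s.

Definition pushASEP_rate (p q : R) (s s' : state L N) : R :=
  \sum_(i < N) (p * ((right_jump i s == s')%:R - (s == s')%:R)
              + q * ((left_push i s == s')%:R - (s == s')%:R)).

Definition pushASEP d (T : measurableType d) (P : probability T R) (p q : R)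
    (Y : config L N) (X : R -> T -> config L N) (J : R -> T -> {ffun 'I_L -> int}) :=
  markov_chain P (pushASEP_rate p q) ((Y, [ffun=> 0]) : state L N)
    (fun t w => (X t w, J t w)).

Definition total_current (J : {ffun 'I_L -> int}) : int := \sum_(x < L) J x.

End Dynamics.

(** * Generator, Bethe functions and Bethe roots *)

Section Bethe.
Context {R : realType} {L N : nat}.
Implicit Types (p q : R) (zeta z : R[i]) (w : {ffun 'I_N -> R[i]}) (X Y : config L N).

(** [oapp _ 0 (displace _)] is the indicator that the displaced configuration is
    admissible. The index [k] below stands for [k - 1] in the usual notation: the
    particles [i, ..., i+k] move. *)
Definition generator p q zeta (f : config L N -> R[i]) X : R[i] :=
  p%:C * (\sum_(i < N)
    oapp (fun X' => zeta * f X' - f X) 0 (displace X [set i] (@ord_pred L)))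
  + q%:C * (\sum_(i < N) \sum_(k < N)
      if ring_dist (pos X i) (pos X (iter k (@ordS N) i)) == k then
        oapp (fun X' => zeta ^- k.+1 * f X' - f X) 0
          (displace X (block i k) (@ordS L))
      else 0).

Definition bethe_h w Y zeta : R[i] := \prod_(i < N) (zeta^-1 * w i) ^+ pos Y i.

Definition bethe_A (s : 'S_N) w : R[i] :=
  (-1) ^+ s * \prod_(j < N) (1 - (w (s j))^-1) ^ ((s j)%:Z - j%:Z).

Definition bethe_u w X zeta : R[i] :=
  \sum_(s : 'S_N) bethe_A s w * \prod_(i < N) (zeta^-1 * w (s i)) ^- pos X i.

Definition energy p q w : R[i] := \sum_(i < N) (p%:C * w i + q%:C * (w i)^-1 - 1).

Definition bethe_p z w zeta : R[i] :=
  1 + (-1) ^+ N * zeta ^+ L * z ^- L * \prod_(i < N) (1 - (w i)^-1).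

(** With [0^-1 = 0] and [0 < L], [0 < N] this equals 1 at [w = 0] and [w = 1], so
    these two values are never roots. *)
Definition bethe_q z (w : R[i]) : R[i] :=
  1 - z ^+ L * w ^- L * (1 - w^-1) ^- N.

(** Solutions [(z, w)] of the Bethe equations. The equations only involve [z ^+ L], so
    every Bethe root [w] comes with exactly [L] values of [z]. The weight [bethe_G] is
    the residue at one such [z]: the spectral sum has to run over the pairs. For
    instance, for [L = 2] and [N = 1] the roots are [zeta] and [- zeta] and, for
    X = Y and t = 0, each has [bethe_G * bethe_u = 1/4], while the total must be 1. *)
Definition bethe_solutions zeta : set (R[i] * {ffun 'I_N -> R[i]}) :=
  [set zw | [/\ zw.1 != 0, bethe_p zw.1 zw.2 zeta = 0
              & forall i, bethe_q zw.1 (zw.2 i) = 0]].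

Definition bethe_roots zeta : set {ffun 'I_N -> R[i]} :=
  [set w | exists z, bethe_solutions zeta (z, w)].

Definition bethe_D (x : R[i]) : R[i] := L%:R * x - (L%:R - N%:R).

Definition bethe_jac w : R[i] := L%:R - \sum_(i < N) L%:R / bethe_D (w i).

Definition bethe_G w Y zeta : R[i] :=
  bethe_h w Y zeta * (\prod_(i < N) ((w i - 1) / bethe_D (w i))) * (bethe_jac w)^-1.

End Bethe.

Arguments bethe_solutions {R} L N zeta.
Arguments bethe_roots {R} L N zeta.
Arguments bethe_D {R} L N x.
Arguments bethe_jac {R} L {N} w.

Definition cexp {R : realType} (z : R[i]) : R[i] :=
  (expR (complex.Re z))%:C * (cos (complex.Im z) +i* sin (complex.Im z)).

Definition int_sum_to {K : numFieldType} (a : int -> K) (l : K) : Prop :=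
  (fun n : nat => \sum_(k < n.*2.+1) a (k%:Z - n%:Z)) @ \oo --> l.

(* Main.v *)
Require Import Defs.
From mathcomp Require Import all_boot all_order all_algebra all_fingroup all_field.
From mathcomp Require cyclic.
From mathcomp Require Import all_classical all_reals all_analysis.
From mathcomp Require Import poly zify ring lra.
Import Order.TTheory GRing.Theory Num.Theory numFieldNormedType.Exports.

Set Implicit Arguments.
Unset Strict Implicit.
Unset Printing Implicit Defensive.

(** (i) [bethe_u] is a determinant in the particle positions. Moving a single particle
    defines [bethe_u] on unordered positions as well; two column relations, one for
    adjacent particles on the same site and one for a full turn around the ring, turn
    the free evolution into the exclusion rule and the pushing rule.

    (ii) The generating series of the total current solves the forward equation
    g' = H g. Its right derivative is controlled with finite subsets of the state space
    only, since the exit rates are bounded. By (i) the spectral sum solves the same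
    equation, so by a Gronwall argument it suffices to treat t = 0, that is, to show that
    L * sum_w G(w) u(w) = 1(X = Y), the sum running over the Bethe roots (each of which
    comes with L values of z).

    This identity between algebraic functions of zeta is first shown up to
    O(zeta^-n), for every n, when zeta is large: there the Bethe roots are indexed by
    the N-tuples (omega_j) of solutions of omega^L = (-1)^(N+1), with
    w_j ~ zeta / omega_j, and Lagrange inversion expands the sum in powers of
    1/zeta, with all coefficients but one vanishing by orthogonality of roots of unity
    and an inequality between the exponents. Quantifier elimination over the
    algebraically closed field makes the value of the sum a definable, hence algebraic,
    function of zeta, so it is constant outside a finite set. *)

(** * Configurations on the ring *)

(** The formula is wanted on the unit circle, where the Bethe roots have no explicit description and
    where two of them may collide or a denominator vanish; for large [zeta] all of them are under
    perturbative control. The obstacle is the passage between these regimes. The roots are not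
    continued analytically. Instead, one first-order formula in ([zeta], v) says that [W] lists
    exactly the L^N solutions, that no denominator vanishes and that the sum equals v. Its graph
    lies on an algebraic curve, and a branch that approaches a constant faster than every power of
    1/[zeta] is that constant. Finiteness of the solution set, nondegeneracy and the value of the
    sum are therefore obtained together, off one finite set. The solutions of zeta^L = 1 are put
    into this set, so the binomial term is zero wherever the expansion is asserted.

    At large [zeta] the roots interact through a single parameter t. Up to a factor L, [bethe_jac]
    is the derivative of log(1/zeta) with respect to log t, which is exactly the factor that
    Lagrange inversion requires in order to expand in 1/zeta rather than in t. *)

Section Ordinals.
Variable n : nat.
Implicit Types i j : 'I_n.

Lemma val_iter_ordS l i : iter l (@ordS n) i = (i + l) %% n :> nat.
Proof.
elim: l => [|l IH] /=; first by rewrite addn0 modn_small.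
by rewrite IH -addn1 modnDml addn1 addnS.
Qed.

Lemma iter_ordSK l : cancel (iter l (@ordS n)) (iter l (@ord_pred n)).
Proof. by elim: l => [|l IH] i //; rewrite [iter l.+1 _ i]/= iterSr ordSK IH. Qed.

Lemma iter_ordS_inj l : injective (iter l (@ordS n)).
Proof. exact: can_inj (iter_ordSK l). Qed.

Lemma iter_ordS_full i : iter n (@ordS n) i = i.
Proof. by apply/val_inj => /=; rewrite val_iter_ordS modnDr modn_small. Qed.

Lemma iter_ordS_eq l m i : l < n -> m < n -> iter l (@ordS n) i = iter m (@ordS n) i -> l = m.
Proof.
move=> ln mn /(congr1 (@nat_of_ord n)); rewrite !val_iter_ordS => /eqP.
by rewrite eqn_modDl !modn_small // => /eqP.
Qed.

End Ordinals.

(** * Moves of particles and blocks, and their inverses *)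

Section Configurations.
Variables L N : nat.
Implicit Types (X Y : config L N) (i j : 'I_N) (f : 'I_N -> 'I_L).

Lemma pos_lt X i j : i < j -> pos X i < pos X j.
Proof.
move=> ij; have tr : transitive (fun a b : 'I_L => a < b) by move=> b a c; apply: ltn_trans.
have x0 : 'I_L := pos X i.
rewrite /pos !(tnth_nth x0).
by apply: (sorted_ltn_nth tr x0 (valP X)) => //; rewrite inE size_tuple.
Qed.

Lemma pos_inj X : injective (pos X).
Proof.
move=> i j ij; case: (ltngtP i j) => [h|h|/val_inj //]; have := pos_lt X h; by rewrite ij ltnn.
Qed.

Lemma pos_le X i j : i <= j -> pos X i <= pos X j.
Proof. by rewrite leq_eqVlt => /orP[/eqP/val_inj -> //|/(pos_lt X)/ltnW]. Qed.

Lemma val_config X : val X = [seq pos X i | i <- enum 'I_N] :> seq _.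
Proof.
by rewrite -[LHS](map_tnth_enum (val X)).
Qed.

Definition occupied X (a : 'I_L) := [exists j, pos X j == a].

Lemma occupied_pos X i : occupied X (pos X i).
Proof. by apply/existsP; exists i. Qed.

(** Positions increase with labels, so no particle sits strictly between [i] and its successor. If
    [i] is on the last site, it carries the last label and the occupied site 0 belongs to particle
    0. *)
Lemma pos_ordS X i : occupied X (ordS (pos X i)) -> pos X (ordS i) = ordS (pos X i).
Proof.
move=> /existsP[j /eqP jE]; apply/val_inj => /=.
have iN := ltn_ord i; have iL := ltn_ord (pos X i).
have [lt|ge] := ltnP (pos X i).+1 L.
  have pj : pos X j = (pos X i).+1 :> nat by rewrite jE /= modn_small.
  have ij : i < j by rewrite ltnNge; apply/negP => /(pos_le X); lia.
  have SN : i.+1 < N by have := ltn_ord j; lia.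
  have Si : ordS i = i.+1 :> nat by rewrite /= modn_small.
  have h1 : pos X i < pos X (ordS i) by apply: pos_lt; rewrite Si.
  have h2 : pos X (ordS i) <= pos X j by apply: pos_le; rewrite Si.
  by rewrite modn_small //; lia.
have pL : (pos X i).+1 = L by lia.
have imax : i.+1 = N.
  apply/eqP; rewrite eqn_leq iN /= leqNgt; apply/negP => SN.
  have Si : ordS i = i.+1 :> nat by rewrite /= modn_small.
  have := pos_lt X (i := i) (j := ordS i); rewrite Si => /(_ (ltnSn _)).
  by have := ltn_ord (pos X (ordS i)); lia.
have S0 : ordS i = 0 :> nat by rewrite /= imax modnn.
have := pos_le X (i := ordS i) (j := j); rewrite S0 => /(_ (leq0n _)).
by rewrite jE /= pL modnn; lia.
Qed.

Lemma pos_ord_pred X i : occupied X (ord_pred (pos X i)) -> pos X (ord_pred i) = ord_pred (pos X i).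
Proof.
move=> /existsP[j /eqP jE].
have ji : pos X (ordS j) = pos X i by rewrite pos_ordS jE ord_predK // occupied_pos.
by rewrite -{1}(pos_inj ji) ordSK jE.
Qed.

Lemma relist_inj f : injective f -> exists2 X, relist f = Some X & perm_eq (val X) (map f (enum 'I_N)).
Proof.
move=> fI; rewrite /relist; set t := [tuple of sort _ _].
have st : sorted (fun a b : 'I_L => a < b) t.
  have -> : sorted (fun a b : 'I_L => a < b) t = uniq t && sorted (fun a b : 'I_L => a <= b) t.
    have := ltn_sorted_uniq_leq (map (@nat_of_ord L) t).
    by rewrite !sorted_map map_inj_uniq //; exact: ord_inj.
  rewrite /t /= sort_uniq sort_sorted ?andbT; last by move=> a b; apply: leq_total.
  by rewrite map_inj_uniq // enum_uniq.
rewrite (insubT (fun x : N.-tuple 'I_L => sorted (fun a b : 'I_L => a < b) x) st).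
exists (Sub t st) => //; rewrite SubK /t /= perm_sort.
by rewrite perm_refl.
Qed.

Lemma relist_some f X : relist f = Some X -> injective f /\ perm_eq (val X) (map f (enum 'I_N)).
Proof.
rewrite /relist; case: insubP => // Y Ys YE [<-].
have pe : perm_eq (val Y) (map f (enum 'I_N)).
  by rewrite YE /= perm_sort perm_refl.
split=> //.
have : uniq (map f (enum 'I_N)).
  rewrite -(perm_uniq pe) val_config map_inj_uniq ?enum_uniq //; exact: pos_inj.
by move=> u; apply/injectiveP.
Qed.

Lemma relist_none f : relist f = None -> ~ injective f.
Proof. by move=> fN /relist_inj[X]; rewrite fN. Qed.

Lemma sorted_config X : sorted (fun a b : 'I_L => a <= b) (val X).
Proof.
by apply: sub_sorted (valP X) => a b; exact: ltnW.
Qed.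

Lemma config_perm X Y : perm_eq (val X) (val Y) -> X = Y.
Proof.
move=> pe; apply/val_inj/val_inj; apply: (sorted_eq (leT := fun a b : 'I_L => a <= b)) => //.
- by move=> b a c; apply: leq_trans.
- by move=> a b ab; apply/val_inj/eqP; rewrite eqn_leq.
- exact: sorted_config.
- exact: sorted_config.
Qed.

Lemma relist_pos X f (s : {perm 'I_N}) : (forall j, f (s j) = pos X j) -> relist f = Some X.
Proof.
move=> fE; have fI : injective f.
  by move=> i j; rewrite -(permKV s i) -(permKV s j) !fE => /pos_inj /perm_inj ->.
have [Y -> pe] := relist_inj fI; congr Some; apply: config_perm.
apply: perm_trans pe _; rewrite val_config; apply: uniq_perm.
- by rewrite map_inj_uniq ?enum_uniq.
- by rewrite map_inj_uniq ?enum_uniq //; exact: pos_inj.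
move=> a; apply/mapP/mapP => -[j _ ->].
  by exists (s^-1 j)%g; rewrite ?mem_enum // -fE permKV.
by exists (s j); rewrite ?mem_enum // fE.
Qed.

Lemma relist_perm X f : relist f = Some X -> exists s : {perm 'I_N}, forall j, pos X (s j) = f j.
Proof.
move=> /relist_some[fI pe].
have H j : exists k, pos X k == f j.
  have : f j \in tval (val X) by rewrite (perm_mem pe) map_f // mem_enum.
  by rewrite val_config => /mapP[k _ ->]; exists k.
pose g j := xchoose (H j).
have gE j : pos X (g j) = f j by apply/eqP; exact: xchooseP (H j).
have gI : injective g by move=> i j gij; apply: fI; rewrite -!gE gij.
by exists (perm gI) => j; rewrite permE.
Qed.

(** The permutation [s] absorbs the relabelling caused by sorting; the reversal arguments below
    follow particles through it. *)
Lemma displace_inv X Y (A : {set 'I_N}) step step' : cancel step step' ->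
  displace X A step = Some Y -> exists s : {perm 'I_N},
  (forall j, pos Y (s j) = if j \in A then step (pos X j) else pos X j) /\
  displace Y (s @: A) step' = Some X.
Proof.
move=> stepK /relist_perm[s sE]; exists s; split=> //.
apply: (relist_pos (s := s)) => j; rewrite mem_imset; last exact: perm_inj.
by rewrite sE; case: (j \in A); rewrite ?stepK.
Qed.

(** The condition on [ring_dist] in the generator constrains only the two ends of a block. This
    version records all intermediate sites; [contigP] shows that the two agree. *)
Definition contig X i k := forall l, l <= k -> pos X (iter l (@ordS N) i) = iter l (@ordS L) (pos X i).

Lemma contig_leq X i k k' : k' <= k -> contig X i k -> contig X i k'.
Proof. by move=> kk H l lk; apply: H; lia. Qed.

Lemma in_block i k j : (j \in block i k) <-> exists2 l, l <= k & j = iter l (@ordS N) i.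
Proof.
rewrite inE; split=> [/existsP[m /eqP ->]|[l lk ->]]; first by exists m => //; rewrite -ltnS.
by apply/existsP; exists (Ordinal (lk : l < k.+1)).
Qed.

Lemma card_block i k : k < N -> #|block i k| = k.+1.
Proof.
move=> kN; pose F (m : 'I_k.+1) := iter m (@ordS N) i.
have -> : block i k = F @: [set: 'I_k.+1].
  apply/setP => j; apply/idP/imsetP => [|[m _ ->]].
    by rewrite inE => /existsP[m /eqP ->]; exists m.
  by rewrite inE; apply/existsP; exists m.
rewrite card_imset ?cardsT ?card_ord // => a b /iter_ordS_eq H.
by apply/val_inj/H; have := ltn_ord a; have := ltn_ord b; lia.
Qed.

(* The [l]-th particle after [i] on the universal cover of the ring. *)
Definition lifted X i l : nat := pos X (iter l (@ordS N) i) + L * ((i + l) %/ N).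

Lemma lifted_lt X i l : lifted X i l < lifted X i l.+1.
Proof.
have N0 : 0 < N by have := ltn_ord i; lia.
rewrite /lifted addnS /= (divnS _ N0); set j := iter l _ i.
have jE : j = (i + l) %% N :> nat by rewrite val_iter_ordS.
have jL := ltn_ord (pos X j); have jN := ltn_ord j.
have [d|nd] := boolP (N %| (i + l).+1); first by rewrite mulnDr /=; lia.
rewrite add0n ltn_add2r; apply: pos_lt => /=.
have Sj : j.+1 < N.
  rewrite ltnNge; apply: contra nd => Nj; have jN1 : j.+1 = N by lia.
  by rewrite /dvdn -addn1 -modnDml -jE addn1 jN1 modnn.
by rewrite modn_small.
Qed.

Lemma lifted_add X i l m : lifted X i l + m <= lifted X i (l + m).
Proof.
elim: m => [|m IH]; first by rewrite !addn0.
by rewrite !addnS; have := lifted_lt X i (l + m); lia.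
Qed.

Lemma ring_dist_lifted X i k : k < N ->
  ring_dist (pos X i) (pos X (iter k (@ordS N) i)) = lifted X i k - pos X i.
Proof.
move=> kN; have iN := ltn_ord i; have iL := ltn_ord (pos X i).
have kL := ltn_ord (pos X (iter k (@ordS N) i)).
have kE := val_iter_ordS k i.
rewrite /ring_dist /lifted.
have [lt|ge] := ltnP (i + k) N.
  rewrite divn_small // muln0 addn0.
  have : pos X i <= pos X (iter k (@ordS N) i) by apply: pos_le; rewrite kE modn_small //; lia.
  by move=> h; rewrite -addnBAC // modnDr modn_small //; lia.
have dE : (i + k) %/ N = 1.
  have N0 : 0 < N by lia.
  by rewrite -(subnK ge) divnDr // divnn N0 divn_small //; lia.
have mE : (i + k) %% N = i + k - N.
  by rewrite -{1}(subnK ge) modnDr modn_small //; lia.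
rewrite dE muln1; have [k0|k0] := posnP k; first by lia.
have : pos X (iter k (@ordS N) i) < pos X i by apply: pos_lt; rewrite kE mE; lia.
by move=> h; rewrite modn_small //; lia.
Qed.

(** On the universal cover each label step advances by at least one site, so a total advance of [k]
    in [k] steps leaves no slack. Conversely, [N] steps advance by exactly [L], which gives [k < L]
    and determines the number of laps. *)
Lemma contigP X i k : k < N ->
  reflect (contig X i k) (ring_dist (pos X i) (pos X (iter k (@ordS N) i)) == k).
Proof.
move=> kN; have iL := ltn_ord (pos X i); have iN := ltn_ord i.
have l0 : lifted X i 0 = pos X i by rewrite /lifted addn0 divn_small // muln0 addn0.
rewrite ring_dist_lifted //; apply: (iffP eqP) => [dk l lk|H].
  have lE : lifted X i l = pos X i + l.
    have := lifted_add X i 0 l; have := lifted_add X i l (k - l).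
    by rewrite l0 add0n subnKC //; lia.
  apply/val_inj => /=; by rewrite val_iter_ordS -lE /lifted addnC mulnC modnMDl modn_small.
have kL : k < L.
  have := lifted_add X i k (N - k); rewrite subnKC ?(ltnW kN) //.
  have -> : lifted X i N = pos X i + L.
    have N0 : 0 < N by lia.
    by rewrite /lifted iter_ordS_full divnDr // divnn N0 divn_small //; lia.
  have := lifted_add X i 0 k; rewrite l0 add0n.
  by have := ltnW kN; lia.
have := congr1 val (H k (leqnn k)) => /=; rewrite val_iter_ordS.
have := lifted_add X i 0 k; rewrite l0 add0n /lifted => ge pE.
have := lifted_add X i k (N - k); rewrite subnKC ?(ltnW kN) //.
have -> : lifted X i N = pos X i + L.
  have N0 : 0 < N by lia.
  by rewrite /lifted iter_ordS_full divnDr // divnn N0 divn_small //; lia.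
rewrite /lifted => le.
have e := divn_eq (pos X i + k) L; rewrite -pE in e.
move: ge le e; set P := val (pos X (iter _ _ _)); set D := (_ %/ N); set D' := (_ %/ L).
rewrite [D' * L]mulnC => ge le e.
suff : D = D' by move=> DD; rewrite DD; lia.
have PL : P < L by exact: ltn_ord.
have [lt|gt|//] := ltngtP D D'.
  have : L * D.+1 <= L * D' by rewrite leq_mul2l lt orbT.
  by rewrite mulnS; lia.
have : L * D'.+1 <= L * D by rewrite leq_mul2l gt orbT.
by rewrite mulnS; lia.
Qed.

(** Only the front particle of a contiguous block can collide, and only with the next particle
    outside the block. A block that contains everybody never collides. *)
Lemma displace_block_none X i k : k < N -> contig X i k ->
  displace X (block i k) (@ordS L) = None <-> k.+1 < N /\ contig X i k.+1.
Proof.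
move=> kN ct; split; last first.
  move=> [SkN ct']; case E: displace => [Y|//]; have [fI _] := relist_some E.
  set b := iter k.+1 (@ordS N) i.
  have bB : b \notin block i k.
    apply/negP => /in_block[l lk /iter_ordS_eq lE].
    by have := lE SkN (leq_ltn_trans lk kN); lia.
  have aB : iter k (@ordS N) i \in block i k by apply/in_block; exists k.
  have := fI b (iter k (@ordS N) i); rewrite (negbTE bB) aB.
  rewrite (ct' k.+1) // (ct k) // => /(_ erefl) h.
  by move: bB; rewrite h aB.
move=> /relist_none nI.
case: (boolP ((k.+1 < N) && (ring_dist (pos X i) (pos X (iter k.+1 (@ordS N) i)) == k.+1))).
  by case/andP => SkN /(contigP X i SkN).
move=> good; exfalso; apply: nI => a b.
wlog suff : a b / a \in block i k -> b \notin block i k -> ordS (pos X a) <> pos X b.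
  move=> H; case: ifPn => aB; case: ifPn => bB.
  - by move/(can_inj (@ordSK L))/pos_inj.
  - by move=> h; case: (H a b aB bB h).
  - by move=> h; case: (H b a bB aB (esym h)).
  - exact: pos_inj.
move=> aB bB h; have [l lk aE] := (in_block i k a).1 aB.
have oc : occupied X (ordS (pos X a)) by rewrite h occupied_pos.
have bE : b = iter l.+1 (@ordS N) i by apply: (pos_inj (X := X)); rewrite -h -pos_ordS // aE.
have [lk'|kl] := ltnP l k.
  by move/negP: bB; apply; apply/in_block; exists l.+1.
have lE : l = k by lia.
rewrite lE in aE bE; apply: (negP good).
have SkN : k.+1 < N.
  have [//|Nk] := ltnP k.+1 N; move/negP: bB; case; apply/in_block; exists 0 => //.
  have kN1 : k.+1 = N by lia.
  by rewrite bE kN1 iter_ordS_full.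
apply/andP; split=> //; apply/contigP => // m; rewrite leq_eqVlt => /orP[/eqP -> |mk]; last by apply: ct; lia.
by rewrite -bE -h aE (ct k).
Qed.

(** The block is the maximal run of adjacent particles from [i] on: a shorter run is obstructed by
    the next particle, a longer one is not contiguous. Hence a single block length contributes to
    the inner sum of the generator. *)
Lemma block_unique X i : exists2 k : 'I_N,
  contig X i k /\ displace X (block i k) (@ordS L) <> None &
  forall k' : 'I_N, contig X i k' -> displace X (block i k') (@ordS L) <> None -> k' = k.
Proof.
have N0 : 0 < N by have := ltn_ord i; lia.
pose P k := (k < N) && (ring_dist (pos X i) (pos X (iter k (@ordS N) i)) == k).
have exP : exists k, P k by exists 0; rewrite /P N0; apply/contigP => // -[].
have ubP k : P k -> k <= N by case/andP => /ltnW.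
case: (ex_maxnP exP ubP) => k /andP[kN /(contigP X i kN) ct] kmax.
have key (m m' : 'I_N) : contig X i m -> displace X (block i m) (@ordS L) <> None ->
    contig X i m' -> m' <= m.
  move=> cm dm cm'; rewrite leqNgt; apply/negP => lt; apply: dm.
  have m'N := ltn_ord m'.
  by apply/displace_block_none => //; split; [lia | apply: contig_leq cm'].
exists (Ordinal kN).
  split=> // /(displace_block_none kN ct)[SkN ct'].
  have := kmax k.+1; rewrite /P SkN (introT (contigP X i SkN) ct') => /(_ isT); lia.
move=> k' c' d'; apply/val_inj/eqP; rewrite eqn_leq (key k' (Ordinal kN)) // andbT.
have /kmax : P k' by rewrite /P ltn_ord (introT (contigP X i (ltn_ord k')) c').
by [].
Qed.

(** Reversal of a block move: the particle that is now at the front of the run pushes exactly the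
    run back to the left. *)
Lemma pushed_displace X Y i k : k < N -> contig X i k ->
  displace X (block i k) (@ordS L) = Some Y ->
  exists j, [/\ pos Y j = ordS (pos X (iter k (@ordS N) i)), #|pushed Y j| = k.+1 &
                displace Y (pushed Y j) (@ord_pred L) = Some X].
Proof.
move=> kN ct /(displace_inv (@ordSK L))[s [sE dE]].
have inB l : l <= k -> iter l (@ordS N) i \in block i k by move=> lk; apply/in_block; exists l.
have posY l : l <= k -> pos Y (s (iter l (@ordS N) i)) = ordS (pos X (iter l (@ordS N) i)).
  by move=> lk; rewrite sE inB.
have next l : l < k -> pos Y (s (iter l (@ordS N) i)) =
    ord_pred (pos Y (s (iter l.+1 (@ordS N) i))).
  by move=> lk; rewrite !posY ?(ltnW lk) // ordSK !ct // ltnW.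
pose e := fun c c' : 'I_N => pos Y c' == ord_pred (pos Y c).
have back c1 c2 : e c1 c2 -> c1 \in s @: block i k -> c2 \in s @: block i k.
  move=> /eqP e12 /imsetP[j /in_block[l lk jE] c1E].
  (* Behind the tail lies the old site of [i], which no particle outside the block can occupy; on a
     full ring the chain closes up on the block itself. *)
  case: l lk jE => [|l] lk jE.
    have c2E : pos Y c2 = pos X i by rewrite e12 c1E jE (posY 0) // ordSK.
    rewrite -(permKV s c2) sE in c2E *; apply: imset_f.
    case: ifPn c2E => // nB /pos_inj ji; move/negP: nB; case.
    by rewrite ji; apply/in_block; exists 0.
  have -> : c2 = s (iter l (@ordS N) i).
    by apply: (pos_inj (X := Y)); rewrite e12 c1E jE (next l).
  by apply/imset_f/inB/ltnW.
have pE : pushed Y (s (iter k (@ordS N) i)) = s @: block i k.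
  apply/setP => c; rewrite inE -/e; apply/idP/idP.
    case/connectP => pth pp ->.
    have : s (iter k (@ordS N) i) \in s @: block i k by apply/imset_f/inB.
    elim: pth (s _) pp => [//|c' pth IH] c0 /= /andP[ec pp] c0B.
    by apply: IH pp _; apply: back ec c0B.
  case/imsetP => j /in_block[l lk ->] ->.
  have : connect e (s (iter (l + (k - l)) (@ordS N) i)) (s (iter l (@ordS N) i)).
    have : l + (k - l) <= k by lia.
    elim: (k - l) => [|m IH] lmk; first by rewrite addn0.
    apply: connect_trans (IH _); last by lia.
    by rewrite addnS; apply: connect1; rewrite /e (next (l + m)) //; lia.
  by rewrite subnKC.
exists (s (iter k (@ordS N) i)); split.
- exact: posY.
- by rewrite pE card_imset ?card_block //; exact: perm_inj.
- by rewrite pE.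
Qed.

End Configurations.

(** * Counting moves and their reversals *)

Section Counting.
Variables L N : nat.
Implicit Types (X Y : config L N) (i j : 'I_N).

Lemma sum_card_pred (T : finType) (B : pred T) : \sum_i B i = #|[set i | B i]|.
Proof. by rewrite -sum1dep_card [RHS]big_mkcond; apply: eq_bigr => i _; case: (B i). Qed.

(** The set [pushed] is closed under passing to the left neighbour, so a moved particle cannot land
    on one that stays. *)
Lemma displace_pushed X i : displace X (pushed X i) (@ord_pred L) <> None.
Proof.
move=> /relist_none; apply => a b.
have out c c' : c \in pushed X i -> c' \notin pushed X i -> ord_pred (pos X c) <> pos X c'.
  rewrite !inE => ic /negP ic' e; apply: ic'; apply: connect_trans ic _.
  by apply: connect1; rewrite e.
case: ifPn => aP; case: ifPn => bP.
- by move=> /(can_inj (@ord_predK L))/pos_inj.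
- by move/(out _ _ aP bP).
- by move/esym/(out _ _ bP aP).
- exact: pos_inj.
Qed.

(** With [pulled], the same transition between [X] and [Y] seen from its two ends: [i] is the tail
    of the run in [X] here, and the pushing particle in [Y] there. In both cases [k.+1] particles
    move. *)
Definition blocked X i k Y : bool :=
  (ring_dist (pos X i) (pos X (iter k (@ordS N) i)) == k) &&
  (displace X (block i k) (@ordS L) == Some Y).

Definition pulled X i k Y : bool :=
  (#|pushed Y i| == k.+1) && (displace Y (pushed Y i) (@ord_pred L) == Some X).

Lemma blocked_leq_pulled X Y (k : 'I_N) :
  \sum_(i < N) blocked X i k Y <= \sum_(i < N) pulled X i k Y.
Proof.
rewrite !sum_card_pred; set A := [set i | _]; set B := [set i | _].
have H i : i \in A -> exists j, (j \in B) && (pos Y j == ordS (pos X (iter k (@ordS N) i))).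
  rewrite inE => /andP[/(contigP X i (ltn_ord k)) ct /eqP dE].
  have [j [pE cE dE']] := pushed_displace (ltn_ord k) ct dE.
  by exists j; rewrite inE /pulled cE dE' pE !eqxx.
pose F i := odflt i [pick j | (j \in B) && (pos Y j == ordS (pos X (iter k (@ordS N) i)))].
have FP i : i \in A -> F i \in B /\ pos Y (F i) = ordS (pos X (iter k (@ordS N) i)).
  move=> /H[j jP]; rewrite /F; case: pickP => [j' /andP[? /eqP]|/(_ j)] //.
  by rewrite jP.
have FI : {in A &, injective F}.
  move=> i j /FP[_ pi] /FP[_ pj] ij; move: pi; rewrite ij pj.
  by move=> /(can_inj (@ordSK L))/pos_inj/iter_ordS_inj.
rewrite -(card_in_imset FI); apply/subset_leq_card/fintype.subsetP => _ /imsetP[i iA ->].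
by case: (FP _ iA).
Qed.

Lemma sum_some (T : finType) (o : option T) : \sum_(y : T) (o == Some y) = isSome o.
Proof.
case: o => [z|] /=; last by rewrite big1.
rewrite (bigD1 z) //= eqxx big1 ?addn0 // => y yz.
by apply/eqP; rewrite eqb0; apply: contra yz => /eqP[->].
Qed.

Lemma sum_blocked X i : \sum_(k < N) \sum_Y blocked X i k Y = 1.
Proof.
have [k [ct dk] uk] := block_unique X i.
rewrite (bigD1 k) //= [X in _ + X]big1 ?addn0.
  under eq_bigr do rewrite /blocked (introT (contigP X i (ltn_ord k)) ct) /=.
  by rewrite sum_some; case: displace dk.
move=> k' k'k.
rewrite big1 // => Y _; apply/eqP; rewrite eqb0; apply: contra k'k.
move=> /andP[/(contigP X i (ltn_ord k')) ct' /eqP d']; apply/eqP/uk => //.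
by rewrite d'.
Qed.

Lemma pushed_card_leq X i : 0 < #|pushed X i| <= N.
Proof.
have := max_card (mem (pushed X i)); rewrite card_ord => ->; rewrite andbT card_gt0.
by apply/set0Pn; exists i; rewrite inE connect0.
Qed.

Lemma sum_pulled Y i : \sum_(k < N) \sum_X pulled X i k Y = 1.
Proof.
have /andP[c0 cN] := pushed_card_leq Y i.
have kN : #|pushed Y i|.-1 < N by lia.
rewrite (bigD1 (Ordinal kN)) //= [X in _ + X]big1 ?addn0.
  under eq_bigr do rewrite /pulled /= prednK // eqxx /=.
  by rewrite sum_some; case: displace (@displace_pushed Y i).
move=> k' k'k.
rewrite big1 // => X _; apply/eqP; rewrite eqb0; apply: contra k'k.
by move=> /andP[/eqP cE _]; apply/eqP/val_inj => /=; rewrite cE.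
Qed.

(** The injection of [blocked_leq_pulled] gives only an inequality for each triple ([X], [Y], [k]).
    Summed over all triples both sides are [N] times the number of configurations, since every
    particle has exactly one admissible block and exactly one push; so equality holds term by
    term. *)
Lemma blocked_pulled X Y (k : 'I_N) :
  \sum_(i < N) blocked X i k Y = \sum_(i < N) pulled X i k Y.
Proof.
pose I := (config L N * (config L N * 'I_N))%type.
have H (u : I) : true -> \sum_(i < N) blocked u.1 i u.2.2 u.2.1 <= \sum_(i < N) pulled u.1 i u.2.2 u.2.1
    ?= iff (\sum_(i < N) blocked u.1 i u.2.2 u.2.1 == \sum_(i < N) pulled u.1 i u.2.2 u.2.1).
  by move=> _; split=> //; apply: blocked_leq_pulled.
have [_ /esym e] := leqif_sum (P := xpredT) H.
have : [forall (u : I | true),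
    \sum_(i < N) blocked u.1 i u.2.2 u.2.1 == \sum_(i < N) pulled u.1 i u.2.2 u.2.1].
  rewrite e; apply/eqP.
  rewrite -(pair_bigA _ (fun x (v : config L N * 'I_N) => \sum_(i < N) blocked x i v.2 v.1)) /=.
  rewrite -(pair_bigA _ (fun x (v : config L N * 'I_N) => \sum_(i < N) pulled x i v.2 v.1)) /=.
  have -> : \sum_x \sum_(v : config L N * 'I_N) \sum_(i < N) blocked x i v.2 v.1 =
      \sum_(x : config L N) \sum_(i < N) 1.
    apply: eq_bigr => x _.
    rewrite -(pair_bigA _ (fun y (k : 'I_N) => \sum_(i < N) blocked x i k y)) /= exchange_big /=.
    under eq_bigr do rewrite exchange_big /=.
    by rewrite exchange_big /=; apply: eq_bigr => i _; rewrite sum_blocked.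
  rewrite [RHS]exchange_big /= -(pair_bigA _ (fun y (k : 'I_N) => \sum_x \sum_(i < N) pulled x i k y)) /=.
  apply: eq_bigr => y _.
  under [RHS]eq_bigr do rewrite exchange_big /=.
  by rewrite [RHS]exchange_big /=; apply: eq_bigr => i _; rewrite sum_pulled.
by move=> /forallP/(_ (X, (Y, k)))/eqP.
Qed.

Lemma displace1_none X i : displace X [set i] (@ordS L) = None <-> 1 < N /\ contig X i 1.
Proof.
have iN := ltn_ord i.
have -> : [set i] = block i 0.
  apply/setP => j; rewrite inE; apply/eqP/idP => [->|/in_block[[|//] _ -> //]].
  by apply/in_block; exists 0.
by apply: displace_block_none => [|[|//]]; first lia.
Qed.

Lemma displace1_pred_none X i :
  displace X [set i] (@ord_pred L) = None <-> 1 < N /\ contig X (ord_pred i) 1.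
Proof.
split=> [/relist_none nI|[N1 ct]].
  have [j /andP[ji /eqP jE]] : exists j, (j != i) && (pos X j == ord_pred (pos X i)).
    apply/existsP; apply: contra_notT nI => /existsPn H a b.
    rewrite !inE; case: eqP => [->|_]; case: eqP => [-> //|_].
    - move=> e; have := H b; rewrite e eqxx andbT negbK => /eqP bi.
      by rewrite bi in e *.
    - move=> e; have := H a; rewrite e eqxx andbT negbK => /eqP //.
    - exact: pos_inj.
  have oc : occupied X (ord_pred (pos X i)) by rewrite -jE occupied_pos.
  have pE := pos_ord_pred oc.
  split.
    have := ltn_ord i; have := ltn_ord j; move: ji; rewrite -val_eqE /=; lia.
  move=> [|[|//]] _ //=; by rewrite ord_predK pE ord_predK.
case E: displace => [Y|//]; have [fI _] := relist_some E.
have := fI i (ord_pred i); rewrite !inE eqxx.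
have pE : pos X i = ordS (pos X (ord_pred i)) by have := ct 1 (leqnn _); rewrite /= ord_predK.
case: eqP => [e|ne]; last by rewrite pE ordSK => /(_ erefl)/esym.
have := congr1 val (ord_predK i); rewrite e /=.
have [lt|ge] := ltnP i.+1 N; first by rewrite modn_small //; lia.
have -> : i.+1 = N by have := ltn_ord i; lia.
by rewrite modnn; lia.
Qed.

(** A right jump of [i] and a left jump of [ordS i] are obstructed under the same condition, namely
    that these two particles are adjacent. *)
Lemma exits_eq X : \sum_(i < N) isSome (displace X [set i] (@ordS L)) =
  \sum_(i < N) isSome (displace X [set i] (@ord_pred L)).
Proof.
rewrite [RHS](reindex_inj (can_inj (@ordSK N))) /=; apply: eq_bigr => i _; congr nat_of_bool.
have h := displace1_none X i; have h' := displace1_pred_none X (ordS i); rewrite ordSK in h'.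
case: displace h => [?|] h; case: displace h' => [?|] h' //=.
  by have := h.2 (h'.1 erefl).
by have := h'.2 (h.1 erefl).
Qed.

Lemma jump_leq step step' X Y : cancel step step' ->
  \sum_(i < N) (displace X [set i] step == Some Y) <=
  \sum_(i < N) (displace Y [set i] step' == Some X).
Proof.
move=> stepK; rewrite !sum_card_pred.
set A := [set i | _]; set B := [set i | _].
have H i : i \in A -> exists j, (j \in B) && (pos Y j == step (pos X i)).
  rewrite inE => /eqP/(displace_inv stepK)[s [sE dE]].
  by exists (s i); rewrite inE sE !inE !eqxx -imset_set1 dE eqxx.
pose F i := odflt i [pick j | (j \in B) && (pos Y j == step (pos X i))].
have FP i : i \in A -> F i \in B /\ pos Y (F i) = step (pos X i).
  move=> /H[j jP]; rewrite /F; case: pickP => [j' /andP[? /eqP]|/(_ j)] //.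
  by rewrite jP.
have FI : {in A &, injective F}.
  move=> i j /FP[_ pi] /FP[_ pj] ij; move: pi; rewrite ij pj.
  by move=> /(can_inj stepK)/pos_inj.
rewrite -(card_in_imset FI); apply/subset_leq_card/fintype.subsetP => _ /imsetP[i iA ->].
by case: (FP _ iA).
Qed.

Lemma jump_inv X Y : \sum_(i < N) (displace X [set i] (@ordS L) == Some Y) =
  \sum_(i < N) (displace Y [set i] (@ord_pred L) == Some X).
Proof.
by apply/eqP; rewrite eqn_leq (jump_leq _ _ (@ordSK L)) (jump_leq _ _ (@ord_predK L)).
Qed.

End Counting.

(** * The inequality between the exponents *)

Section Combinatorics.
Local Open Scope nat_scope.
Variables (L N : nat).

(** Induction by removing the largest element, which is at least the number of the others. *)
Lemma leq_bin2_sum (A : {set 'I_N}) : 'C(#|A|, 2) <= \sum_(i in A) i.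
Proof.
have [m] := ubnP #|A|; elim: m A => // m IH A Am.
have [->|/set0Pn[i0 i0A]] := eqVneq A finset.set0; first by rewrite cards0.
case: (arg_maxnP (fun i : 'I_N => i : nat) i0A) => i iA imax.
have {}iA : i \in A := iA.
rewrite (cardsD1 i A) iA (big_setD1 i) //= add1n binS bin1 addnC leq_add //.
  pose f := widen_ord (ltnW (ltn_ord i)).
  rewrite -[X in _ <= X]card_ord; apply: leq_trans (leq_imset_card f predT).
  apply/subset_leq_card/fintype.subsetP => j; rewrite !inE => /andP[ji jA].
  have lt : j < i by rewrite ltn_neqAle ji /=; apply: imax.
  by apply/imsetP; exists (Ordinal lt) => //; apply/val_inj.
by apply: IH; move: Am; rewrite (cardsD1 i A) iA add1n ltnS.
Qed.

(** The extreme cases are the m smallest labels sent to the m largest, where the two sums differ by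
    m(N - m). The upper bound for the images is [leq_bin2_sum] after [rev_ord]. *)
Lemma sum_perm_leq (A : {set 'I_N}) (s : {perm 'I_N}) :
  \sum_(j in A) s j <= \sum_(j in A) j + #|A| * (N - #|A|).
Proof.
have E (f : 'I_N -> 'I_N) : injective f -> 'C(#|A|, 2) <= \sum_(j in A) f j.
  move=> fI; rewrite -(card_imset (mem A) fI) -(big_imset (fun j => nat_of_ord j)) /=; last by move=> *; exact: fI.
  exact: leq_bin2_sum.
have H1 := leq_bin2_sum A.
have H2 : 'C(#|A|, 2) <= \sum_(j in A) rev_ord (s j).
  by apply: (E (fun j => rev_ord (s j))) => i j /rev_ord_inj /perm_inj.
have H3 : \sum_(j in A) rev_ord (s j) + \sum_(j in A) s j = #|A| * N.-1.
  rewrite -big_split /= (eq_bigr (fun=> N.-1)) ?sum_nat_const // => j _ /=.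
  by have := ltn_ord (s j); lia.
have AN : #|A| <= N by rewrite -[X in _ <= X]card_ord max_card.
have c2 : 'C(#|A|, 2) * 2 = #|A| * #|A|.-1.
  by rewrite bin2 muln2 halfK (_ : odd _ = false) ?subn0 //; case: #|A| => //= m; rewrite oddM /=; case: (odd m).
move: AN c2 H1 H2 H3; move: #|A| 'C(_, 2) => m c AN c2 H1 H2 H3.
case: m AN c2 H3 => [|m] AN /= c2 H3; first by move: H3; rewrite !mul0n; lia.
have e1 : m.+1 * (N - m.+1) + m.+1 * m + m.+1 = m.+1 * N by rewrite mulnBr; nia.
have e2 : m.+1 * N.-1 + m.+1 = m.+1 * N by nia.
move: H2 H3 => /=; move: (\sum_(j in A) (N - (s j).+1)) (\sum_(j in A) s j) (\sum_(j in A) nat_of_ord j) H1 => S2 S S1 H1 H2 H3.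
move: (m.+1 * N.-1) (m.+1 * (N - m.+1)) (m.+1 * N) (m.+1 * m) c2 e1 e2 H3 => a b c1 d; clear -H1 H2; lia.
Qed.

Variables (x y : 'I_N -> nat).
Hypotheses (x_mono : forall i j : 'I_N, i < j -> x i < x j) (x_lt : forall i, x i < L).
Hypotheses (y_mono : forall i j : 'I_N, i < j -> y i < y j).

Lemma mono_gap (z : 'I_N -> nat) (i j : 'I_N) : (forall i j : 'I_N, i < j -> z i < z j) ->
  i <= j -> z i + j <= z j + i.
Proof.
move=> z_mono; move: {2}(j - i) (erefl (j - i)) => d; elim: d j => [|d IH] j dE ij.
  by have -> : i = j by apply/val_inj => /=; lia.
have j1 : j.-1 < N by have := ltn_ord j; lia.
have := IH (Ordinal j1) => /= /(_ _ _)/wrap[]; try lia.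
by have := z_mono (Ordinal j1) j => /= /(_ _)/wrap[]; lia.
Qed.

Lemma mono_ge (j : 'I_N) : j <= y j.
Proof.
have N0 : 0 < N by have := ltn_ord j; lia.
by have := @mono_gap y (Ordinal N0) j y_mono (leq0n _) => /=; lia.
Qed.

Lemma mono_le (j : 'I_N) : x j + N <= L + j.
Proof.
have N0 : N.-1 < N by have := ltn_ord j; lia.
have := @mono_gap x j (Ordinal N0) x_mono; have := x_lt (Ordinal N0) => /=.
by have := ltn_ord j; lia.
Qed.

(** In the spectral sum [r j] is the order in the expansion of the [j]-th root, orthogonality of
    roots of unity produces [k], and [m < r j] makes the [j]-th coefficient vanish. Suppose that no
    such [j] exists. If K, the sum of [k], is positive, the labels with [k j > 0] satisfy j + N k_j
    < s_j + K, and summing over them contradicts [sum_perm_leq]. If K = 0, the remaining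
    inequalities force s = 1 and x = y label by label. *)
Lemma bethe_exponents (r k : 'I_N -> nat) (s : {perm 'I_N}) :
  N <= L -> (forall j, r j + x (s j) = L * k j + y j) ->
  (exists (j : 'I_N) (m : nat), j + N * k j = m + s j + \sum_i k i /\ m < r j)
  \/ [/\ s = 1%g, x =1 y & forall j, r j = 0].
Proof.
move=> NL rE; pose K := \sum_i k i.
have [/existsP[j /andP[jm jr]]|/existsPn H] :=
  boolP [exists j : 'I_N, (s j + K <= j + N * k j) && (j + N * k j < r j + s j + K)].
  by left; exists j, (j + N * k j - (s j + K)); split; rewrite /K in jm jr *; lia.
right.
have {}H (j : 'I_N) : (j + N * k j < s j + K) || (r j + s j + K <= j + N * k j).
  by have := H j; lia.
have K0 : K = 0.
  apply/eqP; rewrite -leqn0 leqNgt; apply/negP => K0.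
  pose A := [set j | 0 < k j].
  have KA : K = \sum_(j in A) k j.
    rewrite /K (bigID (mem A)) /= [X in _ + X]big1 ?addn0 // => j.
    by rewrite inE; lia.
  (* The other alternative would give (L - N)(k_j - 1) + K <= 0, by j <= y_j and x_i + N <= L +
     i. *)
  have kA (j : 'I_N) : j \in A -> j + N * k j + 1 <= s j + K.
    rewrite inE => kj; have := H j; have := rE j; have := mono_ge j; have := mono_le (s j).
    have : N * k j + L <= L * k j + N by nia.
    by lia.
  have := sum_perm_leq A s.
  have : \sum_(j in A) (j + N * k j + 1) <= \sum_(j in A) (s j + K) by apply: leq_sum.
  rewrite !big_split /= -big_distrr /= -KA !sum_nat_const.
  have AK : #|A| <= K.
    by rewrite KA -sum1_card; apply: leq_sum => j; rewrite inE.
  have A0 : 0 < #|A|.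
    apply/card_gt0P; move: K0; rewrite KA lt0n sum_nat_eq0 negb_forall => /existsP[j].
    by rewrite negb_imply => /andP[jA _]; exists j.
  have AN : #|A| <= N by rewrite -[X in _ <= X]card_ord max_card.
  move: (\sum_(i in A) s i) (\sum_(i in A) nat_of_ord i) => S S1.
  move: (subnK AN) A0 AK; move: (N - #|A|) (#|A|) => d m <- A0 AK H1 H2.
  (* With m = [#|A|] and d = N - m the two sums leave d K + m <= d m, which is impossible for 0 < m
     <= K. *)
  have dK : d * m <= d * K by rewrite leq_mul2l AK orbT.
  by nia.
have k0 j : k j = 0.
  by move/eqP: K0; rewrite sum_nat_eq0 => /forallP/(_ j)/eqP.
have {}rE j : r j + x (s j) = y j by rewrite rE k0 muln0.
have {}H (j : 'I_N) : (j < s j) || (r j + s j <= j).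
  by have := H j; rewrite k0 K0 muln0 !addn0.
have P (l : 'I_N) : s l = l /\ x l = y l.
  have [m] := ubnP (nat_of_ord l); elim: m l => // m IH l lm.
  have fixl (i : 'I_N) : i < l -> s i = i by move=> il; apply: (proj1 (IH _ _)); lia.
  have sge (j : 'I_N) : l <= j -> l <= s j.
    move=> lj; rewrite leqNgt; apply/negP => sl; have := fixl _ sl => /perm_inj E.
    by rewrite E in sl; lia.
  (* The inequality at this preimage gives y_l <= x_l, while r_l >= 0 gives x_(s l) <= y_l; as x_l
     <= x_(s l), all three coincide. *)
  pose j := (s^-1)%g l; have sj : s j = l by rewrite /j permKV.
  have lj : l <= j.
    by rewrite leqNgt; apply/negP => jl; have := fixl _ jl; rewrite sj => E; rewrite -E ltnn in jl.
  have xmono (i i' : 'I_N) : i <= i' -> x i <= x i'.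
    by move=> ii'; have := mono_gap x_mono ii'; lia.
  have h1 := rE l; have h2 := rE j; have h3 := H j.
  have h4 := xmono _ _ (sge l (leqnn l)); have h5 := mono_gap y_mono lj.
  rewrite sj in h2 h3.
  have xy : x l = y l by lia.
  split=> //; apply/eqP; case: (eqVneq (s l) l) => // /eqP sl.
  have : l < s l by rewrite ltn_neqAle sge // andbT; apply/eqP => E; apply: sl; apply/val_inj.
  by move/x_mono; lia.
split; [|by move=> j; have [] := P j | by move=> j; have := rE j; have [-> ->] := P j; lia].
by apply/permP => j; rewrite perm1; have [] := P j.
Qed.

End Combinatorics.

Local Open Scope ring_scope.

(** * A real-valued modulus on the complex numbers *)

Notation nm := ComplexField.Normc.normc.

Section Norm.
Local Open Scope complex_scope.
Variable R : realType.
Implicit Types x y z : R[i].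

Lemma normCE x : `|x| = (nm x)%:C.
Proof. by rewrite normc_def; case: x. Qed.

Lemma nm_ge0 x : 0 <= nm x.
Proof. by rewrite -lecR -normCE; exact: normr_ge0. Qed.

Lemma nm0 : nm (0 : R[i]) = 0. Proof. exact: ComplexField.Normc.normc0. Qed.
Lemma nm1 : nm (1 : R[i]) = 1. Proof. exact: ComplexField.Normc.normc1. Qed.
Lemma nmM x y : nm (x * y) = nm x * nm y. Proof. exact: ComplexField.Normc.normcM. Qed.
Lemma nmV x : nm x^-1 = (nm x)^-1. Proof. exact: ComplexField.Normc.normcV. Qed.
Lemma nmN x : nm (- x) = nm x.
Proof. by apply: complexI; rewrite -!normCE normrN. Qed.
Lemma nmD x y : nm (x + y) <= nm x + nm y.
Proof. by rewrite -lecR rmorphD /= -!normCE; exact: ler_normD. Qed.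
Lemma nmB x y : nm (x - y) <= nm x + nm y.
Proof. by rewrite -(nmN y); exact: nmD. Qed.
Lemma nm_sub x y : nm x - nm y <= nm (x - y).
Proof. by rewrite lerBlDr -{1}(subrK y x); exact: nmD. Qed.
Lemma nm_distC x y : nm (x - y) = nm (y - x).
Proof. by rewrite -nmN opprB. Qed.
Lemma nmX x n : nm (x ^+ n) = nm x ^+ n.
Proof. by elim: n => [|n IH]; rewrite ?expr0 ?nm1 // !exprS nmM IH. Qed.
Lemma nm_eq0 x : (nm x == 0) = (x == 0).
Proof. by rewrite -(inj_eq (@complexI R)) -normCE normr_eq0. Qed.
Lemma nm_gt0 x : (0 < nm x) = (x != 0).
Proof. by rewrite lt_def nm_ge0 nm_eq0 andbT. Qed.
Lemma nm_nat n : nm (n%:R : R[i]) = n%:R.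
Proof. by apply: complexI; rewrite -normCE normr_nat rmorph_nat. Qed.
Lemma nmC (a : R) : 0 <= a -> nm a%:C = a.
Proof. by move=> a0; apply: complexI; rewrite -normCE ger0_norm // ler0c. Qed.
Lemma nm_sum (I : Type) (s : seq I) (P : pred I) (f : I -> R[i]) :
  nm (\sum_(i <- s | P i) f i) <= \sum_(i <- s | P i) nm (f i).
Proof.
elim/big_rec2: _ => [|i a b _ H]; first by rewrite nm0.
by apply: le_trans (nmD _ _) _; rewrite lerD2l.
Qed.
Lemma nm_prod (I : Type) (s : seq I) (P : pred I) (f : I -> R[i]) :
  nm (\prod_(i <- s | P i) f i) = \prod_(i <- s | P i) nm (f i).
Proof. by elim/big_rec2: _ => [|i a b _ <-]; rewrite ?nm1 ?nmM. Qed.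

End Norm.

(** * The generator as the transpose of a jump kernel *)

Section Adjoint.
Local Open Scope complex_scope.
Variables (R : realType) (L N : nat).
Local Notation C := R[i].
Implicit Types (X x y : config L N) (i : 'I_N).

(** Jump rates of the configuration, weighted by [zeta] to the power of the current gained; a push
    carries one negative power per moved particle. The kernel is indexed by the source of a move,
    whereas the generator is written from its target. *)
Definition jump_kernel (p q : R) (zeta : C) y x : C :=
  p%:C * (\sum_(i < N) oapp (fun X' => zeta * (X' == x)%:R - (y == x)%:R) 0
    (displace y [set i] (@ordS L)))
  + q%:C * (\sum_(i < N) (oapp (fun X' => zeta ^- #|pushed y i| * (X' == x)%:R) 0
    (displace y (pushed y i) (@ord_pred L)) - (y == x)%:R)).

Lemma oapp_sum (T : finType) (f : T -> C) (o : option T) :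
  oapp f 0 o = \sum_y (o == Some y)%:R * f y.
Proof.
case: o => [z|] /=; last by rewrite big1 // => y _; rewrite mul0r.
rewrite (bigD1 z) //= eqxx mul1r big1 ?addr0 // => y yz.
case: eqP => [[zy]|]; last by rewrite mul0r.
by rewrite zy eqxx in yz.
Qed.

Lemma oapp_const (T : finType) (c : C) (o : option T) : oapp (fun=> c) 0 o = (isSome o)%:R * c.
Proof. by case: o => /=; rewrite ?mul1r ?mul0r. Qed.

Lemma oapp_sub (T : finType) (f g : T -> C) (o : option T) :
  oapp (fun z => f z - g z) 0 o = oapp f 0 o - oapp g 0 o.
Proof. by case: o => //=; rewrite subr0. Qed.

Lemma oapp_delta (T : finType) (c : C) (x : T) (o : option T) :
  oapp (fun z => c * (z == x)%:R) 0 o = c * (o == Some x)%:R.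
Proof. by case: o => //=; rewrite mulr0. Qed.

(** The gain terms match by reversing moves ([jump_inv], [blocked_pulled]). The loss terms match
    because left and right jumps are obstructed equally often and each particle has exactly one
    admissible block. *)
Lemma generator_adjoint (p q : R) (zeta : C) (g : config L N -> C) x :
  \sum_y g y * jump_kernel p q zeta y x = generator p q zeta g x.
Proof.
have diag (F : config L N -> C) : \sum_y g y * (F y * (y == x)%:R) = g x * F x.
  rewrite (bigD1 x) //= eqxx mulr1 big1 ?addr0 // => y /negbTE ->.
  by rewrite !mulr0.
have jumps : \sum_y g y * (\sum_(i < N) oapp (fun X' => zeta * (X' == x)%:R - (y == x)%:R) 0
    (displace y [set i] (@ordS L))) =
    \sum_(i < N) oapp (fun X' => zeta * g X' - g x) 0 (displace x [set i] (@ord_pred L)).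
  have -> : \sum_(i < N) oapp (fun X' => zeta * g X' - g x) 0 (displace x [set i] (@ord_pred L)) =
      (\sum_y zeta * g y * (\sum_(i < N) (displace x [set i] (@ord_pred L) == Some y))%N%:R)
      - (\sum_(i < N) isSome (displace x [set i] (@ord_pred L)))%N%:R * g x.
    rewrite natr_sum mulr_suml.
    under eq_bigr do rewrite oapp_sub oapp_const oapp_sum.
    rewrite sumrB; congr (_ - _); rewrite exchange_big; apply: eq_bigr => y _ /=.
    by rewrite natr_sum mulr_sumr; apply: eq_bigr => i _; rewrite mulrC.
  under eq_bigr => y _.
    under eq_bigr do rewrite oapp_sub oapp_const oapp_delta.
    rewrite sumrB mulrBr -mulr_sumr -natr_sum -mulr_suml -natr_sum.
    over.
  rewrite sumrB diag exits_eq [g x * _]mulrC; congr (_ - _).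
  by apply: eq_bigr => y _; rewrite jump_inv; ring.
have pushes : \sum_y g y * (\sum_(i < N) (oapp (fun X' => zeta ^- #|pushed y i| * (X' == x)%:R) 0
    (displace y (pushed y i) (@ord_pred L)) - (y == x)%:R)) =
    \sum_(i < N) \sum_(k < N)
      if ring_dist (pos x i) (pos x (iter k (@ordS N) i)) == k then
        oapp (fun X' => zeta ^- k.+1 * g X' - g x) 0
          (displace x (block i k) (@ordS L))
      else 0.
  have -> : \sum_(i < N) \sum_(k < N)
      (if ring_dist (pos x i) (pos x (iter k (@ordS N) i)) == k then
        oapp (fun X' => zeta ^- k.+1 * g X' - g x) 0
          (displace x (block i k) (@ordS L))
      else 0) = \sum_(i < N) \sum_(k < N) \sum_y
        (blocked x i k y)%:R * (zeta ^- k.+1 * g y - g x).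
    apply: eq_bigr => i _; apply: eq_bigr => k _; rewrite /blocked.
    case: ifP => _ /=; last by rewrite big1 // => y _; rewrite mul0r.
    by rewrite oapp_sum.
  have -> : \sum_(i < N) \sum_(k < N) \sum_y (blocked x i k y)%:R * (zeta ^- k.+1 * g y - g x) =
      \sum_y \sum_(k < N) zeta ^- k.+1 * g y * (\sum_(i < N) blocked x i k y)%N%:R - N%:R * g x.
    transitivity (\sum_(i < N) \sum_(k < N) \sum_y (blocked x i k y)%:R * (zeta ^- k.+1 * g y)
        - \sum_(i < N) \sum_(k < N) \sum_y (blocked x i k y)%:R * g x).
      rewrite -sumrB; apply: eq_bigr => i _; rewrite -sumrB; apply: eq_bigr => k _.
      by rewrite -sumrB; apply: eq_bigr => y _; rewrite mulrBr.
    congr (_ - _).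
      under eq_bigr do rewrite exchange_big /=.
      rewrite exchange_big; apply: eq_bigr => y _ /=; rewrite exchange_big; apply: eq_bigr => k _ /=.
      by rewrite natr_sum mulr_sumr; apply: eq_bigr => i _; rewrite mulrC.
    transitivity (\sum_(i < N) (\sum_(k < N) \sum_y blocked x i k y)%N%:R * g x).
      apply: eq_bigr => i _; rewrite natr_sum mulr_suml; apply: eq_bigr => k _.
      by rewrite natr_sum mulr_suml.
    under eq_bigr do rewrite sum_blocked mul1r.
    by rewrite sumr_const card_ord mulr_natl.
  under eq_bigr => y _.
    rewrite sumrB sumr_const card_ord mulrBr -[_ *+ N]mulr_natl.
    over.
  rewrite sumrB diag [g x * _]mulrC; congr (_ - _); apply: eq_bigr => y _.
  under [RHS]eq_bigr do rewrite blocked_pulled natr_sum mulr_sumr.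
  rewrite exchange_big mulr_sumr /=; apply: eq_bigr => i _.
  rewrite oapp_delta /pulled; have /andP[c0 cN] := pushed_card_leq y i.
  have kN : (#|pushed y i|.-1 < N)%N by lia.
  rewrite (bigD1 (Ordinal kN)) //= prednK // eqxx [X in _ + X]big1 ?addr0; first by ring.
  move=> k; rewrite -val_eqE /= => kn; case: eqP => [e|_ /=]; last by rewrite mulr0.
  by rewrite e eqxx in kn.
rewrite /jump_kernel /generator -jumps -pushes.
under eq_bigr do rewrite mulrDr mulrCA [X in _ + X]mulrCA.
by rewrite big_split /= -!mulr_sumr.
Qed.

End Adjoint.

(** * Eigenfunctions *)

Lemma odd_ordS n : (0 < n)%N -> perm (can_inj (@ordSK n)) = odd n.-1 :> bool.
Proof.
case: n => [//|n] _ /=.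
have -> : perm (can_inj (@ordSK n.+1)) = lift_perm ord_max ord0 1.
  apply/permP => j; rewrite permE; case: (unliftP ord_max j) => [k|] ->.
    rewrite lift_perm_lift perm1; apply/val_inj => /=.
    by rewrite /bump leqNgt ltn_ord modn_small ?ltnS // ltn_ord.
  by rewrite lift_perm_id; apply/val_inj; rewrite /= modnn.
by rewrite odd_lift_perm /= odd_perm1 !addbF.
Qed.

(** * The Bethe determinant and its two relations *)

Section BetheDet.
Variables (K : fieldType) (N : nat) (a b : 'I_N -> K) (zeta : K).
Hypothesis a0 : forall k, a k != 0.
Hypothesis b0 : forall k, b k != 0.
Implicit Types (p : 'I_N -> int) (i j k : 'I_N).

(** Rows are particles, columns are roots; in the application a = 1 - 1/w and b = zeta/w. The
    positions are arbitrary integers: they may coincide, be out of order or leave the window 0, ...,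
    L - 1, so that a single particle can be moved regardless of the others. *)
Definition bethe_mx p : 'M[K]_N := \matrix_(j, k) (a k ^ (k%:Z - j%:Z) * b k ^ p j).

Lemma bethe_mx_eq p p' : p =1 p' -> bethe_mx p = bethe_mx p'.
Proof. by move=> pp'; apply/matrixP => j k; rewrite !mxE pp'. Qed.

Lemma det_bethe_mx p : \det (bethe_mx p) =
  \sum_(s : 'S_N) (-1) ^+ s * (\prod_j a (s j) ^ ((s j)%:Z - j%:Z)) * \prod_j b (s j) ^ p j.
Proof.
apply: eq_bigr => s _; rewrite -mulrA -big_split /=; congr (_ * _).
by apply: eq_bigr => j _; rewrite mxE.
Qed.

Hypothesis ab : forall k, b k - zeta = - zeta * a k.

(** Since b = zeta - zeta a, the row of the advanced particle is zeta times its old row minus zeta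
    times the row of the particle behind it. The second part repeats a row and contributes
    nothing. *)
Lemma bethe_mx_merge p p' i i' : i' = i.+1 :> nat -> p i' = p i ->
  p' i' = p i' + 1 -> (forall j, j != i' -> p' j = p j) ->
  \det (bethe_mx p') = zeta * \det (bethe_mx p).
Proof.
move=> i'E pE p'E p'j.
pose C := \matrix_(j, k) (bethe_mx p (if j == i' then i else j) k).
have ii' : i != i' by rewrite -val_eqE /= i'E; lia.
have C0 : \det C = 0.
  apply: (determinant_alternate ii') => k; rewrite !mxE eqxx.
  by rewrite (negbTE ii').
rewrite (@determinant_multilinear _ _ (bethe_mx p') (bethe_mx p) C i' zeta (- zeta)).
- by rewrite C0 mulr0 addr0.
- apply/rowP => k; rewrite !mxE eqxx p'E pE [b k ^ _]expfzDr // expr1z.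
  have -> : a k ^ (k%:Z - i%:Z) = a k * a k ^ (k%:Z - i'%:Z).
    have -> : k%:Z - i%:Z = 1 + (k%:Z - i'%:Z) by rewrite i'E; lia.
    by rewrite [LHS]expfzDr // expr1z.
  move: (a k ^ _) (b k ^ _) (ab k) => x y abk.
  have -> : b k = zeta + - zeta * a k by rewrite -abk; ring.
  by ring.
- by apply/matrixP => j k; rewrite !mxE p'j // eq_sym neq_lift.
- by apply/matrixP => j k; rewrite !mxE [lift _ _ == _]eq_sym (negbTE (neq_lift _ _)) p'j // eq_sym neq_lift.
Qed.

Hypothesis N0 : (0 < N)%N.
Variable (L : nat).
Hypothesis periodic : forall k, b k ^+ L * \prod_j a j = (-1) ^+ N.-1 * a k ^+ N.

Definition cyc : 'S_N := perm (can_inj (@ordSK N)).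

Lemma odd_cyc : (-1) ^+ cyc = (-1) ^+ N.-1 :> K.
Proof.
by rewrite odd_ordS // signr_odd.
Qed.

(** Shifting the labels by one scales column [k] by [a k]. In the row that crosses the boundary,
    periodicity leaves the factor (-1)^(N-1) / prod a. The products cancel, and the sign is that of
    the N-cycle. *)
Lemma bethe_mx_rot p :
  \det (bethe_mx (fun j => p (ordS j) + (if j.+1 == N then L%:Z else 0))) = \det (bethe_mx p).
Proof.
have A0 : \prod_j a j != 0 by apply/prodf_neq0.
pose d : 'rV[K]_N := \row_j (if j.+1 == N then (-1) ^+ N.-1 / \prod_j a j else 1).
have -> : bethe_mx (fun j => p (ordS j) + (if j.+1 == N then L%:Z else 0)) =
    diag_mx d *m row_perm cyc (bethe_mx p) *m diag_mx (\row_k a k).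
  apply/matrixP => j k; rewrite mul_mx_diag mul_diag_mx !mxE permE [b k ^ _]expfzDr //.
  case: ifP => [/eqP jN|jN].
    have -> : (ordS j)%:Z = 0 by rewrite /= jN modnn.
    rewrite subr0 -exprnP (_ : j%:Z = N%:Z - 1); last by lia.
    rewrite opprB addrA expfzDr // expfzDr // expr1z -exprnN.
    have e : b k ^+ L = (-1) ^+ N.-1 * a k ^+ N / \prod_j a j by rewrite -periodic mulfK.
    rewrite e; move: (a k ^ _) (b k ^ _) (_ ^+ N.-1) (\prod_j _) A0 (expf_neq0 N (a0 k)) => u v sg P P0 aN.
    by field; rewrite P0 aN.
  rewrite expr0z mulr1 mul1r (_ : (ordS j)%:Z = j%:Z + 1); last first.
    by rewrite /= modn_small ?addn1 //; have := ltn_ord j; lia.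
  rewrite mulrAC; congr (_ * _); rewrite -[X in _ * X]expr1z -expfzDr //; congr (_ ^ _); lia.
rewrite row_permE !det_mulmx !det_diag det_perm odd_cyc.
have -> : \prod_i (\row_k a k) 0 i = \prod_j a j by apply: eq_bigr => j _; rewrite mxE.
have -> : \prod_i d 0 i = (-1) ^+ N.-1 / \prod_j a j.
  have lt : (N.-1 < N)%N by lia.
  rewrite (bigD1 (Ordinal lt)) //= mxE /= prednK // eqxx [X in _ * X]big1 ?mulr1 // => i iN.
  rewrite mxE; case: eqP => // iE; move: iN; rewrite -val_eqE /=; lia.
have sg : (-1) ^+ N.-1 * (-1) ^+ N.-1 = 1 :> K by rewrite -expr2 sqrr_sign.
transitivity ((-1) ^+ N.-1 * (-1) ^+ N.-1 * \det (bethe_mx p)); last by rewrite sg mul1r.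
by field.
Qed.

(** In the permutation expansion a shift of row [i] multiplies the term of [s] by [b (s i) ^ e]; the
    sum of these factors over [i] does not depend on [s]. *)
Lemma bethe_mx_shift_sum (c : 'I_N -> K) (e : int) p : (forall k, c k = b k ^ e) ->
  \sum_i \det (bethe_mx (fun j => p j + (if j == i then e else 0))) =
  (\sum_k c k) * \det (bethe_mx p).
Proof.
move=> cE; under eq_bigr do rewrite det_bethe_mx.
rewrite exchange_big det_bethe_mx mulr_sumr; apply: eq_bigr => s _ /=.
rewrite -mulr_sumr [RHS]mulrCA; congr (_ * _).
rewrite [\sum_k c k](reindex_inj (@perm_inj _ s)) mulr_suml; apply: eq_bigr => i _ /=.
under eq_bigr do rewrite [b _ ^ _]expfzDr //.
rewrite big_split /= mulrC; congr (_ * _).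
rewrite (bigD1 i) //= eqxx -cE [X in _ * X]big1 ?mulr1 // => j /negbTE ->.
by rewrite expr0z.
Qed.

(* [p (ordS i)] is one lap short of [p i] when the particle [i] has crossed the end
   of the window. *)
Lemma bethe_mx_push p i : ordS i != i ->
  p (ordS i) + (if i.+1 == N then L%:Z else 0) = p i ->
  \det (bethe_mx (fun j => p j + (j == ordS i)%:Z)) = zeta * \det (bethe_mx p).
Proof.
move=> Si; case: ifPn => [/eqP iN|iN] pE.
  have S0 : ordS i = 0 :> nat by rewrite /= iN modnn.
  rewrite -bethe_mx_rot -[in RHS]bethe_mx_rot.
  have i0 : (0 < i)%N.
    by rewrite lt0n; apply: contraNneq Si => i0; apply/eqP/val_inj; rewrite /= iN modnn.
  have E : i = (ord_pred i).+1 :> nat.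
    have -> : ord_pred i = i.-1 :> nat.
      rewrite /= (_ : (i + N).-1 = i.-1 + N)%N; last by lia.
      by rewrite modnDr modn_small //; have := ltn_ord i; lia.
    by lia.
  apply: (@bethe_mx_merge _ _ (ord_pred i) i) => //.
  - rewrite -E ord_predK iN eqxx pE; case: eqP => [|_]; first by have := ltn_ord i; lia.
    by rewrite addr0.
  - by rewrite !eqxx addrAC.
  - move=> j ji; congr (_ + _); case: eqP => [/(can_inj (@ordSK N)) /eqP|_]; last by rewrite addr0.
    by rewrite (negbTE ji).
apply: (@bethe_mx_merge _ _ i (ordS i)).
- by rewrite /= modn_small //; have := ltn_ord i; lia.
- by rewrite -pE addr0.
- by rewrite eqxx.
- by move=> j /negbTE ->; rewrite addr0.
Qed.

End BetheDet.

Lemma mono_perm N (s : {perm 'I_N}) : (forall i j : 'I_N, (i < j)%N -> (s i < s j)%N) -> s = 1%g.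
Proof.
move=> sm; apply/permP => j; rewrite perm1; apply/val_inj/eqP; rewrite eqn_leq.
rewrite (mono_ge (y := fun i => s i)) // andbT.
have := @mono_le N N (fun i => s i) sm (fun i => ltn_ord (s i)) j => /=; lia.
Qed.

(** * From unordered positions to exclusion and pushing *)

Section Eigenfunction.
Local Open Scope complex_scope.
Variables (R : realType) (L N : nat).
Local Notation C := R[i].
Variables (zeta : C) (w : {ffun 'I_N -> C}).
Hypothesis z0 : zeta != 0.
Hypothesis w0 : forall k, w k != 0.
Let a k := 1 - (w k)^-1.
Let b k := zeta / w k.
Hypothesis a0 : forall k, a k != 0.
Hypothesis N0 : (0 < N)%N.
Hypothesis roots : forall k, w k ^+ L * a k ^+ N = (-1) ^+ N.+1 * zeta ^+ L * \prod_j a j.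
Implicit Types (X Y : config L N) (i j k : 'I_N).

Let b0 k : b k != 0. Proof. by rewrite mulf_neq0 ?invr_eq0. Qed.
Let ab k : b k - zeta = - zeta * a k. Proof. by rewrite /a /b; ring. Qed.

Let periodic k : b k ^+ L * \prod_j a j = (-1) ^+ N.-1 * a k ^+ N.
Proof.
rewrite /b exprMn exprVn.
have wL : w k ^+ L != 0 by rewrite expf_neq0.
apply: (mulfI wL); rewrite mulrCA [RHS]mulrCA roots.
have -> : (-1) ^+ N.+1 = (-1) ^+ N.-1 :> C by rewrite -{1}(prednK N0) exprS exprS; ring.
have sg : (-1) ^+ N.-1 * (-1) ^+ N.-1 = 1 :> C by rewrite -expr2 sqrr_sign.
transitivity ((-1) ^+ N.-1 * (-1) ^+ N.-1 * (zeta ^+ L * \prod_j a j)); last by ring.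
by rewrite sg; field.
Qed.

Let U p : C := \det (bethe_mx a b p).

(** Monotonicity of [p] forces the relabelling [s] to be trivial. It stays in the statement because
    [relist_perm] provides positions only up to a permutation. *)
Lemma bethe_u_det X (s : {perm 'I_N}) p : (forall j, (pos X (s j))%:Z = p j) ->
  (forall i j : 'I_N, (i <= j)%N -> p i <= p j) -> bethe_u w X zeta = U p.
Proof.
move=> sE pm; have s1 : s = 1%g.
  apply: mono_perm => i j ij; rewrite ltnNge; apply/negP => /(pos_le X) le.
  have := pm _ _ (ltnW ij); rewrite -!sE lez_nat => le'.
  have /pos_inj/perm_inj e : pos X (s i) = pos X (s j) by apply/val_inj/eqP; rewrite eqn_leq le le'.
  by rewrite e ltnn in ij.
rewrite /U det_bethe_mx; apply: eq_bigr => t _; rewrite /bethe_A; congr (_ * _).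
apply: eq_bigr => i _; rewrite -sE s1 perm1 -exprnP -exprVn; congr (_ ^+ _).
by rewrite /b invfM invrK mulrC.
Qed.

Lemma bethe_u_pos X : bethe_u w X zeta = U (fun j => (pos X j)%:Z).
Proof. by apply: (@bethe_u_det X 1%g) => [j|i j ij]; rewrite ?perm1 // lez_nat pos_le. Qed.

(** If the last particle leaves the window, [Y] is relabelled cyclically and that particle restarts
    at site 0. By [bethe_mx_rot] the determinant is insensitive to this, so unwrapped positions may
    be used throughout. *)
Lemma bethe_u_right X Y (A : {set 'I_N}) : displace X A (@ordS L) = Some Y ->
  bethe_u w Y zeta = U (fun j => (pos X j)%:Z + (j \in A)%:Z).
Proof.
move=> /relist_perm[s sE].
have lt : (N.-1 < N)%N by lia.
pose last := Ordinal lt.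
have jl j : (j <= last)%N by have := ltn_ord j => /=; lia.
have pl i j : (i < j)%N -> (pos X i < pos X j)%N by apply: pos_lt.
have sE' j : (pos X j + (j \in A) < L)%N -> pos Y (s j) = (pos X j + (j \in A))%N :> nat.
  by rewrite sE; case: (j \in A) => /= h; rewrite ?addn0 ?addn1 // modn_small // -addn1.
have [small|big] := ltnP (pos X last + (last \in A)) L.
  apply: (@bethe_u_det Y s) => [j|i j].
    rewrite sE' //; have := jl j; rewrite leq_eqVlt => /orP[/eqP/val_inj -> //|/pl].
    by have := ltn_ord (pos X last); case: (j \in A) => /=; lia.
  rewrite leq_eqVlt => /orP[/eqP/val_inj -> //|/pl].
  by case: (i \in A); case: (j \in A) => /=; lia.
have lA : last \in A by move: big; case: (last \in A) => //; have := ltn_ord (pos X last); lia.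
have lL : (pos X last).+1 = L by move: big; rewrite lA; have := ltn_ord (pos X last); lia.
(* Positions of [Y] in its own labelling: the wrapped particle comes first and the others move up by
   one label. *)
pose p j : int := if j == 0%N :> nat then 0 else (pos X (ord_pred j))%:Z + (ord_pred j \in A)%:Z.
have opE j : (0 < j)%N -> ord_pred j = j.-1 :> nat.
  move=> j0; rewrite /= (_ : (j + N).-1 = j.-1 + N)%N; last by lia.
  by rewrite modnDr modn_small //; have := ltn_ord j; lia.
rewrite (@bethe_u_det Y (perm (can_inj (@ord_predK N)) * s)%g p); first last.
- move=> i j; rewrite leq_eqVlt => /orP[/eqP/val_inj -> //|ij]; rewrite /p.
  case: eqP => i0; case: eqP => j0 //; first by lia.
  have : (pos X (ord_pred i) < pos X (ord_pred j))%N by apply: pl; rewrite !opE //; lia.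
  by case: (_ \in A); case: (_ \in A) => /=; lia.
- move=> j; rewrite permM permE /p; case: eqP => j0.
    have -> : ord_pred j = last by apply/val_inj; rewrite /= j0 add0n modn_small.
    by rewrite sE lA /= lL modnn.
  have : (pos X (ord_pred j) < pos X last)%N.
    by apply: pl; rewrite opE /=; have := ltn_ord j; lia.
  move=> h; rewrite sE' ?PoszD //.
  by have := ltn_ord (pos X last); case: (_ \in A) => /=; lia.
rewrite /U -(@bethe_mx_rot _ _ _ _ a0 b0 N0 L periodic p); congr (\det _); apply: bethe_mx_eq => j.
rewrite /p ordSK; have [jN|jN] := eqVneq j.+1 N.
  have -> : j = last by apply/val_inj => /=; lia.
  have e0 : ordS last = 0%N :> nat by rewrite /= prednK // modnn.
  by rewrite e0 eqxx lA add0r -PoszD addn1 lL.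
by rewrite /= modn_small ?addr0 //; have := ltn_ord j; lia.
Qed.

(** Mirror image of [bethe_u_right]: the first particle may reach position -1, and the rotation
    makes it the last one, at L - 1. *)
Lemma bethe_u_left X Y (A : {set 'I_N}) : displace X A (@ord_pred L) = Some Y ->
  bethe_u w Y zeta = U (fun j => (pos X j)%:Z - (j \in A)%:Z).
Proof.
move=> /relist_perm[s sE].
have lt : (N.-1 < N)%N by lia.
pose last := Ordinal lt; pose first := Ordinal N0.
have pl i j : (i < j)%N -> (pos X i < pos X j)%N by apply: pos_lt.
have sE' j : (first < j)%N || ((j \in A) <= pos X j)%N ->
    (pos Y (s j))%:Z = (pos X j)%:Z - (j \in A)%:Z.
  rewrite sE => h; case: (j \in A) h => /= h; last by rewrite subr0.
  have j0 : (0 < pos X j)%N by by case/orP: h => [/(pl first j)|//]; lia.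
  rewrite (_ : (pos X j + L).-1 = (pos X j).-1 + L)%N; last by lia.
  by rewrite modnDr modn_small; have := ltn_ord (pos X j); lia.
have pm i j : (i <= j)%N -> (pos X i)%:Z - (i \in A)%:Z <= (pos X j)%:Z - (j \in A)%:Z.
  rewrite leq_eqVlt => /orP[/eqP/val_inj -> //|/pl].
  by case: (i \in A); case: (j \in A) => /=; lia.
have [small|big] := leqP (first \in A) (pos X first).
  apply: (@bethe_u_det Y s) => [j|//]; apply: sE'.
  have [j0|j0] := posnP j; last by apply/orP; left.
  by have -> : j = first; [exact/val_inj | rewrite small orbT].
have fA : first \in A by move: big; case: (_ \in A).
have f0 : pos X first = 0%N :> nat by move: big; rewrite fA; case: (pos X first : nat).
pose p j : int := (pos X j)%:Z - (j \in A)%:Z.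
rewrite /U -(@bethe_mx_rot _ _ _ _ a0 b0 N0 L periodic p).
have Slast : ordS last = first by apply/val_inj; rewrite /= prednK // modnn.
have lastE j : j.+1 = N -> j = last by move=> jN; apply/val_inj => /=; lia.
have Sj j : j.+1 <> N -> ordS j = j.+1 :> nat by move=> jN; rewrite /= modn_small //; have := ltn_ord j; lia.
apply: (@bethe_u_det Y (perm (can_inj (@ordSK N)) * s)%g).
- move=> j; rewrite permM permE; case: eqP => jN.
    rewrite (lastE j jN) Slast sE fA /p fA f0 /= f0.
    have L0 : (0 < L)%N by have := ltn_ord (pos X first); lia.
    rewrite add0n modn_small; last by rewrite prednK.
    by lia.
  by rewrite sE' ?addr0 // (Sj j jN).
move=> i j; rewrite leq_eqVlt => /orP[/eqP/val_inj -> //|ij].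
case: eqP => iN; first by have := ltn_ord j; lia.
case: eqP => jN; last by rewrite !addr0; apply: pm; rewrite !Sj //; lia.
rewrite (lastE j jN) Slast /p fA f0.
by have := ltn_ord (pos X (ordS i)); case: (_ \in A) => /=; lia.
Qed.

Lemma step_unwrap X j : (1 < N)%N -> contig X j 1 ->
  ordS j != j /\ (pos X (ordS j))%:Z + (if j.+1 == N then L%:Z else 0) = (pos X j)%:Z + 1.
Proof.
move=> N1 ct; have jN := ltn_ord j; have pL := ltn_ord (pos X j).
have pE : pos X (ordS j) = ((pos X j).+1 %% L)%N :> nat by rewrite (ct 1%N).
have [jE|jE] := eqVneq j.+1 N.
  have S0 : ordS j = 0%N :> nat by rewrite /= jE modnn.
  have lt : (pos X (ordS j) < pos X j)%N by apply: pos_lt; rewrite S0; lia.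
  split; first by apply/eqP => /(congr1 (@nat_of_ord N)); rewrite S0; lia.
  have : (L <= (pos X j).+1)%N by rewrite leqNgt; apply/negP => h; rewrite pE modn_small in lt; lia.
  move=> h; have e : (pos X j).+1 = L by lia.
  by rewrite pE e modnn; lia.
have S1 : ordS j = j.+1 :> nat by rewrite /= modn_small //; lia.
have lt : (pos X j < pos X (ordS j))%N by apply: pos_lt; rewrite S1.
split; first by apply/eqP => /(congr1 (@nat_of_ord N)); rewrite S1; lia.
have : ((pos X j).+1 < L)%N.
  rewrite ltnNge; apply/negP => h; have e : (pos X j).+1 = L by lia.
  by move: lt; rewrite ltnNge pE {1}e modnn.
by move=> h; rewrite pE modn_small //; lia.
Qed.

(** For a suppressed jump the right-hand side vanishes as well: it puts two particles on one site,
    and [bethe_mx_push] identifies zeta times that determinant with the one at [X]. The exclusion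
    rule is thus contained in the free evolution. *)
Lemma jump_left X i :
  oapp (fun X' => zeta * bethe_u w X' zeta - bethe_u w X zeta) 0 (displace X [set i] (@ord_pred L))
  = zeta * U (fun j => (pos X j)%:Z + (if j == i then -1 else 0)) - bethe_u w X zeta.
Proof.
case E : displace => [Y|] /=.
  rewrite (bethe_u_left E); congr (_ * _ - _); congr (\det _); apply: bethe_mx_eq => j.
  by rewrite inE; case: (j == i) => /=; rewrite ?oppr0.
have /displace1_pred_none[N1 ct] := E; apply/esym/eqP; rewrite subr_eq0; apply/eqP.
have pE : pos X i = ordS (pos X (ord_pred i)) by have := ct 1%N (leqnn _); rewrite /= ord_predK.
have := step_unwrap N1 ct; rewrite ord_predK => -[ne eqp].
rewrite bethe_u_pos /U -(@bethe_mx_push _ _ _ _ _ a0 b0 ab N0 L periodic _ (ord_pred i)).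
- congr (\det _); apply: bethe_mx_eq => j; rewrite ord_predK.
  by case: (j == i) => /=; ring.
- by rewrite ord_predK.
rewrite ord_predK eqxx [ord_pred i == i]eq_sym (negbTE ne) addr0.
by move: eqp; case: ifP => _; lia.
Qed.

(** The run is advanced one particle at a time, starting with [i]. Each further particle shares its
    site with the one just moved, and resolving the collision costs a factor [zeta]. *)
Lemma push_chain X i (k : nat) : (k < N)%N -> contig X i k ->
  U (fun j => (pos X j)%:Z + (j \in block i k)%:Z) =
  zeta ^+ k * U (fun j => (pos X j)%:Z + (if j == i then 1 else 0)).
Proof.
elim: k => [|k IH] kN ct.
  rewrite expr0 mul1r; congr (\det _); apply: bethe_mx_eq => j; congr (_ + _).
  case: eqP => [->|ji]; first by rewrite (_ : (i \in block i 0)) //; apply/in_block; exists 0%N.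
  by case: (boolP (j \in block i 0)) => // /in_block[[|//] _ /= /ji].
set jk := iter k (@ordS N) i.
have ctj : contig X jk 1.
  by move=> [|[|//]] _ //=; rewrite -[ordS jk]/(iter k.+1 (@ordS N) i) ct // ct.
have N1 : (1 < N)%N by lia.
have [ne eqp] := step_unwrap N1 ctj.
have jB : jk \in block i k by apply/in_block; exists k.
have SB : ordS jk \notin block i k.
  apply/negP => /in_block[l lk]; rewrite -[ordS jk]/(iter k.+1 (@ordS N) i) => e.
  by have := iter_ordS_eq kN (leq_ltn_trans lk (ltnW kN)) e; lia.
rewrite exprS -mulrA -IH ?(ltnW kN) //; last exact: contig_leq ct.
rewrite /U -(@bethe_mx_push _ _ _ _ _ a0 b0 ab N0 L periodic _ jk) //; last first.
  by rewrite (negbTE SB) jB addr0.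
congr (\det _); apply: bethe_mx_eq => j; rewrite -addrA; congr (_ + _).
case: eqP => [->|/eqP jS].
  by rewrite (negbTE SB) (_ : ordS jk \in block i k.+1) //; apply/in_block; exists k.+1.
rewrite addr0; congr (nat_of_bool _)%:Z; apply/idP/idP => /in_block[l lk jE]; apply/in_block.
  move: lk; rewrite leq_eqVlt => /orP[/eqP lE|lk]; last by exists l.
  by case/eqP: jS; rewrite jE lE.
by exists l => //; lia.
Qed.

(** Only the maximal run contributes; the factor zeta^k from [push_chain] reduces zeta^-(k+1) to
    zeta^-1 whatever its length. *)
Lemma push_right X i :
  \sum_(k < N) (if ring_dist (pos X i) (pos X (iter k (@ordS N) i)) == k then
        oapp (fun X' => zeta ^- k.+1 * bethe_u w X' zeta - bethe_u w X zeta) 0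
          (displace X (block i k) (@ordS L))
      else 0) = zeta^-1 * U (fun j => (pos X j)%:Z + (if j == i then 1 else 0)) - bethe_u w X zeta.
Proof.
have [k [ct dk] uk] := block_unique X i.
rewrite (bigD1 k) //= [X in _ + X]big1 ?addr0; last first.
  move=> k' k'k; case: ifP => // /(contigP X i (ltn_ord k')) ct'.
  case E : displace => [Y|//]; case/eqP: k'k; apply: uk => //.
  by rewrite E.
rewrite (introT (contigP X i (ltn_ord k)) ct).
case E : displace dk => [Y|//] _ /=; congr (_ - _).
rewrite (bethe_u_right E) (push_chain (ltn_ord k) ct) mulrA; congr (_ * _).
by rewrite exprS invfM -mulrA mulVf ?mulr1 ?expf_neq0.
Qed.

Lemma energyE (p q : R) :
  energy p q w = p%:C * (\sum_k w k) + q%:C * (\sum_k (w k)^-1) - N%:R.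
Proof. by rewrite /energy sumrB big_split /= -!mulr_sumr sumr_const card_ord. Qed.

(** After [jump_left] and [push_right] every particle moves freely, so the shifts produce the sums
    of w and of 1/w; the loss terms add up to -N because p + q = 1. *)
Lemma bethe_eigenfunction (p q : R) X : p + q = 1 ->
  generator p q zeta (fun X' => bethe_u w X' zeta) X = energy p q w * bethe_u w X zeta.
Proof.
move=> pq; rewrite /generator.
under eq_bigr do rewrite jump_left.
under [X in _ + _ * X]eq_bigr do rewrite push_right.
rewrite !sumrB -!mulr_sumr.
have bN k : (b k)^-1 = b k ^ (-1) by rewrite exprN1.
have b1 k : b k = b k ^ 1 by rewrite expr1z.
rewrite (@bethe_mx_shift_sum _ _ a _ b0 _ _ _ bN) (@bethe_mx_shift_sum _ _ a _ b0 _ _ _ b1).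
rewrite -/(U (fun j => (pos X j)%:Z)) -bethe_u_pos energyE; move: (bethe_u w X zeta) => u.
have -> : zeta * ((\sum_k (b k)^-1) * u) = (\sum_k w k) * u.
  rewrite mulrA; congr (_ * _); rewrite mulr_sumr; apply: eq_bigr => k _.
  by rewrite /b; field; rewrite w0 z0.
have -> : zeta^-1 * ((\sum_k b k) * u) = (\sum_k (w k)^-1) * u.
  rewrite mulrA; congr (_ * _); rewrite mulr_sumr; apply: eq_bigr => k _.
  by rewrite /b; field; rewrite w0 z0.
move: (\sum_k w k) (\sum_k (w k)^-1) => Sw Si.
have cst : \sum_(i < N) u = N%:R * u by rewrite sumr_const card_ord mulr_natl.
rewrite cst.
have pqC : p%:C + q%:C = 1 :> C by rewrite -rmorphD pq.
have -> : p%:C = 1 - q%:C :> C by rewrite -pqC; ring.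
by move: (q%:C) => Q; ring.
Qed.

End Eigenfunction.

(** * Truncated power series *)

Section Truncated.
Variable F : numFieldType.
Implicit Types (p q r : {poly F}) (M n : nat).

(** Formal power series are represented by polynomials up to this congruence modulo X^M. *)
Definition eqX M p q := (('X^M : {poly F}) %| p - q).

Lemma dvdpXnP M p : reflect (forall i, (i < M)%N -> p`_i = 0) ('X^M %| p).
Proof.
apply: (iffP idP).
  by move=> /dvdpP[r ->] i iM; rewrite coefMXn iM.
move=> H; apply/dvdpP; exists (drop_poly M p).
rewrite -[LHS](poly_take_drop M) (_ : take_poly M p = 0) ?add0r //.
by apply/polyP=> i; rewrite coef_take_poly coef0; case: ifP => // /H.
Qed.

Lemma eqX_coef M p q i : eqX M p q -> (i < M)%N -> p`_i = q`_i.
Proof. by move=> /dvdpXnP H iM; apply/eqP; rewrite -subr_eq0 -coefB H. Qed.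

Lemma eqXxx M p : eqX M p p.
Proof. by rewrite /eqX subrr dvdp0. Qed.

Lemma eqX_sym M p q : eqX M p q -> eqX M q p.
Proof. by rewrite /eqX -dvdpNr opprB. Qed.

Lemma eqX_trans M q p r : eqX M p q -> eqX M q r -> eqX M p r.
Proof.
rewrite /eqX => pq qr; rewrite (_ : p - r = (p - q) + (q - r)); last by rewrite addrA subrK.
exact: dvdp_add.
Qed.

Lemma eqXD M p p' q q' : eqX M p p' -> eqX M q q' -> eqX M (p + q) (p' + q').
Proof. by rewrite /eqX => pq qr; rewrite opprD addrACA dvdp_add. Qed.

Lemma eqXN M p p' : eqX M p p' -> eqX M (- p) (- p').
Proof. by rewrite /eqX => pq; rewrite -opprD dvdpNr. Qed.

Lemma eqXM M p p' q q' : eqX M p p' -> eqX M q q' -> eqX M (p * q) (p' * q').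
Proof.
rewrite /eqX => pq qr.
rewrite (_ : p * q - p' * q' = (p - p') * q + p' * (q - q')); last by ring.
by apply: dvdp_add; [apply: dvdp_mulr | apply: dvdp_mull].
Qed.

Lemma eqXX M n p p' : eqX M p p' -> eqX M (p ^+ n) (p' ^+ n).
Proof.
by move=> H; elim: n => [|n IH]; rewrite ?expr0 ?eqXxx // !exprS eqXM.
Qed.

Lemma eqX_prod M (I : Type) (s : seq I) (P : pred I) (f g : I -> {poly F}) :
  (forall i, P i -> eqX M (f i) (g i)) ->
  eqX M (\prod_(i <- s | P i) f i) (\prod_(i <- s | P i) g i).
Proof.
by move=> H; apply: (big_ind2 (eqX M)); [exact: eqXxx | move=> *; exact: eqXM |].
Qed.

Lemma eqX_sum M (I : Type) (s : seq I) (P : pred I) (f g : I -> {poly F}) :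
  (forall i, P i -> eqX M (f i) (g i)) ->
  eqX M (\sum_(i <- s | P i) f i) (\sum_(i <- s | P i) g i).
Proof.
by move=> H; apply: (big_ind2 (eqX M)); [exact: eqXxx | move=> *; exact: eqXD |].
Qed.

Lemma eqX_deriv M p q : eqX M p q -> eqX M ('X * p^`()) ('X * q^`()).
Proof.
move=> /dvdpXnP H; apply/dvdpXnP => -[|i] iM; rewrite -mulrBr -derivB coefXM //= coef_deriv H //.
by rewrite mul0rn.
Qed.

Lemma eqX_scale M p q (c : F) : eqX M p q -> eqX M (p \Po (c *: 'X)) (q \Po (c *: 'X)).
Proof.
rewrite /eqX -comp_polyB => /dvdpP[r ->]; rewrite comp_polyM comp_Xn_poly exprZn -scalerAr.
by rewrite scalerAl dvdp_mull.
Qed.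

Lemma eqX_le M n p q : (n <= M)%N -> eqX M p q -> eqX n p q.
Proof. by move=> nM; apply: dvdp_trans; apply: dvdp_exp2l. Qed.

Lemma coef_scale p (c : F) i : (p \Po (c *: 'X))`_i = c ^+ i * p`_i.
Proof.
rewrite comp_polyE coef_sum.
under eq_bigr => j _ do rewrite exprZn !coefZ coefXn.
have [ip|pi] := ltnP i (size p).
  rewrite (bigD1 (Ordinal ip)) //= eqxx mulr1 big1 ?addr0 1?mulrC // => j ji.
  rewrite (_ : (i == j) = false) ?mulr0 ?mulr0 //.
  by apply/negP => /eqP ij; case/eqP: ji; apply/val_inj.
rewrite big1 => [|j _]; first by rewrite [p`_i]nth_default ?mulr0.
by rewrite (_ : (i == j) = false) ?mulr0 ?mulr0 //; apply/negP => /eqP ij; have := ltn_ord j; lia.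
Qed.

Lemma inverse_mod M p : p`_0 = 1 -> exists2 q : {poly F}, q`_0 = 1 & eqX M (p * q) 1.
Proof.
move=> p0.
(* One more order of precision, so that the constant coefficient is determined even when M = 0. *)
suff [q Hq] : exists q : {poly F}, eqX M.+1 (p * q) 1.
  exists q; last exact: eqX_le Hq.
  by have := eqX_coef Hq (ltn0Sn M); rewrite coef0M p0 mul1r coef1.
have : coprimep p 'X^(M.+1).
  by rewrite coprimep_pexpr // coprimepX /root horner_coef0 p0 oner_eq0.
move=> /Bezout_eq1_coprimepP[[u v] /= uv]; exists u.
by rewrite /eqX -uv mulrC opprD addrA subrr sub0r dvdpNr dvdp_mull.
Qed.

(* Residue of the logarithmic form (d log (X tau)) / (X tau)^p. *)
Lemma coef_residue M (p : nat) (tau sigma : {poly F}) : eqX M (tau * sigma) 1 -> (p < M)%N ->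
  (sigma ^+ p * (1 + 'X * tau^`() * sigma))`_p = (p == 0)%:R.
Proof.
move=> H pM.
case: p pM => [|p] pM; first by rewrite expr0 mul1r -mulrA coefD coef1 coefXM addr0.
have Hd : eqX M ('X * tau^`() * sigma) (- ('X * sigma^`() * tau)).
  have := eqX_deriv H; rewrite derivM derivC mulr0 /eqX subr0 => Hd.
  by rewrite opprK (_ : _ + _ = 'X * (tau^`() * sigma + tau * sigma^`())) //; ring.
have E : eqX M (sigma ^+ p.+1 * (1 + 'X * tau^`() * sigma))
   (sigma ^+ p.+1 - 'X * sigma^`() * sigma ^+ p).
  rewrite mulrDr mulr1; apply: eqXD; first exact: eqXxx.
  apply: (@eqX_trans _ (sigma ^+ p.+1 * - ('X * sigma^`() * tau))).
    by apply: eqXM => //; apply: eqXxx.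
  rewrite (_ : _ * - _ = - (('X * sigma^`() * sigma ^+ p) * (tau * sigma))); last by rewrite exprS; ring.
  by apply: eqXN; rewrite -[X in eqX _ _ X]mulr1; apply: eqXM => //; apply: eqXxx.
rewrite (eqX_coef E pM) coefB.
have -> : 'X * sigma^`() * sigma ^+ p = 'X * (p.+1%:R^-1 *: (sigma ^+ p.+1)^`()).
  rewrite deriv_exp -[(_ * _) *+ _]scaler_nat scalerA mulVf ?pnatr_eq0 // scale1r /=; ring.
rewrite coefXM /= coefZ coef_deriv -[X in _ * X]mulr_natl mulrA mulVf ?pnatr_eq0 //.
by rewrite mul1r subrr.
Qed.

(* Lagrange inversion: expansion of K along the powers of the uniformizer X tau. *)
Lemma lagrange_expansion M (tau sigma K : {poly F}) : tau`_0 = 1 -> eqX M (tau * sigma) 1 ->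
  eqX M K (\sum_(q < M) (K * sigma ^+ q)`_q *: (('X * tau) ^+ q * (1 + 'X * tau^`() * sigma))).
Proof.
move=> tau0 H; set v := 1 + _.
have v0 : v`_0 = 1 by rewrite /v -mulrA coefD coef1 coefXM addr0.
have [k Hk] : exists k : nat -> F, eqX M K (\sum_(q < M) k q *: (('X * tau) ^+ q * v)).
  move: v v0 => v v0; elim: {H} M => [|m [k IH]]; first by exists (fun=> 0); rewrite /eqX expr0 dvd1p.
  move: IH; set S := \sum_(q < m) _ => IH.
  have [r Hr] := dvdpP _ _ IH.
  exists (fun q : nat => if q == m then r`_0 else k q).
  rewrite big_ord_recr /= eqxx.
  rewrite (_ : \sum_(q < m) _ = S); last first.
    by apply: eq_bigr => q _; rewrite (_ : (q == m :> nat) = false) //; have := ltn_ord q; lia.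
  rewrite /eqX opprD addrA Hr (_ : _ - _ = 'X^m * (r - r`_0 *: (tau ^+ m * v))); last first.
    by rewrite exprMn -!mul_polyC; ring.
  rewrite exprSr dvdp_mul2l ?monic_neq0 ?monicXn // -[X in X %| _]expr1.
  apply/dvdpXnP => -[|//] _.
  rewrite coefB coefZ coef0M v0 mulr1.
  have -> : (tau ^+ m)`_0 = 1.
    by rewrite -horner_coef0 horner_exp horner_coef0 tau0 expr1n.
  by rewrite mulr1 subrr.
suff E (q : nat) : (q < M)%N -> (K * sigma ^+ q)`_q = k q.
  by apply: eqX_trans Hk _; apply: eqX_sum => q _; rewrite E ?eqXxx.
move=> qM.
have Hq : eqX M (K * sigma ^+ q) ((\sum_(q < M) k q *: (('X * tau) ^+ q * v)) * sigma ^+ q).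
  by apply: eqXM => //; apply: eqXxx.
rewrite (eqX_coef Hq qM) mulr_suml coef_sum (bigD1 (Ordinal qM)) //= big1 ?addr0.
  rewrite -scalerAl coefZ exprMn (_ : 'X^_ * _ * v * _ = 'X^q * (v * (tau * sigma) ^+ q)); last first.
    by rewrite exprMn; ring.
  rewrite coefXnM ltnn subnn.
  have : eqX M (v * (tau * sigma) ^+ q) v.
    rewrite -[X in eqX _ _ X]mulr1; apply: eqXM; first exact: eqXxx.
    by rewrite -(expr1n _ q); apply: eqXX.
  by move/eqX_coef => -> //; [rewrite v0 mulr1 | lia].
move=> j jq; rewrite -scalerAl coefZ exprMn.
rewrite (_ : 'X^_ * _ * v * _ = 'X^j * (v * tau ^+ j * sigma ^+ q)); last by ring.
rewrite coefXnM; case: ltnP => [|jq']; first by rewrite mulr0.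
have jlt : (j < q)%N.
  by rewrite ltn_neqAle jq' andbT; apply: contra jq => /eqP e; apply/eqP/val_inj.
rewrite -(subnK (ltnW jlt)) addnK.
have : eqX M (v * tau ^+ j * sigma ^+ (q - j + j)) (sigma ^+ (q - j) * v).
  rewrite exprD (_ : _ * _ = sigma ^+ (q - j) * v * (tau * sigma) ^+ j); last first.
    by rewrite exprMn; ring.
  rewrite -[X in eqX _ _ X]mulr1; apply: eqXM; first exact: eqXxx.
  by rewrite -(expr1n _ j); apply: eqXX.
move/eqX_coef => -> //; last by lia.
rewrite (coef_residue H); last by lia.
by rewrite subn_eq0 leqNgt jlt mulr0.
Qed.

(** Hensel lifting, one coefficient at a time: at X = 0 and eta = 1 the derivative in eta is L,
    which is invertible in characteristic 0. *)
Lemma algebraic_series L N M : (0 < L)%N ->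
  exists2 eta : {poly F}, eta`_0 = 1 & eqX M (eta ^+ L + 'X * eta ^+ N) 1.
Proof.
move=> L0; elim: M => [|M [eta e0 IH]].
  by exists 1; rewrite ?coef1 // /eqX expr0 dvd1p.
case: (posnP M) => [->|M0].
  exists 1; first by rewrite coef1.
  by rewrite /eqX !expr1n mulr1 addrAC subrr add0r expr1.
have [r Hr] := dvdpP _ _ IH.
pose c := - r`_0 / L%:R; exists (eta + c *: 'X^M).
  by rewrite coefD coefZ coefXn e0 (_ : (0 == M)%N = false) ?mulr0 ?addr0 //; lia.
set eta' := eta + _.
have D : eta' - eta = c *: 'X^M by rewrite /eta' addrC addKr.
have e'0 : eta'`_0 = 1.
  by rewrite coefD coefZ coefXn e0 (_ : (0 == M)%N = false) ?mulr0 ?addr0 //; lia.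
have -> : eqX M.+1 (eta' ^+ L + 'X * eta' ^+ N) 1 =
   ('X^(M.+1) %| (eta ^+ L + 'X * eta ^+ N - 1) + ((eta' ^+ L - eta ^+ L) + 'X * (eta' ^+ N - eta ^+ N)))%R.
  by rewrite /eqX; congr (dvdp _ _); ring.
rewrite Hr !subrXX D -!scalerAl -!scalerAr.
rewrite (_ : _ + _ = 'X^M * (r + (c *: \sum_(i < L) eta' ^+ (L.-1 - i) * eta ^+ i
   + c *: ('X * \sum_(i < N) eta' ^+ (N.-1 - i) * eta ^+ i)))); last first.
  by rewrite -!mul_polyC; ring.
rewrite exprSr dvdp_mul2l ?monic_neq0 ?monicXn // -[X in X %| _]expr1.
apply/dvdpXnP => -[|//] _.
rewrite !coefD !coefZ coefXM mulr0 addr0 coef_sum (eq_bigr (fun=> 1)).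
  by rewrite sumr_const card_ord /c mulfVK ?subrr // pnatr_eq0; lia.
by move=> i _; rewrite coef0M -!horner_coef0 !horner_exp !horner_coef0 e0 e'0 !expr1n mulr1.
Qed.

End Truncated.

(** * The series of one root, and sums over all branches *)

Section BetheSeries.
Variables (F : numFieldType) (L N M : nat) (eta iota : {poly F}).
Hypotheses (L_gt0 : (0 < L)%N) (eta0 : eta`_0 = 1) (iota0 : iota`_0 = 1).
Hypothesis (etaE : eqX M (eta ^+ L + 'X * eta ^+ N) 1).
Hypothesis (iotaE : eqX M (eta * iota) 1).

(** Integer powers of eta, with [iota] as its inverse modulo X^M. *)
Definition zpow_series (c : int) : {poly F} :=
  match c with Posz n => eta ^+ n | Negz n => iota ^+ n.+1 end.

Local Notation zp := zpow_series.

Lemma zpow_seriesE (m n : nat) : eqX M (zp (m%:Z - n%:Z)) (eta ^+ m * iota ^+ n).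
Proof.
have H k : eqX M ((eta * iota) ^+ k) 1 by rewrite -(expr1n _ k); apply: eqXX.
have [nm|mn] := leqP n m.
  rewrite subzn //= -{2}(subnK nm) exprD -mulrA -exprMn -{1}[eta ^+ _]mulr1.
  by apply: eqXM; [exact: eqXxx | apply: eqX_sym].
rewrite (_ : m%:Z - n%:Z = Negz (n - m).-1) /=; last by rewrite NegzE; lia.
rewrite prednK ?subn_gt0 // -{2}(subnK (ltnW mn)) exprD mulrCA -exprMn -{1}[iota ^+ _]mulr1.
by apply: eqXM; [exact: eqXxx | apply: eqX_sym].
Qed.

Lemma zpow_seriesD a b : eqX M (zp a * zp b) (zp (a + b)).
Proof.
have H c : exists m n, c = m%:Z - n%:Z.
  by case: c => m; [exists m, 0%N; rewrite subr0 | exists 0%N, m.+1; rewrite sub0r NegzE].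
have [m [n ->]] := H a; have [m' [n' ->]] := H b.
rewrite (_ : _ - _ + _ = (m + m')%N%:Z - (n + n')%N%:Z); last by lia.
apply: (@eqX_trans _ _ ((eta ^+ m * iota ^+ n) * (eta ^+ m' * iota ^+ n'))).
  by apply: eqXM; apply: zpow_seriesE.
apply: eqX_sym; rewrite mulrACA -!exprD; exact: zpow_seriesE.
Qed.

Lemma zpow_series0 c : (zp c)`_0 = 1.
Proof. by case: c => n /=; rewrite -horner_coef0 horner_exp horner_coef0 ?eta0 ?iota0 expr1n. Qed.

(** Modulo X^M this is X times the logarithmic derivative of X eta^N, the factor that [coef_residue]
    asks for. *)
Definition weight_series : {poly F} := 1 + 'X * (eta ^+ N)^`() * iota ^+ N.
Local Notation w := weight_series.

Lemma weight_series0 : w`_0 = 1.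
Proof. by rewrite /w -mulrA coefD coef1 coefXM addr0. Qed.

Lemma zpow_weight0 c : (zp c * w)`_0 = 1.
Proof. by rewrite coef0M zpow_series0 weight_series0 mulr1. Qed.

Lemma etaN_iotaN : eqX M (eta ^+ N * iota ^+ N) 1.
Proof. by rewrite -exprMn -(expr1n _ N); apply: eqXX. Qed.

(** By the trinomial equation eta^c = (1 - X eta^N)^m eta^(-N r). The binomial term of index i <= m
    < r contributes the coefficient of order r - i > 0 of eta^(-N(r - i)) times the weight, which is
    zero by [coef_residue]. *)
Lemma zpow_weight_eq0 (c : int) (r m : nat) : (r < M)%N ->
  c + N%:Z * r%:Z = L%:Z * m%:Z -> (m < r)%N -> (zp c * w)`_r = 0.
Proof.
move=> rM cE mr.
have E : eqX M (zp c * w)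
    (\sum_(i < m.+1) (1 ^+ (m - i) * (- ('X * eta ^+ N)) ^+ i *+ 'C(m, i) * ((iota ^+ N) ^+ r * w))).
  rewrite -mulr_suml -exprDn mulrA; apply: eqXM; last exact: eqXxx.
  rewrite (_ : c = (L * m)%N%:Z - (N * r)%N%:Z); last by rewrite !PoszM; lia.
  apply: eqX_trans (zpow_seriesE _ _) _; rewrite !exprM; apply: eqXM; last exact: eqXxx.
  apply: eqXX; rewrite -[eta ^+ L](addrK ('X * eta ^+ N)).
  by apply: eqXD => //; apply: eqXxx.
rewrite (eqX_coef E rM) coef_sum big1 // => i _.
have ir : (i < r)%N by have := ltn_ord i; lia.
rewrite expr1n mul1r -mulr_natl exprNn exprMn.
have -> : (iota ^+ N) ^+ r = (iota ^+ N) ^+ (r - i) * (iota ^+ N) ^+ i.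
  by rewrite -exprD subnK // ltnW.
rewrite (_ : _ * (_ * _) = 'X^i * (('C(m, i)%:R * (-1) ^+ i) * ((iota ^+ N) ^+ (r - i) * w * (eta ^+ N * iota ^+ N) ^+ i))); last first.
  by rewrite !exprMn; ring.
rewrite coefXnM ltnNge (ltnW ir) /=.
rewrite -(rmorph_nat (@polyC F)) -[-1](rmorphN1 (@polyC F)) -rmorphXn -rmorphM /= coefCM.
have : eqX M ((iota ^+ N) ^+ (r - i) * w * (eta ^+ N * iota ^+ N) ^+ i) ((iota ^+ N) ^+ (r - i) * w).
  rewrite -[X in eqX _ _ X]mulr1; apply: eqXM; first exact: eqXxx.
  by rewrite -(expr1n _ i); apply: eqXX; exact: etaN_iotaN.
move/eqX_coef => ->; last by lia.
rewrite (coef_residue etaN_iotaN); last by lia.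
by rewrite subn_eq0 leqNgt ir mulr0.
Qed.

Variables (rt : 'I_L -> F).
Hypothesis (rt_neq0 : forall i, rt i != 0).
Hypothesis (rt_sum : forall p : int, ~~ (L%:Z %| p)%Z -> \sum_i rt i ^ p = 0).
Variables (n c : 'I_N -> int).

(** The coefficient of order [q] given by [lagrange_expansion] for a product of one-root series; the
    index [w0] chooses a branch, that is a root of unity up to a common factor, for each [j]. *)
Definition lagrange_coef (w0 : {ffun 'I_N -> 'I_L}) (q : nat) : F :=
  ((\prod_j ((zp (c j) * w) \Po (rt (w0 j) *: 'X)))
   * (\prod_j (iota \Po (rt (w0 j) *: 'X))) ^+ q)`_q.

(** The power of order [q] in the definition is itself a product over [j] and only lowers the
    exponent [c j] by [q]. Hence the sum over all branches factorises, and each factor contains a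
    power sum of [rt]. *)
Lemma lagrange_coef_sum q : (q < M)%N ->
  \sum_(w0 : {ffun 'I_N -> 'I_L}) (\prod_j rt (w0 j) ^ (n j)) * lagrange_coef w0 q =
  \sum_(r : {ffun 'I_N -> 'I_q.+1} | (\sum_j r j == q)%N)
     \prod_j ((zp (c j - q%:Z) * w)`_(r j) * \sum_i rt i ^ (n j + (r j)%:Z)).
Proof.
move=> qM.
pose f j : {poly F} := zp (c j - q%:Z) * w.
have fE (w0 : {ffun 'I_N -> 'I_L}) : lagrange_coef w0 q = (\prod_j (f j \Po (rt (w0 j) *: 'X)))`_q.
  rewrite /lagrange_coef -prodrXl -big_split /=; apply: eqX_coef qM.
  apply: eqX_prod => j _.
  rewrite -rmorphXn -rmorphM /=; apply: eqX_scale.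
  rewrite mulrAC; apply: eqXM; last exact: eqXxx.
  apply: eqX_trans (zpow_seriesD (c j) (- q%:Z)); apply: eqXM; first exact: eqXxx.
  by case: (q) => [|k] /=; rewrite ?expr0 ?eqXxx // oppr0 expr0 eqXxx.
under eq_bigr => w0 _ do rewrite fE -coefCM rmorph_prod /= -big_split /=.
rewrite -coef_sum -(bigA_distr_bigA (fun j i => ((rt i ^ n j)%:P * (f j \Po (rt i *: 'X))))) /=.
pose g j r : F := (f j)`_r * \sum_i rt i ^ (n j + r%:Z).
have gE j : eqX q.+1 (\sum_i ((rt i ^ n j)%:P * (f j \Po (rt i *: 'X)))) (\sum_(r < q.+1) (g j r)%:P * 'X^r).
  rewrite /eqX; apply/dvdpXnP => k kq; rewrite coefB !coef_sum.
  have -> : \sum_(i < q.+1) ((g j i)%:P * 'X^i)`_k = g j k.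
    rewrite (bigD1 (Ordinal kq)) //= coefCM coefXn eqxx mulr1 big1 ?addr0 // => j1 jk.
    rewrite coefCM coefXn (_ : (k == j1) = false) ?mulr0 //.
    by apply/negP => /eqP kj; case/eqP: jk; apply/val_inj.
  rewrite /g big_distrr /= -sumrB big1 // => i _.
  by rewrite coefCM coef_scale expfzDr // exprnP; ring.
rewrite (eqX_coef (eqX_prod _ (fun j _ => gE j)) (ltnSn q)) bigA_distr_bigA coef_sum [RHS]big_mkcond /=.
apply: eq_bigr => r _; rewrite big_split /= -rmorph_prod coefCM /=.
rewrite -expr_sum coefXn eq_sym; case: eqP => _; last by rewrite mulr0.
by rewrite mulr1; apply: eq_bigr.
Qed.

(** If some n_j + r_j is not divisible by L, a power sum vanishes; otherwise a coefficient vanishes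
    by [zpow_weight_eq0]. *)
Lemma lagrange_coef_sum_eq0 q : (q < M)%N ->
  (forall r : 'I_N -> nat, (\sum_j r j = q)%N ->
     (forall j, (L%:Z %| n j + (r j)%:Z)%Z) ->
     exists j (m : nat), c j - q%:Z + N%:Z * (r j)%:Z = L%:Z * m%:Z /\ (m < r j)%N) ->
  \sum_(w0 : {ffun 'I_N -> 'I_L}) (\prod_j rt (w0 j) ^ (n j)) * lagrange_coef w0 q = 0.
Proof.
move=> qM H; rewrite lagrange_coef_sum // big1 // => r /eqP rq.
have [/forallP D|/forallPn[j jD]] := boolP [forall j, (L%:Z %| n j + (r j)%:Z)%Z].
  have [j [m [E mr]]] := H _ rq D.
  rewrite (bigD1 j) //= (zpow_weight_eq0 _ E) ?mul0r //.
  by apply: leq_ltn_trans qM; rewrite -ltnS ltn_ord.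
by rewrite (bigD1 j) //= rt_sum // mulr0 mul0r.
Qed.

Lemma lagrange_coef_sum0 : (0 < M)%N ->
  \sum_(w0 : {ffun 'I_N -> 'I_L}) (\prod_j rt (w0 j) ^ (n j)) * lagrange_coef w0 0 =
  \prod_j (\sum_i rt i ^ (n j)).
Proof.
move=> M0; rewrite bigA_distr_bigA /=; apply: eq_bigr => w0 _.
suff -> : lagrange_coef w0 0 = 1 by rewrite mulr1.
rewrite /lagrange_coef expr0 mulr1 -horner_coef0 horner_prod big1 // => j _.
by rewrite horner_coef0 coef_scale zpow_weight0 expr0 mul1r.
Qed.

End BetheSeries.

(** * Solutions of the Bethe equations for small [zeta^-1] *)

Section Estimates.
Variable R : realType.
Local Notation C := R[i].
Implicit Types x y z : C.

Lemma prod_dist (I : Type) (s : seq I) (f g : I -> C) :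
  (forall i, nm (f i) <= 2) -> (forall i, nm (g i) <= 2) ->
  nm (\prod_(i <- s) f i - \prod_(i <- s) g i) <= 2 ^+ size s * \sum_(i <- s) nm (f i - g i).
Proof.
move=> f2 g2; elim: s => [|i s IH]; first by rewrite !big_nil subrr nm0 mulr0.
rewrite !big_cons (_ : _ - _ = f i * (\prod_(j <- s) f j - \prod_(j <- s) g j) + (f i - g i) * \prod_(j <- s) g j); last by ring.
apply: le_trans (nmD _ _) _; rewrite !nmM exprS -mulrA mulrDr addrC mulrDr lerD //.
  rewrite mulrC mulrA ler_wpM2r ?nm_ge0 // nm_prod.
  apply: (@le_trans _ _ (2 ^+ size s)).
    elim: s {IH} => [|j s IH]; first by rewrite !big_nil expr0.
    by rewrite !big_cons exprS ler_pM ?nm_ge0 // prodr_ge0 // => *; exact: nm_ge0.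
  by rewrite ler_peMl ?exprn_ge0 // ler1n.
by apply: ler_pM => //; exact: nm_ge0.
Qed.

Lemma prod_dist1 n (f : 'I_n -> C) : (forall i, nm (f i) <= 2) ->
  nm (\prod_i f i - 1) <= 2 ^+ n * \sum_i nm (f i - 1).
Proof.
move=> f2; have one2 : nm (1 : C) <= 2 by rewrite nm1; lra.
have := prod_dist (index_enum 'I_n) f2 (fun=> one2).
by rewrite prodr_const expr1n /index_enum -enumT size_enum_ord.
Qed.

Lemma nm_near1 x (r : R) : nm (x - 1) <= r -> r <= 2^-1 -> [/\ 2^-1 <= nm x, nm x <= 2 & x != 0].
Proof.
move=> xr r2; have h1 := nm_sub 1 x; have h2 := nmD (x - 1) 1.
rewrite nm_distC nm1 in h1; rewrite subrK nm1 in h2.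
have xp : 2^-1 <= nm x by lra.
split=> //; first by lra.
by rewrite -nm_gt0; lra.
Qed.

Lemma exp_dist x y n : nm x <= 2 -> nm y <= 2 -> nm (x ^+ n - y ^+ n) <= 2 ^+ n * n%:R * nm (x - y).
Proof.
move=> x2 y2; have := @prod_dist 'I_n (index_enum 'I_n) (fun=> x) (fun=> y) (fun=> x2) (fun=> y2).
by rewrite !prodr_const sumr_const card_ord /index_enum -enumT size_enum_ord -[nm _ *+ n]mulr_natl mulrA.
Qed.

(** The product of the distances from 1 to the roots is |p(1)| divided by the modulus of the leading
    coefficient, so the distances cannot all exceed [r]. *)
Lemma near_root (p : {poly C}) (r : R) : 0 < r -> nm p.[1] < nm (lead_coef p) * r ^+ (size p).-1 ->
  exists2 x, root p x & nm (x - 1) <= r.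
Proof.
move=> r0 H; have [s ps] := closed_field_poly_normal p.
have p0 : p != 0.
  apply/eqP => p0; move: H; rewrite p0 lead_coef0 nm0 mul0r horner0 nm0 ltxx //.
have rootE x : root p x = (x \in s).
  by rewrite ps rootZ ?lead_coef_eq0 // root_prod_XsubC.
have [/hasP[x xs xr]|/hasPn H'] := boolP (has (fun x => nm (x - 1) <= r) s).
  by exists x => //; rewrite rootE.
exfalso; move: H; rewrite ltNge => /negP; apply.
have -> : (size p).-1 = size s.
  by rewrite ps size_scale ?lead_coef_eq0 // size_prod_XsubC.
have -> : p.[1] = lead_coef p * \prod_(a <- s) (1 - a).
  by rewrite {1}ps hornerZ horner_prod; congr (_ * _); apply: eq_bigr => a _; rewrite hornerXsubC.
rewrite nmM ler_wpM2l ?nm_ge0 // nm_prod.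
elim: s {ps rootE} H' => [|a s IH] H; first by rewrite big_nil.
rewrite big_cons exprS ler_pM ?exprn_ge0 // ?(ltW r0) //.
  by rewrite nm_distC ltW // ltNge H // inE eqxx.
by apply: IH => b bs; apply: H; rewrite inE bs orbT.
Qed.

(** Nested intervals of half-width 2k/2^n around u_n; the limit is the supremum of their left
    ends. *)
Lemma real_geometric_limit (u : nat -> R) (k : R) : 0 <= k ->
  (forall n, `|u n.+1 - u n| <= k / 2 ^+ n) ->
  exists l, forall n, `|u n - l| <= 2 * k / 2 ^+ n.
Proof.
move=> k0 H.
pose y n := u n - 2 * k / 2 ^+ n; pose z n := u n + 2 * k / 2 ^+ n.
have e n : 2 * k / 2 ^+ n.+1 = k / 2 ^+ n by rewrite exprS invfM mulrACA divff ?pnatr_eq0 // mul1r.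
have p n : 0 <= k / 2 ^+ n by rewrite divr_ge0 // exprn_ge0.
have e2 n : 2 * k / 2 ^+ n = k / 2 ^+ n + k / 2 ^+ n by ring.
have ym n : y n <= y n.+1.
  by have := H n; rewrite ler_norml => /andP[h1 h2]; rewrite /y e e2; lra.
have zm n : z n.+1 <= z n.
  by have := H n; rewrite ler_norml => /andP[h1 h2]; rewrite /z e e2; lra.
have ymon m n : (m <= n)%N -> y m <= y n.
  by move=> /subnK <-; elim: (n - m)%N => // d IH; rewrite addSn (le_trans IH).
have zmon m n : (m <= n)%N -> z n <= z m.
  by move=> /subnK <-; elim: (n - m)%N => // d IH; rewrite addSn (le_trans _ IH).
have yz m n : y m <= z n.
  apply: (le_trans (ymon m (maxn m n) (leq_maxl _ _))).
  apply: le_trans (zmon n (maxn m n) (leq_maxr _ _)).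
  by rewrite /y /z e2; have := p (maxn m n); lra.
pose E : set R := fun a : R => exists n, a = y n.
have E0 : has_sup E.
  by split; [exists (y 0%N); exists 0%N | exists (z 0%N) => _ [n ->]].
exists (sup E) => n.
have h1 : y n <= sup E by apply: sup_upper_bound => //; exists n.
have h2 : sup E <= z n by apply: sup_le_ub; [exists (y 0%N); exists 0%N | move=> _ [m ->]].
by rewrite ler_distl; apply/andP; split; move: h1 h2; rewrite /y /z; lra.
Qed.

Lemma nm_Re_le x : `|complex.Re x| <= nm x.
Proof.
case: x => a b /=; rewrite -[`|a|]sqrtr_sqr; first by rewrite ler_wsqrtr // lerDl sqr_ge0.
Qed.
Lemma nm_Im_le x : `|complex.Im x| <= nm x.
Proof. by case: x => a b /=; rewrite -sqrtr_sqr ler_wsqrtr // lerDr sqr_ge0. Qed.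
Lemma nm_le_ReIm x : nm x <= `|complex.Re x| + `|complex.Im x|.
Proof.
case: x => a b /=; rewrite -[X in _ <= X]ger0_norm ?addr_ge0 // -sqrtr_sqr ler_wsqrtr //.
rewrite sqrrD !real_normK ?num_real // lerD2r lerDl.
by rewrite mulrn_wge0 // mulr_ge0.
Qed.

Lemma geometric_limit (u : nat -> C) (k : R) : 0 <= k ->
  (forall n, nm (u n.+1 - u n) <= k / 2 ^+ n) ->
  exists l, forall n, nm (u n - l) <= 4 * k / 2 ^+ n.
Proof.
move=> k0 H.
have [n|a Ha] := @real_geometric_limit (fun n => complex.Re (u n)) k k0.
  by apply: le_trans (H n); apply: le_trans (nm_Re_le _); case: (u n.+1) (u n) => ? ? [].
have [n|b Hb] := @real_geometric_limit (fun n => complex.Im (u n)) k k0.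
  by apply: le_trans (H n); apply: le_trans (nm_Im_le _); case: (u n.+1) (u n) => ? ? [].
exists (Complex a b) => n; apply: le_trans (nm_le_ReIm _) _.
rewrite (_ : 4 * k / 2 ^+ n = 2 * k / 2 ^+ n + 2 * k / 2 ^+ n); last by ring.
by rewrite lerD //; [move: (Ha n) | move: (Hb n)]; case: (u n).
Qed.

Lemma pow2_small (k d : R) : 0 < d -> exists n : nat, k / 2 ^+ n < d.
Proof.
move=> d0; exists (Num.trunc (`|k| / d)).+1.
have := Num.Theory.truncnS_gt (`|k| / d); set n := (Num.trunc _).+1 => H.
have kd : `|k| < d * n%:R by rewrite mulrC -ltr_pdivrMr.
rewrite ltr_pdivrMr ?exprn_gt0 //; apply: le_lt_trans (ler_norm k) _; apply: lt_trans kd _.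
by rewrite ltr_pM2l // -natrX ltr_nat ltn_expl.
Qed.

Lemma contraction_fixpoint (T : C -> C) (rho : R) : 0 <= rho ->
  (forall t, nm t <= rho -> nm (T t) <= rho) ->
  (forall t t', nm t <= rho -> nm t' <= rho -> nm (T t - T t') <= nm (t - t') / 2) ->
  exists2 t, nm t <= rho & T t = t.
Proof.
move=> rho0 TD TL; pose u n := iter n T 0.
have uD n : nm (u n) <= rho by elim: n => [|n IH]; [by rewrite -[u 0%N]/(0 : C) nm0 | exact: TD].
have uC n : nm (u n.+1 - u n) <= rho / 2 ^+ n.
  elim: n => [|n IH]; first by rewrite expr0 divr1 subr0 uD.
  apply: le_trans (TL _ _ (uD n.+1) (uD n)) _.
  by rewrite exprS invfM [2^-1 * _]mulrC mulrA ler_wpM2r // invr_ge0.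
have [l Hl] := geometric_limit rho0 uC.
have lD : nm l <= rho.
  apply/ler_addgt0Pr => d d0; have [n nd] := pow2_small (4 * rho) d0.
  have := nmD (u n - (u n - l)) 0; have := nmB (u n) (u n - l).
  rewrite (_ : u n - (u n - l) = l); last by ring.
  by have := Hl n; have := uD n; lra.
exists l => //; apply/eqP; rewrite -subr_eq0 -nm_eq0; apply/eqP/le_anti; rewrite nm_ge0 andbT.
apply/ler_addgt0Pr => d d0; rewrite add0r.
have [n nd] := pow2_small (8 * rho) d0.
have h1 := TL l (u n) lD (uD n); have h2 := nmD (T l - T (u n)) (u n.+1 - l).
rewrite (_ : T l - T (u n) + (u n.+1 - l) = T l - l) in h2; last by rewrite /=; ring.
have h3 := Hl n; have h4 := Hl n.+1; rewrite nm_distC in h3.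
have e : 4 * rho / 2 ^+ n.+1 = 4 * rho / 2 ^+ n / 2 by rewrite exprS invfM; ring.
have e8 : 8 * rho / 2 ^+ n = 4 * rho / 2 ^+ n + 4 * rho / 2 ^+ n by ring.
have p4 : 0 <= 4 * rho / 2 ^+ n by rewrite divr_ge0 ?mulr_ge0 // exprn_ge0.
rewrite e in h4; rewrite e8 in nd; lra.
Qed.

End Estimates.

(** * The trinomial x^L + z x^N = 1 near x = 1 *)

Section Trinomial.
Variables (R : realType) (L N : nat).
Local Notation C := R[i].
Hypotheses (L_gt0 : (0 < L)%N) (NL : (N <= L)%N).
Implicit Types x y z : C.

(** Chosen so that (x^L - y^L)/(x - y) stays within 1/4 of L when x and y are this close to 1, see
    [quotient_near]. *)
Definition near_radius : R := (4 * (L%:R * L%:R * 2 ^+ L))^-1.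
Local Notation r := near_radius.
(** Chosen so that z x^N adds at most 1/4 to the same quotient, see [coef_boundE]. *)
Definition coef_bound : R := (4 * (N%:R * 2 ^+ N + 1))^-1.
Local Notation zb := coef_bound.

Lemma near_radius_gt0 : 0 < r.
Proof. by rewrite invr_gt0 !mulr_gt0 ?exprn_gt0 // ltr0n. Qed.

Lemma near_radiusE : L%:R * (2 ^+ L * L%:R * r) = 4^-1.
Proof.
rewrite /near_radius invfM (_ : _ * (_ * (_ * _)) = 4^-1 * ((L%:R * L%:R * 2 ^+ L) / (L%:R * L%:R * 2 ^+ L))); last by ring.
by rewrite divff ?mulr1 // !mulf_neq0 ?expf_neq0 // pnatr_eq0 -lt0n.
Qed.

Lemma near_radius_le : r <= 2^-1.
Proof.
have := near_radiusE; have := near_radius_gt0; move: (r) => r0 r0p.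
have h1 : 1 <= L%:R :> R by rewrite ler1n.
have h2 : 1 <= (2 : R) ^+ L by rewrite exprn_ege1 // ler1n.
have h : r0 <= L%:R * (2 ^+ L * L%:R * r0).
  rewrite !mulrA ler_peMl ?(ltW r0p) // mulr_ege1 // mulr_ege1 //.
lra.
Qed.

Lemma coef_bound_gt0 : 0 < zb.
Proof.
rewrite invr_gt0 mulr_gt0 // ltr_wpDl // mulr_ge0 // exprn_ge0 //.
Qed.

Lemma coef_boundE z : nm z <= zb -> nm z * (N%:R * 2 ^+ N) <= 4^-1.
Proof.
move=> H; have := coef_bound_gt0; rewrite /zb invr_gt0 => p.
have h : nm z * (4 * (N%:R * 2 ^+ N + 1)) <= 1.
  by rewrite -ler_pdivlMr // mul1r.
have := nm_ge0 z; move: h; rewrite mulrDr mulr1 mulrDr.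
rewrite (_ : nm z * (4 * (N%:R * 2 ^+ N)) = 4 * (nm z * (N%:R * 2 ^+ N))); last by ring.
by lra.
Qed.

Lemma quotient_near x y : nm (x - 1) <= r -> nm (y - 1) <= r ->
  nm (\sum_(i < L) x ^+ (L.-1 - i) * y ^+ i - L%:R) <= 4^-1.
Proof.
move=> xr yr; have [x2 x2' _] := nm_near1 xr near_radius_le.
have [y2 y2' _] := nm_near1 yr near_radius_le.
have r0 := ltW near_radius_gt0.
have -> : L%:R = \sum_(i < L) (1 : C) by rewrite sumr_const card_ord.
rewrite -sumrB; apply: le_trans (nm_sum _ _ _) _.
rewrite -near_radiusE (_ : L%:R * _ = \sum_(i < L) (2 ^+ L * L%:R * r)); last first.
  by rewrite sumr_const card_ord mulr_natl.
apply: ler_sum => i _; have := ltn_ord i; move: (i : nat) => {i} b bL.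
have -> : x ^+ (L.-1 - b) * y ^+ b - 1 = x ^+ (L.-1 - b) * (y ^+ b - 1) + (x ^+ (L.-1 - b) - 1) by ring.
have e1 n u : nm (u - 1) <= r -> nm u <= 2 -> (n <= L.-1)%N -> nm (u ^+ n - 1) <= 2 ^+ n * n%:R * r.
  move=> ur u2 _; have := @exp_dist R u 1 n u2; rewrite nm1 expr1n => /(_ ltac:(lra)) /le_trans; apply.
  by rewrite ler_wpM2l // mulr_ge0 // exprn_ge0.
apply: le_trans (nmD _ _) _; rewrite nmM nmX.
set a := (L.-1 - b)%N.
have ab : (a + b = L.-1)%N by rewrite /a subnK //; lia.
have h1 : nm x ^+ a * nm (y ^+ b - 1) <= 2 ^+ a * (2 ^+ b * b%:R * r).
  apply: ler_pM; rewrite ?nm_ge0 ?exprn_ge0 ?nm_ge0 //.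
    by rewrite lerXn2r ?nnegrE ?nm_ge0.
  by apply: e1 => //; lia.
have h2 := e1 a x xr x2' ltac:(lia).
apply: (@le_trans _ _ (2 ^+ (a + b) * b%:R * r + 2 ^+ (a + b) * a%:R * r)).
  apply: lerD; first by apply: le_trans h1 _; rewrite exprD !mulrA.
  apply: le_trans h2 _; rewrite ler_wpM2r // ler_wpM2r // exprD ler_peMr ?exprn_ge0 //.
  by rewrite exprn_ege1 // ler1n.
rewrite -mulrDl -mulrDr -natrD (addnC b) ab; rewrite ler_wpM2r //.
apply: ler_pM; rewrite ?exprn_ge0 //; last by rewrite ler_nat leq_pred.
by rewrite ler_weXn2l ?ler1n // leq_pred.
Qed.

(** The divided difference of x^L + z x^N is at least L - 1/4 - 1/4 >= 1/2 in modulus. The case z =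
    z', d = 0 is uniqueness of the root, d = 0 is Lipschitz dependence on z, and a nonzero d
    measures the quality of an approximate root. *)
Lemma trinomial_close x y z z' d : nm (x - 1) <= r -> nm (y - 1) <= r -> nm z <= zb ->
  x ^+ L + z * x ^+ N = 1 -> y ^+ L + z' * y ^+ N = 1 + d ->
  nm (x - y) <= 2 * (2 ^+ N * nm (z - z') + nm d).
Proof.
move=> xr yr zz ex ey.
have [x2 x2' _] := nm_near1 xr near_radius_le.
have [y2 y2' _] := nm_near1 yr near_radius_le.
set S := \sum_(i < L) x ^+ (L.-1 - i) * y ^+ i.
set SN := \sum_(i < N) x ^+ (N.-1 - i) * y ^+ i.
have E : (x - y) * (S + z * SN) = - ((z - z') * y ^+ N) - d.
  have e1 : x ^+ L - y ^+ L = (x - y) * S by rewrite subrXX.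
  have e2 : x ^+ N - y ^+ N = (x - y) * SN by rewrite subrXX.
  rewrite mulrDr (mulrCA _ z) -e1 -e2.
  rewrite (_ : x ^+ L = 1 - z * x ^+ N); last by rewrite -ex; ring.
  rewrite (_ : y ^+ L = 1 + d - z' * y ^+ N); last by rewrite -ey; ring.
  by ring.
have SNb : nm (z * SN) <= 4^-1.
  rewrite nmM; apply: le_trans (coef_boundE zz); rewrite ler_wpM2l ?nm_ge0 //.
  apply: le_trans (nm_sum _ _ _) _.
  rewrite (_ : N%:R * _ = \sum_(i < N) 2 ^+ N); last by rewrite sumr_const card_ord mulr_natl.
  apply: ler_sum => i _; rewrite nmM !nmX.
  apply: (@le_trans _ _ (2 ^+ (N.-1 - i) * 2 ^+ i)).
    by apply: ler_pM; rewrite ?exprn_ge0 ?nm_ge0 // lerXn2r ?nnegrE ?nm_ge0.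
  by rewrite -exprD ler_weXn2l ?ler1n //; have := ltn_ord i; lia.
have Sb := quotient_near xr yr.
have L1 : 1 <= L%:R :> R by rewrite ler1n.
have low : 2^-1 <= nm (S + z * SN).
  have h1 := nm_sub (L%:R : C) (L%:R - (S + z * SN)).
  rewrite (_ : L%:R - (L%:R - (S + z * SN)) = S + z * SN) in h1; last by ring.
  have h2 := nmD (L%:R - S) (- (z * SN)).
  rewrite (_ : L%:R - S - z * SN = L%:R - (S + z * SN)) in h2; last by ring.
  by rewrite nmN in h2; rewrite nm_distC in Sb; rewrite nm_nat in h1; lra.
have : nm (x - y) * nm (S + z * SN) <= 2 ^+ N * nm (z - z') + nm d.
  rewrite -nmM E; apply: le_trans (nmB _ _) _; rewrite lerD2r nmN nmM mulrC ler_wpM2r ?nm_ge0 //.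
  by rewrite nmX lerXn2r ?nnegrE ?nm_ge0.
have := nm_ge0 (x - y) => h0 h3.
have : nm (x - y) * 2^-1 <= nm (x - y) * nm (S + z * SN) by rewrite ler_wpM2l.
lra.
Qed.

Lemma trinomial_root z : nm z < r ^+ L / 2 -> nm z <= 2^-1 ->
  exists2 x, nm (x - 1) <= r & x ^+ L + z * x ^+ N = 1.
Proof.
move=> zr z2; pose p : {poly C} := 'X^L + z *: 'X^N - 1.
have pH x : p.[x] = x ^+ L + z * x ^+ N - 1 by rewrite /p !hornerE.
have r0 := near_radius_gt0.
have lower : 2^-1 <= nm (p`_L).
  rewrite /p coefB coefD coefZ !coefXn coef1 eqxx (_ : (L == 0)%N = false) ?subr0; last by lia.
  case: (L == N); last by rewrite mulr0 addr0 nm1; lra.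
  by rewrite mulr1; have := nm_sub 1 (- z); rewrite opprK nm1 nmN; lra.
have sp : size p = L.+1.
  apply/eqP; rewrite eqn_leq; apply/andP; split.
    apply/leq_sizeP => j jL; rewrite /p coefB coefD coefZ !coefXn coef1.
    rewrite (_ : (j == L) = false); last by lia.
    rewrite (_ : (j == N) = false); last by lia.
    by rewrite (_ : (j == 0)%N = false) ?mulr0 ?addr0 ?subr0 //; lia.
  rewrite ltnNge; apply/negP => /leq_sizeP /(_ L (leqnn L)) H; move: lower.
  by rewrite H nm0; lra.
have [] := @near_root R p r r0.
  rewrite lead_coefE sp /= pH !expr1n mulr1 addrC addKr.
  have : 2^-1 * r ^+ L <= nm p`_L * r ^+ L by rewrite ler_wpM2r // exprn_ge0 // ltW.
  by lra.
move=> x /rootP; rewrite pH => /eqP; rewrite subr_eq0 => /eqP E xr.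
by exists x.
Qed.

Lemma power_root a : nm (a - 1) < r ^+ L -> exists2 x, nm (x - 1) <= r & x ^+ L = a.
Proof.
move=> ar; have r0 := near_radius_gt0.
have [] := @near_root R ('X^L - a%:P) r r0.
  by rewrite (monicP (monicXnsubC _ L_gt0)) nm1 mul1r size_XnsubC //= !hornerE expr1n nm_distC.
move=> x /rootP; rewrite !hornerE => /eqP; rewrite subr_eq0 => /eqP E xr.
by exists x.
Qed.

End Trinomial.

(** * Parametrisation of the Bethe roots *)

Section Solutions.
Variables (R : realType) (L N : nat).
Local Notation C := R[i].
Hypotheses (L_gt0 : (0 < L)%N) (N_gt0 : (0 < N)%N) (NL : (N <= L)%N).
Variables (sg : C) (rt : 'I_L -> C).
Hypotheses (sg2 : sg * sg = 1) (rt_pow : forall i, rt i ^+ L = sg) (rt_inj : injective rt).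
Hypothesis rt_all : forall x, x ^+ L = sg -> exists i, x = rt i.
Local Notation r := (near_radius R L).
Local Notation index := {ffun 'I_N -> 'I_L}.
Implicit Types (eta : 'I_N -> C) (t eps : C).

Lemma nm_rt i : nm (rt i) = 1.
Proof.
have sg1 : nm sg = 1.
  by apply/eqP; rewrite -(pexpr_eq1 (n := 2)) ?nm_ge0 // expr2 -nmM sg2 nm1.
by apply/eqP; rewrite -(pexpr_eq1 L_gt0) ?nm_ge0 // -nmX rt_pow sg1.
Qed.

(** Write eps = 1/zeta, eta_j^L = 1 - 1/w_j and t = eps / prod eta. The Bethe equations then say
    that 1/w_j divided by t eta_j^N is an L-th root of [sg]. Once this root is named, each eta_j
    solves a trinomial equation in which the other roots enter only through t. *)
Definition local_data (w0 : index) t eta :=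
  forall j, nm (eta j - 1) <= r /\ eta j ^+ L + rt (w0 j) * t * eta j ^+ N = 1.

(** The trinomial makes each eta_j a Lipschitz function [h] of t. It remains to solve t prod h(t) =
    eps, which is the fixed point equation of t -> eps + t (1 - prod h(t)), a contraction of the
    disc of radius 2|eps|. *)
Lemma local_data_ex : exists2 rho : R, 0 < rho & forall eps, nm eps < rho -> forall w0,
  exists t eta, [/\ nm t <= 2 * nm eps, local_data w0 t eta, t * \prod_j eta j = eps &
    forall t' eta', nm t' <= 2 * nm eps -> local_data w0 t' eta' -> t' * \prod_j eta' j = eps ->
      t' = t /\ eta' =1 eta].
Proof.
have r0 := near_radius_gt0 R L_gt0; have r2 := near_radius_le R L_gt0.
pose zb := coef_bound R N; have zb0 : 0 < zb := coef_bound_gt0 R N.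
have rL0 : 0 < r ^+ L by rewrite exprn_gt0.
pose rho1 := Num.min (r ^+ L / 4) (Num.min 2^-1 zb).
have rho1_0 : 0 < rho1 by rewrite /rho1 !lt_min zb0 invr_gt0 ltr0n !andbT divr_gt0.
have rho1P t : nm t <= rho1 -> [/\ nm t < r ^+ L / 2, nm t <= 2^-1 & nm t <= zb].
  by rewrite /rho1 !le_min => /andP[h /andP[-> ->]]; split=> //; lra.
have nmrt i t : nm (rt i * t) = nm t by rewrite nmM nm_rt mul1r.
have /choice[h0 Hh0] : forall it : 'I_L * C, exists x, nm it.2 <= rho1 ->
    nm (x - 1) <= r /\ x ^+ L + rt it.1 * it.2 * x ^+ N = 1.
  move=> [i t] /=.
  have [tr|_] := leP (nm t) rho1; last by exists 0.
  have [h1 h2 h3] := rho1P t tr.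
  have [||x xr xE] := trinomial_root L_gt0 NL (z := rt i * t); rewrite ?nmrt //.
  by exists x.
pose h i t := h0 (i, t).
have hr i t : nm t <= rho1 -> nm (h i t - 1) <= r by move=> /(Hh0 (i, t))[].
have hE i t : nm t <= rho1 -> h i t ^+ L + rt i * t * h i t ^+ N = 1 by move=> /(Hh0 (i, t))[].
have hu i t x : nm t <= rho1 -> nm (x - 1) <= r -> x ^+ L + rt i * t * x ^+ N = 1 -> x = h i t.
  move=> tr xr xE; have [_ _ tz] := rho1P t tr.
  have := @trinomial_close R L N L_gt0 NL x (h i t) (rt i * t) (rt i * t) 0 xr (hr i t tr).
  rewrite nmrt addr0 subrr nm0 mulr0 addr0 mulr0 => /(_ tz xE (hE i t tr)) H.
  by apply/eqP; rewrite -subr_eq0 -nm_eq0 eq_le H nm_ge0.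
have h2 i t : nm t <= rho1 -> nm (h i t) <= 2 by move=> tr; have [] := nm_near1 (hr i t tr) r2.
have hL i t t' : nm t <= rho1 -> nm t' <= rho1 -> nm (h i t - h i t') <= 2 * 2 ^+ N * nm (t - t').
  move=> tr tr'; have [_ _ tz] := rho1P t tr.
  have := @trinomial_close R L N L_gt0 NL (h i t) (h i t') (rt i * t) (rt i * t') 0 (hr i t tr) (hr i t' tr').
  by rewrite nmrt addr0 -mulrBr nmrt nm0 addr0 mulrA => /(_ tz (hE i t tr) (hE i t' tr')).
have h1 i t : nm t <= rho1 -> nm (h i t - 1) <= 2 * 2 ^+ N * nm t.
  move=> tr; have [_ _ tz] := rho1P t tr.
  have := @trinomial_close R L N L_gt0 NL (h i t) 1 (rt i * t) 0 0 (hr i t tr).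
  by rewrite subrr nm0 (ltW r0) nmrt !expr1n mul0r !addr0 subr0 nmrt mulrA => /(_ isT tz (hE i t tr) erefl).
(* A Lipschitz constant for t -> prod h(t): each of the N factors has constant 2 * 2^N, and
   [prod_dist] costs another 2^N. *)
pose c : R := 2 ^+ N * (N%:R * (2 * 2 ^+ N)).
have c0 : 0 <= c by rewrite !mulr_ge0 ?exprn_ge0.
pose P (w0 : index) t := \prod_j h (w0 j) t.
have PL w0 t t' : nm t <= rho1 -> nm t' <= rho1 -> nm (P w0 t - P w0 t') <= c * nm (t - t').
  move=> tr tr'; apply: le_trans (prod_dist _ (fun j => h2 (w0 j) t tr) (fun j => h2 (w0 j) t' tr')) _.
  rewrite /index_enum -enumT size_enum_ord /c -!mulrA ler_wpM2l ?exprn_ge0 //.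
  rewrite mulr_natl -[X in _ *+ X](card_ord N) -sumr_const big_enum.
  by apply: ler_sum => j _; rewrite mulrA hL.
have P1 w0 t : nm t <= rho1 -> nm (P w0 t - 1) <= c * nm t.
  move=> tr; apply: le_trans (prod_dist1 (fun j => h2 (w0 j) t tr)) _.
  rewrite /c -!mulrA ler_wpM2l ?exprn_ge0 //.
  rewrite mulr_natl -[X in _ *+ X](card_ord N) -sumr_const.
  by apply: ler_sum => j _; rewrite mulrA h1.
(* The first bound keeps the disc of radius 2|eps| inside [rho1]; the second gives 2 c |eps| <= 1/4,
   so that each of the two parts of T t - T t' is at most |t - t'|/4. *)
exists (Num.min (rho1 / 2) (8 * (c + 1))^-1).
  by rewrite lt_min divr_gt0 // invr_gt0 mulr_gt0 // ltr_wpDl.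
move=> eps; rewrite lt_min => /andP[e1 e2] w0.
have ec : c * (2 * nm eps) <= 4^-1.
  have c1 : 0 < 8 * (c + 1) by rewrite mulr_gt0 // ltr_wpDl.
  have : nm eps * (8 * (c + 1)) <= 1 by rewrite -ler_pdivlMr // mul1r ltW.
  rewrite (_ : nm eps * (8 * (c + 1)) = 4 * (c * (2 * nm eps)) + 8 * nm eps); last by ring.
  by have := nm_ge0 eps; lra.
have tr t : nm t <= 2 * nm eps -> nm t <= rho1 by lra.
pose T t := eps + t * (1 - P w0 t).
have TL t t' : nm t <= 2 * nm eps -> nm t' <= 2 * nm eps -> nm (T t - T t') <= nm (t - t') / 2.
  move=> th th'; have q1 := P1 w0 t (tr t th); have q2 := PL w0 t t' (tr t th) (tr t' th').
  rewrite (_ : T t - T t' = - ((t - t') * (P w0 t - 1)) - t' * (P w0 t - P w0 t')); last by rewrite /T; ring.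
  apply: le_trans (nmB _ _) _; rewrite nmN !nmM.
  have a1 : nm (t - t') * nm (P w0 t - 1) <= nm (t - t') * 4^-1.
    rewrite ler_wpM2l ?nm_ge0 //; apply: le_trans q1 _; apply: le_trans ec.
    by rewrite ler_wpM2l.
  have a2 : nm t' * nm (P w0 t - P w0 t') <= nm (t - t') * 4^-1.
    apply: (@le_trans _ _ (2 * nm eps * (c * nm (t - t')))).
      by apply: ler_pM; rewrite ?nm_ge0.
    rewrite (_ : _ * _ = nm (t - t') * (c * (2 * nm eps))); last by ring.
    by rewrite ler_wpM2l ?nm_ge0.
  by lra.
have TD t : nm t <= 2 * nm eps -> nm (T t) <= 2 * nm eps.
  move=> th; have q1 := P1 w0 t (tr t th); apply: le_trans (nmD _ _) _; rewrite nmM nm_distC.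
  have : nm t * nm (P w0 t - 1) <= 2 * nm eps * 4^-1.
    apply: ler_pM; rewrite ?nm_ge0 //; apply: le_trans q1 _; apply: le_trans ec.
    by rewrite ler_wpM2l.
  by have := nm_ge0 eps; lra.
have [t th tE] := contraction_fixpoint (mulr_ge0 (ler0n R 2) (nm_ge0 eps)) TD TL.
have TE t' : (T t' == t') = (t' * P w0 t' == eps).
  rewrite -subr_eq0 -[RHS]subr_eq0 -oppr_eq0; congr (_ == 0); rewrite /T; ring.
exists t, (fun j => h (w0 j) t); split=> //.
- by move=> j; split; [apply: hr; apply: tr | apply: hE; apply: tr].
- by apply/eqP; rewrite -TE tE.
move=> t' eta' th' d' tE'.
have e' j : eta' j = h (w0 j) t' by have [a b] := d' j; apply: hu => //; apply: tr.
have : t' * P w0 t' == eps by rewrite -tE' /P (eq_bigr eta').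
rewrite -TE => /eqP tE2.
have tt : t' = t.
  apply/eqP; rewrite -subr_eq0 -nm_eq0; have := TL t' t th' th; rewrite tE2 tE.
  by have := nm_ge0 (t' - t) => a b; apply/eqP; lra.
by split=> // j; rewrite e' tt.
Qed.

Lemma half_pow_le n : 2^-1 / 2 ^+ n <= 2^-1 :> R.
Proof. by rewrite ler_pdivrMr ?exprn_gt0 // ler_peMr ?invr_ge0 // exprn_ege1 // ler1n. Qed.

(** The Bethe equations after elimination of z: for [sg] = (-1)^(N+1) the right-hand side is z^L. *)
Definition bethe_sys (zeta : C) (w : {ffun 'I_N -> C}) := forall i,
  [/\ w i != 0, 1 - (w i)^-1 != 0 &
  w i ^+ L * (1 - (w i)^-1) ^+ N = sg * zeta ^+ L * \prod_j (1 - (w j)^-1)].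

(** Excludes solutions outside the perturbative regime. Put a_j = 1 - 1/w_j and e = prod a_j. Where
    |a_j| is smallest, |a_j|^N <= |e| and hence |1/w_j| <= |eps|. So every |a_j| is at least 1/2 and
    |e| >= 2^-N. Once |a_j| <= 2 is known, the equation bounds |1/w_j|^L by 4^N |eps|^L. *)
Lemma bethe_sys_bound (eps : C) w : eps != 0 -> nm eps < 2^-1 / 2 ^+ N -> bethe_sys eps^-1 w ->
  forall j, nm (w j)^-1 <= 4 ^+ N * nm eps.
Proof.
move=> eps0 eps_small sw.
pose a j := 1 - (w j)^-1; pose e := \prod_j a j.
have a0 j : a j != 0 by have [] := sw j.
have e0 : e != 0 by apply/prodf_neq0 => j _; exact: a0.
have sg1 : nm sg = 1.
  by apply/eqP; rewrite -(pexpr_eq1 (n := 2)) ?nm_ge0 // expr2 -nmM sg2 nm1.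
have E j : nm (a j) ^+ N * nm eps ^+ L = nm e * nm (w j)^-1 ^+ L.
  have [w0 _ H] := sw j.
  have W0 : nm (w j) ^+ L != 0 by rewrite -nmX nm_eq0 expf_neq0.
  have P0 : nm eps ^+ L != 0 by rewrite -nmX nm_eq0 expf_neq0.
  have : nm (w j) ^+ L * nm (a j) ^+ N = (nm eps ^+ L)^-1 * nm e.
    by rewrite -!nmX -nmM H !nmM sg1 mul1r nmX nmV exprVn -nmX.
  move=> /(congr1 (fun z => z * nm eps ^+ L / nm (w j) ^+ L)).
  rewrite nmV exprVn => H'.
  transitivity (nm (w j) ^+ L * nm (a j) ^+ N * nm eps ^+ L / nm (w j) ^+ L); first by field.
  by rewrite H'; field; rewrite W0 P0.
have e1 : nm eps ^+ L <= nm eps.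
  rewrite -[X in _ <= X]expr1 ler_wiXn2l ?nm_ge0 //.
  have : 2^-1 / 2 ^+ N <= 2^-1 :> R by exact: half_pow_le.
  by lra.
have eps_half : nm eps <= 2^-1.
  have : 2^-1 / 2 ^+ N <= 2^-1 :> R by exact: half_pow_le.
  by lra.
have nme0 : 0 < nm e by rewrite nm_gt0.
have [i0 i0P] : exists i0, forall j, nm (a i0) <= nm (a j).
  case: (arg_minP (fun j => nm (a j)) (isT : xpredT (Ordinal N_gt0))) => i0 _ H.
  by exists i0 => j; exact: H.
have amin : nm (w i0)^-1 <= nm eps.
  have : nm (a i0) ^+ N <= nm e.
    rewrite /e nm_prod -[X in _ ^+ X](card_ord N) -prodr_const.
    by apply: ler_prod => j _; rewrite nm_ge0 i0P.
  move=> H; rewrite -(ler_pXn2r L_gt0) ?nnegrE ?nm_ge0 // -(ler_pM2l nme0) -E.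
  by apply: ler_wpM2r => //; apply: exprn_ge0; exact: nm_ge0.
have alow j : 2^-1 <= nm (a j).
  have h : _ <= nm (a i0) := nm_sub 1 (w i0)^-1; rewrite nm1 in h; apply: le_trans (i0P j); lra.
have elow : (2 ^+ N)^-1 <= nm e.
  rewrite -exprVn /e nm_prod -[X in _ ^+ X](card_ord N) -prodr_const.
  by apply: ler_prod => j _; rewrite invr_ge0 ler0n alow.
move=> j.
have wle : nm (w j)^-1 <= 1 + nm (a j).
  have := nmB 1 (a j); rewrite nm1 (_ : 1 - a j = (w j)^-1) // /a; ring.
(* If |a_j| > 2 then |1/w_j| >= |a_j|/2, and |a_j|^N <= |a_j|^L because N <= L; the powers of a_j
   cancel and eps is too small. *)
have ale : nm (a j) <= 2.
  rewrite leNgt; apply/negP => a2.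
  have w2 : nm (a j) / 2 <= nm (w j)^-1.
    have := nm_sub (a j) 1; rewrite nm1 (_ : a j - 1 = - (w j)^-1); last by rewrite /a; ring.
    by rewrite nmN; lra.
  have := E j => Ej.
  have h1 : (nm (a j) / 2) ^+ L <= nm (w j)^-1 ^+ L.
    by rewrite ler_pXn2r // ?nnegrE ?nm_ge0 //; apply: divr_ge0; rewrite ?nm_ge0.
  have h2 : nm (a j) ^+ N <= nm (a j) ^+ L by rewrite ler_weXn2l //; lra.
  have h3 : nm e * (nm (a j) / 2) ^+ L <= nm (a j) ^+ L * nm eps ^+ L.
    apply: (@le_trans _ _ (nm e * nm (w j)^-1 ^+ L)); first by rewrite ler_wpM2l // ltW.
    by rewrite -Ej ler_wpM2r // exprn_ge0 // nm_ge0.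
  have aL : 0 < nm (a j) ^+ L by rewrite exprn_gt0 //; lra.
  rewrite expr_div_n mulrCA ler_pM2l // in h3.
  have h4 : (2 ^+ N)^-1 / 2 ^+ L <= nm eps ^+ L.
    by apply: le_trans h3; rewrite ler_wpM2r // invr_ge0 exprn_ge0.
  have h5 : nm eps ^+ L < (2^-1 / 2 ^+ N) ^+ L.
    have hp : 0 <= 2^-1 / 2 ^+ N :> R by rewrite divr_ge0 ?invr_ge0 ?exprn_ge0 ?ler0n.
    by rewrite ltr_pXn2r // ?nnegrE ?nm_ge0.
  have h6 : (2^-1 / 2 ^+ N) ^+ L <= (2 ^+ N)^-1 / 2 ^+ L :> R.
    rewrite exprMn exprVn mulrC ler_wpM2r ?invr_ge0 ?exprn_ge0 //.
    rewrite exprVn lef_pV2 ?posrE ?exprn_gt0 ?exprn_gt0 //.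
    by rewrite -[X in X <= _]expr1 ler_weXn2l // exprn_ege1 // ler1n.
  by lra.
rewrite -(ler_pXn2r L_gt0) ?nnegrE ?nm_ge0 ?mulr_ge0 ?exprn_ge0 ?nm_ge0 //.
have h1 : nm (w j)^-1 ^+ L <= 4 ^+ N * nm eps ^+ L.
  have p2 : 0 < (2 ^+ N)^-1 :> R by rewrite invr_gt0 exprn_gt0.
  rewrite -(ler_pM2l p2) mulrA (_ : 4 = 2 * 2 :> R); last by ring.
  rewrite exprMn mulKf ?expf_neq0 ?pnatr_eq0 //.
  apply: (@le_trans _ _ (nm e * nm (w j)^-1 ^+ L)).
    by rewrite ler_wpM2r // exprn_ge0 // nm_ge0.
  have p2n : 0 <= nm eps ^+ L by rewrite exprn_ge0 ?nm_ge0.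
  by rewrite -E; apply: ler_wpM2r p2n _ _ _; rewrite lerXn2r ?nnegrE ?nm_ge0 ?ler0n.
apply: le_trans h1 _; rewrite exprMn ler_wpM2r ?exprn_ge0 ?nm_ge0 //.
by rewrite -[X in X <= _]expr1 ler_weXn2l // exprn_ege1 // ler1n.
Qed.

Definition root_of_data eta : {ffun 'I_N -> C} := [ffun j => (1 - eta j ^+ L)^-1].

(** The root determines eta_j in the disc around 1, then t, then the branch, whence injectivity. For
    exhaustiveness, [bethe_sys_bound] puts 1 - 1/w_j close enough to 1 to have an L-th root in the
    disc, and the branch is read off from [om]. *)
Lemma bethe_sys_enum : exists2 rho : R, 0 < rho & forall eps, eps != 0 -> nm eps < rho ->
  exists (t : index -> C) (eta : index -> 'I_N -> C),
  [/\ forall w0, [/\ nm (t w0) <= 2 * nm eps, local_data w0 (t w0) (eta w0) & t w0 * \prod_j eta w0 j = eps],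
      forall w0, bethe_sys eps^-1 (root_of_data (eta w0)),
      injective (fun w0 => root_of_data (eta w0)) &
      forall w, bethe_sys eps^-1 w -> exists w0, w = root_of_data (eta w0)].
Proof.
have r0 := near_radius_gt0 R L_gt0; have r2 := near_radius_le R L_gt0.
have [rho1 rho10 H1] := local_data_ex.
have rL0 : 0 < r ^+ L by rewrite exprn_gt0.
exists (Num.min rho1 (Num.min (2^-1 / 2 ^+ N) (Num.min (r ^+ L / 4 ^+ N) (2 * (2 ^+ N * (N%:R * 4 ^+ N)))^-1))).
  have d1 : 0 < 2 * (2 ^+ N * (N%:R * 4 ^+ N)) :> R.
    by apply: mulr_gt0 => //; apply: mulr_gt0; [exact: exprn_gt0 | apply: mulr_gt0; [rewrite ltr0n | exact: exprn_gt0]].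
  have d2 : 0 < 2^-1 / 2 ^+ N :> R by apply: divr_gt0; [rewrite invr_gt0 | exact: exprn_gt0].
  have d3 : 0 < r ^+ L / 4 ^+ N by apply: divr_gt0 => //; exact: exprn_gt0.
  by rewrite !lt_min rho10 d2 d3 invr_gt0 d1.
move=> eps eps0; rewrite !lt_min => /andP[e1 /andP[e2 /andP[e3 e4]]].
have /choice[t /choice[eta H]] := H1 eps e1.
have D w0 j : nm (eta w0 j - 1) <= r by have [_ /(_ j)[]] := H w0.
have DE w0 j : eta w0 j ^+ L + rt (w0 j) * t w0 * eta w0 j ^+ N = 1 by have [_ /(_ j)[]] := H w0.
have tE w0 : t w0 * \prod_j eta w0 j = eps by have [] := H w0.
have eta0 w0 j : eta w0 j != 0 by have [] := nm_near1 (D w0 j) r2.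
have t0 w0 : t w0 != 0 by apply: contraNneq eps0 => t00; rewrite -(tE w0) t00 mul0r.
have rt0 i : rt i != 0 by rewrite -nm_eq0 nm_rt oner_eq0.
have one_a w0 j : 1 - eta w0 j ^+ L = rt (w0 j) * t w0 * eta w0 j ^+ N.
  by rewrite -(DE w0 j) addrC addKr.
exists t, eta; split.
- by move=> w0; have [] := H w0.
- move=> w0 j; rewrite ffunE invrK.
  have a0 : rt (w0 j) * t w0 * eta w0 j ^+ N != 0 by rewrite !mulf_neq0 ?expf_neq0.
  have e0 : eta w0 j ^+ L != 0 by rewrite expf_neq0.
  rewrite (_ : 1 - (1 - eta w0 j ^+ L) = eta w0 j ^+ L); last by ring.
  split=> //; first by rewrite invr_eq0 one_a.
  under eq_bigr => k _ do rewrite ffunE invrK opprB addrC subrK.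
  rewrite one_a -(tE w0) prodrXl.
  have p0 : \prod_j eta w0 j != 0 by apply/prodf_neq0.
  set p := \prod_j _ in p0 *.
  have sg0 : sg != 0 by rewrite -(rt_pow (w0 j)) expf_neq0.
  rewrite !exprVn !exprMn rt_pow -!exprM (mulnC L N).
  have sgV : sg = sg^-1 by apply: (mulfI sg0); rewrite sg2 mulfV.
  rewrite [in RHS]sgV.
  by field; rewrite ?expf_neq0 ?sg0 ?p0 ?t0 ?eta0.
- move=> w0 w1 /ffunP E.
  have ee j : eta w0 j = eta w1 j.
    have := E j; rewrite !ffunE => /invr_inj /(congr1 (fun z => 1 - z)); rewrite !subKr => ej.
    have := quotient_near L_gt0 NL (D w0 j) (D w1 j); set S := \sum_(i < L) _ => HS.
    have : (eta w0 j - eta w1 j) * S = 0 by rewrite -subrXX ej subrr.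
    move/eqP; rewrite mulf_eq0 subr_eq0 => /orP[/eqP //|/eqP S0].
    move: HS; rewrite S0 sub0r nmN nm_nat => HS.
    have L1 : 1 <= L%:R :> R by rewrite ler1n.
    by exfalso; lra.
  have tt : t w0 = t w1.
    have p0 : \prod_j eta w0 j != 0 by apply/prodf_neq0.
    by apply: (mulIf p0); rewrite tE -(tE w1); congr (_ * _); apply: eq_bigr.
  apply/ffunP => j; apply: rt_inj.
  have e0 : t w0 * eta w0 j ^+ N != 0 by rewrite mulf_neq0 ?expf_neq0.
  by apply: (mulIf e0); rewrite mulrA -one_a tt ee mulrA -one_a.
move=> w sw.
have wb := bethe_sys_bound eps0 e2 sw.
have /choice[et Het] : forall j, exists x, nm (x - 1) <= r /\ x ^+ L = 1 - (w j)^-1.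
  move=> j; have [|x xr xE] := power_root L_gt0 (a := 1 - (w j)^-1).
    rewrite addrC addKr nmN; apply: le_lt_trans (wb j) _.
    by rewrite mulrC -ltr_pdivlMr ?exprn_gt0.
  by exists x.
have et0 j : et j != 0 by have [/nm_near1 /(_ r2)[]] := Het j.
have p0 : \prod_j et j != 0 by apply/prodf_neq0.
pose tt := eps / \prod_j et j.
have tt0 : tt != 0 by rewrite mulf_neq0 ?invr_eq0.
have wE j : (w j)^-1 = 1 - et j ^+ L by have [_ ->] := Het j; rewrite subKr.
pose om j := (w j)^-1 / (tt * et j ^+ N).
have /choice[i0 Hi0] : forall j, exists i, om j = rt i.
  move=> j; apply: rt_all; have [w0 a0 E] := sw j.
  have [_ aE] := Het j.
  have E2 : \prod_k (1 - (w k)^-1) = (\prod_k et k) ^+ L.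
    by rewrite -prodrXl; apply: eq_bigr => k _; have [_ ->] := Het k.
  rewrite E2 -aE -exprM in E.
  rewrite /om /tt !(exprMn, exprVn, invfM, invrK) -!exprM.
  have W0 : w j ^+ L != 0 by rewrite expf_neq0.
  have -> : (w j ^+ L)^-1 = et j ^+ (L * N) / (sg * eps^-1 ^+ L * (\prod_k et k) ^+ L).
    by rewrite -E invfM mulrCA divff ?mulr1 // expf_neq0.
  have sg0 : sg != 0 by apply: contra_eq_neq sg2 => ->; rewrite mul0r eq_sym oner_eq0.
  rewrite exprVn (mulnC N L).
  have {2}-> : sg = sg^-1 by apply: (mulfI sg0); rewrite sg2 mulfV.
  by field; rewrite ?expf_neq0 ?sg0 ?eps0 ?p0 ?et0.
pose w0 : index := [ffun j => i0 j].
exists w0.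
have [th _ _ uni] := H w0.
(* Uniqueness in [local_data_ex] is limited to |tt| <= 2|eps|, that is |prod et| >= 1/2; this
   follows from the same bound for its L-th power, the product of the 1 - 1/w_j. *)
have [] := uni tt et.
- rewrite /tt nmM nmV mulrC ler_wpM2r ?nm_ge0 //.
  rewrite invf_ple ?posrE ?nm_gt0 //.
  have one2 : nm (1 : C) <= 2 by rewrite nm1; lra.
  have a2 j : nm (1 - (w j)^-1) <= 2.
    apply: le_trans (nmB _ _) _; rewrite nm1; have := wb j.
    have : 4 ^+ N * nm eps <= 1.
      rewrite mulrC -ler_pdivlMr ?exprn_gt0 // mul1r; apply: le_trans (ltW e3) _.
      rewrite -[X in _ <= X]mul1r ler_wpM2r ?invr_ge0 ?exprn_ge0 //.
      by rewrite exprn_ile1 // ?(ltW r0) //; lra.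
    by lra.
  have c0 : 0 < 2 * (2 ^+ N * (N%:R * 4 ^+ N)) :> R by rewrite !mulr_gt0 ?exprn_gt0 ?ltr0n.
  have pd := prod_dist1 a2.
  have pl : nm (\prod_j (1 - (w j)^-1) - 1) <= 2^-1.
    apply: le_trans pd _; apply: (@le_trans _ _ (2 ^+ N * (N%:R * (4 ^+ N * nm eps)))).
      rewrite ler_wpM2l ?exprn_ge0 // mulr_natl -[X in _ *+ X](card_ord N) -sumr_const.
      by apply: ler_sum => j _; rewrite addrC addKr nmN wb.
    have : nm eps * (2 * (2 ^+ N * (N%:R * 4 ^+ N))) <= 1 by rewrite -ler_pdivlMr // mul1r ltW.
    rewrite (_ : nm eps * _ = 2 * (2 ^+ N * (N%:R * (4 ^+ N * nm eps)))); last by ring.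
    by lra.
  have pL : 2^-1 <= nm (\prod_j et j) ^+ L.
    rewrite -nmX -prodrXl (eq_bigr (fun j => 1 - (w j)^-1)) => [|j _]; last by have [_ ->] := Het j.
    have h := nm_sub 1 (1 - \prod_j (1 - (w j)^-1)).
    by rewrite subKr nm1 nm_distC in h; lra.
  have pl2 : 2^-1 <= nm (\prod_j et j).
    rewrite leNgt; apply/negP => h; move: pL; rewrite leNgt => /negP; apply.
    apply: (le_lt_trans _ h); rewrite -[X in _ <= X]expr1 ler_wiXn2l ?nm_ge0 //; lra.
  exact: pl2.
- move=> j; have [xr xE] := Het j; split=> //.
  have tn0 : tt * et j ^+ N != 0 by apply: mulf_neq0 => //; exact: expf_neq0.
  have omE : om j * (tt * et j ^+ N) = (w j)^-1 by rewrite /om divfK.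
  by rewrite ffunE -Hi0 -mulrA omE wE addrC subrK.
- by rewrite /tt divfK.
move=> _ ee; apply/ffunP => j; rewrite ffunE -ee -wE invrK //.
Qed.

End Solutions.

(** * Asymptotics of the spectral sum *)

Section BigO.
Variables (R : realType) (A : Type) (t : A -> R[i]) (M : nat).
Hypothesis t1 : forall a, nm (t a) <= 1.
Implicit Types f g h : A -> R[i].

Definition bdO f := exists2 k : R, 0 <= k & forall a, nm (f a) <= k.
(** f = g + O(t^M), uniformly over the type [A], which will consist of all admissible pairs (t, eta)
    for a fixed branch. *)
Definition eqO f g := exists2 k : R, 0 <= k & forall a, nm (f a - g a) <= k * nm (t a) ^+ M.

Lemma eqOxx f : eqO f f.
Proof. by exists 0 => // a; rewrite subrr nm0 mul0r. Qed.
Lemma eqO_sym f g : eqO f g -> eqO g f.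
Proof. by move=> [k k0 H]; exists k => // a; rewrite nm_distC. Qed.
Lemma eqO_trans g f h : eqO f g -> eqO g h -> eqO f h.
Proof.
move=> [k k0 H] [k' k0' H']; exists (k + k'); first exact: addr_ge0.
move=> a; rewrite (_ : _ - _ = (f a - g a) + (g a - h a)); last by ring.
by apply: le_trans (nmD _ _) _; rewrite mulrDl lerD.
Qed.
Lemma eqOD f f' g g' : eqO f f' -> eqO g g' -> eqO (fun a => f a + g a) (fun a => f' a + g' a).
Proof.
move=> [k k0 H] [k' k0' H']; exists (k + k'); first exact: addr_ge0.
move=> a; rewrite (_ : _ - _ = (f a - f' a) + (g a - g' a)); last by ring.
by apply: le_trans (nmD _ _) _; rewrite mulrDl lerD.
Qed.
Lemma bd_eqO f g : eqO f g -> bdO f -> bdO g.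
Proof.
move=> [k k0 H] [k' k0' H']; exists (k + k'); first exact: addr_ge0.
move=> a; rewrite (_ : g a = - (f a - g a) + f a); last by ring.
apply: le_trans (nmD _ _) _; rewrite nmN lerD //; apply: le_trans (H a) _.
by rewrite ler_piMr // exprn_ile1 // nm_ge0.
Qed.
Lemma bdOM f g : bdO f -> bdO g -> bdO (fun a => f a * g a).
Proof.
move=> [k k0 H] [k' k0' H']; exists (k * k'); first exact: mulr_ge0.
by move=> a; rewrite nmM ler_pM // nm_ge0.
Qed.
Lemma bdOD f g : bdO f -> bdO g -> bdO (fun a => f a + g a).
Proof.
move=> [k k0 H] [k' k0' H']; exists (k + k'); first exact: addr_ge0.
by move=> a; apply: le_trans (nmD _ _) _; rewrite lerD.
Qed.
Lemma bdO_cst c : bdO (fun=> c).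
Proof. by exists (nm c); rewrite ?nm_ge0. Qed.
Lemma bdOX f n : bdO f -> bdO (fun a => f a ^+ n).
Proof.
move=> [k k0 H]; exists (k ^+ n); first exact: exprn_ge0.
by move=> a; rewrite nmX lerXn2r ?nnegrE ?nm_ge0.
Qed.
Lemma bdO_low f (c : R) : 0 < c -> (forall a, c <= nm (f a)) -> bdO (fun a => (f a)^-1).
Proof.
move=> c0 H; exists c^-1; first by rewrite invr_ge0 ltW.
by move=> a; rewrite nmV lef_pV2 ?posrE //; apply: lt_le_trans (H a).
Qed.
Lemma bdOXz f (n : int) : bdO f -> bdO (fun a => (f a)^-1) -> bdO (fun a => f a ^ n).
Proof.
case: n => n Hf Hf'; first exact: bdOX.
rewrite /exprz; have [k k0 H] := bdOX n.+1 Hf'; exists k => // a.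
by move: (H a); rewrite exprVn.
Qed.
Lemma eqOM f f' g g' : eqO f f' -> eqO g g' -> bdO f -> bdO g ->
  eqO (fun a => f a * g a) (fun a => f' a * g' a).
Proof.
move=> ff gg bf bg; have [k2 k20 H2] := bd_eqO ff bf.
move: ff gg bg => [k k0 H] [k' k0' H'] [k1 k10 H1].
exists (k * k1 + k2 * k'); first by rewrite addr_ge0 ?mulr_ge0.
move=> a; rewrite (_ : _ - _ = (f a - f' a) * g a + f' a * (g a - g' a)); last by ring.
apply: le_trans (nmD _ _) _; rewrite !nmM mulrDl lerD //.
  by rewrite mulrAC; apply: ler_pM; rewrite ?nm_ge0.
by rewrite -mulrA; apply: ler_pM; rewrite ?nm_ge0.
Qed.
Lemma eqOX f f' n : eqO f f' -> bdO f -> eqO (fun a => f a ^+ n) (fun a => f' a ^+ n).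
Proof.
move=> H b; elim: n => [|n IH].
  by exists 0 => // a; rewrite !expr0 subrr nm0 mul0r.
have [k k0 Hk] := eqOM H IH b (bdOX n b).
by exists k => // a; rewrite !exprS.
Qed.
Lemma eqOV f g (c : R) : 0 < c -> (forall a, c <= nm (f a)) -> (forall a, c <= nm (g a)) ->
  eqO f g -> eqO (fun a => (f a)^-1) (fun a => (g a)^-1).
Proof.
move=> c0 Hf Hg [k k0 H]; exists (k / (c * c)); first by rewrite divr_ge0 // mulr_ge0 // ltW.
move=> a; have fp := lt_le_trans c0 (Hf a); have gp := lt_le_trans c0 (Hg a).
have f0 : f a != 0 by rewrite -nm_gt0.
have g0 : g a != 0 by rewrite -nm_gt0.
rewrite (_ : _ - _ = (g a - f a) / (f a * g a)); last by field; rewrite f0 g0.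
rewrite nmM nmV nmM nm_distC mulrAC; apply: ler_pM; rewrite ?nm_ge0 ?invr_ge0 ?mulr_ge0 ?nm_ge0 //.
by rewrite lef_pV2 ?posrE ?mulr_gt0 // ler_pM // ltW.
Qed.
Lemma eqO_prod (I : Type) (s : seq I) (f g : I -> A -> R[i]) :
  (forall i, eqO (f i) (g i)) -> (forall i, bdO (f i)) ->
  eqO (fun a => \prod_(i <- s) f i a) (fun a => \prod_(i <- s) g i a).
Proof.
move=> H b; suff [] : eqO (fun a => \prod_(i <- s) f i a) (fun a => \prod_(i <- s) g i a) /\
   bdO (fun a => \prod_(i <- s) f i a) by [].
elim: s => [|i s [IH IHb]].
  by split; [exists 0 => // a; rewrite !big_nil subrr nm0 mul0r | exists 1 => // a; rewrite big_nil nm1].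
split.
  by have [k k0 Hk] := eqOM (H i) IH (b i) IHb; exists k => // a; rewrite !big_cons.
by have [k k0 Hk] := bdOM (b i) IHb; exists k => // a; rewrite !big_cons.
Qed.
Lemma bdO_prod (I : Type) (s : seq I) (f : I -> A -> R[i]) :
  (forall i, bdO (f i)) -> bdO (fun a => \prod_(i <- s) f i a).
Proof.
move=> b; elim: s => [|i s IHb]; first by exists 1 => // a; rewrite big_nil nm1.
by have [k k0 Hk] := bdOM (b i) IHb; exists k => // a; rewrite !big_cons.
Qed.
Lemma eqO_sum (I : Type) (s : seq I) (f g : I -> A -> R[i]) :
  (forall i, eqO (f i) (g i)) -> eqO (fun a => \sum_(i <- s) f i a) (fun a => \sum_(i <- s) g i a).
Proof.
move=> H; elim: s => [|i s IH]; first by exists 0 => // a; rewrite !big_nil subrr nm0 mul0r.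
by have [k k0 Hk] := eqOD (H i) IH; exists k => // a; rewrite !big_cons.
Qed.

Lemma eqO_ext f f' g g' : f =1 f' -> g =1 g' -> eqO f g -> eqO f' g'.
Proof. by move=> ef eg [k k0 H]; exists k => // a; rewrite -ef -eg. Qed.
Lemma bdO_ext f f' : f =1 f' -> bdO f -> bdO f'.
Proof. by move=> ef [k k0 H]; exists k => // a; rewrite -ef. Qed.

Lemma bdO_poly (p : {poly R[i]}) c : nm c <= 1 -> bdO (fun a => p.[c * t a]).
Proof.
move=> c1; exists (\sum_(i < size p) nm p`_i); first by apply: sumr_ge0 => *; exact: nm_ge0.
move=> a; rewrite horner_coef; apply: le_trans (nm_sum _ _ _) _; apply: ler_sum => i _.
by rewrite nmM nmX ler_piMr ?nm_ge0 // exprn_ile1 ?nm_ge0 // nmM mulr_ile1 ?nm_ge0.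
Qed.

Lemma eqO_poly (p q : {poly R[i]}) c : nm c <= 1 -> eqX M p q ->
  eqO (fun a => p.[c * t a]) (fun a => q.[c * t a]).
Proof.
move=> c1 /dvdpP[u E]; have [k k0 H] := bdO_poly u c1.
exists k => // a; rewrite -hornerN -hornerD E hornerM hornerXn nmM ler_pM ?nm_ge0 //.
by rewrite nmX lerXn2r ?nnegrE ?nm_ge0 // nmM ler_piMl ?nm_ge0.
Qed.

End BigO.

Lemma poly_near_cst (R : realType) (p : {poly R[i]}) (d : R) : 0 < d ->
  exists2 rho : R, 0 < rho & forall z, nm z <= rho -> nm (p.[z] - p`_0) <= d.
Proof.
move=> d0.
pose t (z : {z : R[i] | nm z <= 1}) : R[i] := sval z.
have t1 a : nm (t a) <= 1 by exact: (svalP a).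
have one : nm (1 : R[i]) <= 1 by rewrite nm1.
have [k k0 H] := bdO_poly t1 (drop_poly 1 p) one.
exists (Num.min 1 (d / (k + 1))).
  by rewrite lt_min ltr01 divr_gt0 // ltr_wpDl.
move=> z; rewrite le_min => /andP[z1 zd].
have := H (exist _ z z1); rewrite mul1r /t /= => Hz.
have -> : p.[z] - p`_0 = (drop_poly 1 p).[z] * z.
  rewrite -{1}(poly_take_drop 1 p) expr1 hornerD hornerMX (_ : take_poly 1 p = (p`_0)%:P).
    by rewrite hornerC addrC addKr.
  by apply/polyP => -[|j]; rewrite coef_take_poly coefC.
rewrite nmM; have h : nm z * (k + 1) <= d by rewrite -ler_pdivlMr // ltr_wpDl.
apply: le_trans h; rewrite mulrC ler_wpM2l ?nm_ge0 //; lra.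
Qed.

(** * Formal identities for the spectral weights *)

Section FormalWeights.
Variables (F : numFieldType) (L N M : nat) (eta iota : {poly F}).
Hypotheses (L_gt0 : (0 < L)%N) (N_gt0 : (0 < N)%N).
Hypothesis (etaE : eqX M (eta ^+ L + 'X * eta ^+ N) 1).
Hypothesis (iotaE : eqX M (eta * iota) 1).
Local Notation w := (weight_series N eta iota).
Definition dlog_eta : {poly F} := 'X * eta^`() * iota.
Local Notation u := dlog_eta.
Definition den_series : {poly F} := L%:R *: eta ^+ L + N%:R *: ('X * eta ^+ N).

Lemma deriv_expE (p : {poly F}) n : (p ^+ n)^`() = n%:R * (p^`() * p ^+ n.-1).
Proof. by rewrite deriv_exp mulr_natl. Qed.

(** Obtained by differentiating eta^L + X eta^N = 1 and multiplying by X. *)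
Lemma dlog_den : eqX M (u * den_series) (- ('X * eta ^+ N)).
Proof.
have H := eqX_deriv etaE; rewrite derivC mulr0 in H.
have E : eqX M ('X * (eta ^+ L)^`() + 'X * ('X * (eta ^+ N)^`())) (- ('X * eta ^+ N)).
  rewrite /eqX opprK; move: H; rewrite /eqX subr0 derivD derivM derivX mul1r.
  by rewrite (_ : 'X * (_ + _) = 'X * (eta ^+ L)^`() + 'X * ('X * (eta ^+ N)^`()) + 'X * eta ^+ N) //; ring.
apply: (@eqX_trans _ _ ((eta * iota) * ('X * (eta ^+ L)^`() + 'X * ('X * (eta ^+ N)^`())))); last first.
  by rewrite -[X in eqX _ _ X]mul1r; apply: eqXM.
rewrite /u /den_series !deriv_expE -!mul_polyC !rmorph_nat.
have eL : eta ^+ L = eta * eta ^+ L.-1 by rewrite -exprS prednK.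
have eN : eta ^+ N = eta * eta ^+ N.-1 by rewrite -exprS prednK.
rewrite eL eN.
rewrite (_ : _ * (_ + _) = eta * iota * ('X * (L%:R * (eta^`() * eta ^+ L.-1)) + 'X * ('X * (N%:R * (eta^`() * eta ^+ N.-1))))) ?eqXxx //.
by ring.
Qed.

Lemma weightE : eqX M w (1 + N%:R *: u).
Proof.
rewrite /weight_series deriv_expE -mul_polyC rmorph_nat.
have eN : iota ^+ N = iota * iota ^+ N.-1 by rewrite -exprS prednK.
rewrite eN; apply: eqXD; first exact: eqXxx.
rewrite (_ : _ * _ = N%:R * u * (eta * iota) ^+ N.-1); last by rewrite /u exprMn; ring.
rewrite -[X in eqX _ _ X]mulr1; apply: eqXM; first exact: eqXxx.
by rewrite -(expr1n _ N.-1); apply: eqXX.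
Qed.

(** Identifies the weight series with L eta^L / den, which is L times the factor (w_j - 1) / D(w_j)
    of [bethe_G] in terms of eta. *)
Lemma weight_den : eqX M (w * den_series) (L%:R *: eta ^+ L).
Proof.
apply: (@eqX_trans _ _ ((1 + N%:R *: u) * den_series)).
  by apply: eqXM; [exact: weightE | exact: eqXxx].
rewrite mulrDl mul1r -scalerAl.
rewrite (_ : L%:R *: eta ^+ L = den_series + N%:R *: - ('X * eta ^+ N)); last first.
  by rewrite /den_series scalerN addrK.
apply: eqXD; first exact: eqXxx.
by rewrite -!mul_polyC; apply: eqXM; [exact: eqXxx | exact: dlog_den].
Qed.

Lemma dlog_prod (I : Type) (s : seq I) (c : I -> F) :
  eqX M ('X * (\prod_(i <- s) (eta \Po (c i *: 'X)))^`() * \prod_(i <- s) (iota \Po (c i *: 'X)))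
        (\sum_(i <- s) (u \Po (c i *: 'X))).
Proof.
have one i : eqX M ((eta \Po (c i *: 'X)) * (iota \Po (c i *: 'X))) 1.
  by rewrite -rmorphM /= -[X in eqX _ _ X](comp_polyC 1 (c i *: 'X)); apply: eqX_scale.
have onep (s' : seq I) : eqX M ((\prod_(i <- s') (eta \Po (c i *: 'X))) * \prod_(i <- s') (iota \Po (c i *: 'X))) 1.
  rewrite -big_split /=; elim: s' => [|i s' IH]; first by rewrite big_nil eqXxx.
  by rewrite big_cons -[X in eqX _ _ X]mulr1; apply: eqXM.
elim: s => [|i s IH]; first by rewrite !big_nil derivC mulr0 mul0r eqXxx.
rewrite !big_cons derivM.
set E := eta \Po _; set P := \prod_(j <- s) (eta \Po _); set J := iota \Po _; set Q := \prod_(j <- s) (iota \Po _).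
rewrite (_ : _ * _ = ('X * E^`() * J) * (P * Q) + (E * J) * ('X * P^`() * Q)); last by ring.
apply: eqXD.
  rewrite -[X in eqX _ _ X]mulr1; apply: eqXM; last exact: onep.
  rewrite /E /J deriv_comp derivZ derivX alg_polyC /u !rmorphM /= comp_polyX.
  rewrite (_ : _ * _ = (c i *: 'X) * (eta^`() \Po (c i *: 'X)) * (iota \Po (c i *: 'X))) ?eqXxx //.
  by rewrite -!mul_polyC; ring.
by rewrite -[X in eqX _ _ X]mul1r; apply: eqXM => //; exact: one.
Qed.

End FormalWeights.

(** * Expansion of one spectral term *)

Section Asymptotics.
Variables (R : realType) (L N M : nat).
Local Notation C := R[i].
Hypotheses (L_gt0 : (0 < L)%N) (N_gt0 : (0 < N)%N) (NL : (N <= L)%N).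
Variables (rt : 'I_L -> C).
Hypothesis (nm_rt : forall i, nm (rt i) = 1).
Variables (eh ih : {poly C}).
Hypotheses (eh0 : eh`_0 = 1) (ih0 : ih`_0 = 1).
Hypothesis (ehE : eqX M (eh ^+ L + 'X * eh ^+ N) 1).
Hypothesis (ihE : eqX M (eh * ih) 1).
Local Notation index := {ffun 'I_N -> 'I_L}.
Local Notation r := (near_radius R L).

Definition den_at (w0 : index) (t : C) (eta : 'I_N -> C) j : C :=
  L%:R * eta j ^+ L + N%:R * (rt (w0 j) * t * eta j ^+ N).
(** By [dlog_den] this represents 1 plus the sum of the derivatives of log eta_j in log t, that is
    the derivative of log eps in log t. *)
Definition jac_at (w0 : index) (t : C) (eta : 'I_N -> C) : C :=
  1 - \sum_j rt (w0 j) * t * eta j ^+ N / den_at w0 t eta j.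

Variables (c : 'I_N -> int) (w0 : index).

(** Up to O(t^M) the quotient is K/v, where v is the logarithmic derivative of X tau, times X. By
    [lagrange_expansion] K is v times a polynomial in X tau, so division by the Jacobian leaves a
    polynomial in eps. *)
Lemma bethe_term_asymptotics : exists2 rho : R, 0 < rho & exists2 k : R, 0 <= k &
  forall t eps eta, nm t <= rho -> local_data rt w0 t eta -> t * \prod_j eta j = eps ->
  [/\ forall j, den_at w0 t eta j != 0, jac_at w0 t eta != 0 &
  nm ((\prod_j (eta j ^ c j * (L%:R * eta j ^+ L / den_at w0 t eta j))) / jac_at w0 t eta
     - \sum_(q < M) lagrange_coef eh ih rt c w0 q * eps ^+ q) <= k * nm t ^+ M].
Proof.
have r0 := near_radius_gt0 R L_gt0; have r2 := near_radius_le R L_gt0.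
pose cc j := rt (w0 j).
have cc1 j : nm (cc j) <= 1 by rewrite nm_rt.
pose tau : {poly C} := \prod_j (eh \Po (cc j *: 'X)).
pose sigma : {poly C} := \prod_j (ih \Po (cc j *: 'X)).
pose v : {poly C} := 1 + 'X * tau^`() * sigma.
have v0 : v`_0 = 1 by rewrite /v -mulrA coefD coef1 coefXM addr0.
have [rho1 rho10 H1] := poly_near_cst eh r0.
have [rho2 rho20 H2] := @poly_near_cst R v 2^-1 ltac:(by rewrite invr_gt0).
pose zb := coef_bound R N; have zb0 : 0 < zb := coef_bound_gt0 R N.
(* For |t| <= [c4] the sum subtracted in [jac_at] is at most 1/2, which keeps the Jacobian away from
   0. *)
pose c4 : R := (4 * (2 ^+ N * N%:R))^-1.
have n1 : 1 <= N%:R :> R by rewrite ler1n.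
have p1 : 1 <= (2 : R) ^+ N by rewrite exprn_ege1 // ler1n.
have c40 : 0 < c4 by rewrite invr_gt0 !mulr_gt0 ?exprn_gt0 // ltr0n.
pose rho := Num.min (Num.min 1 rho1) (Num.min rho2 (Num.min zb c4)).
have rho_gt0 : 0 < rho by rewrite !lt_min ltr01 rho10 rho20 zb0 c40.
have rhoP t : nm t <= rho -> [/\ nm t <= 1, nm t <= rho1, nm t <= rho2, nm t <= zb & nm t <= c4].
  by rewrite !le_min => /andP[/andP[-> ->] /andP[-> /andP[-> ->]]].
exists rho => //.
pose A := {a : C * ('I_N -> C) | nm a.1 <= rho /\ local_data rt w0 a.1 a.2}.
pose T (a : A) := (sval a).1; pose E (a : A) := (sval a).2.
have Tr a : nm (T a) <= rho by have [] := svalP a.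
have ED a : local_data rt w0 (T a) (E a) by have [] := svalP a.
have T1 a : nm (T a) <= 1 by have [] := rhoP _ (Tr a).
pose D j a := den_at w0 (T a) (E a) j.
have El a j : [/\ 2^-1 <= nm (E a j), nm (E a j) <= 2 & E a j != 0].
  by have [h _] := ED a j; apply: nm_near1 h r2.
have EE a j : E a j ^+ L + cc j * T a * E a j ^+ N = 1 by have [_] := ED a j.
have t4 a : nm (T a) * (4 * (2 ^+ N * N%:R)) <= 1.
  have [_ _ _ _ h] := rhoP _ (Tr a).
  by rewrite -ler_pdivlMr ?mulr_gt0 ?exprn_gt0 ?ltr0n // mul1r.
have small a j : nm (cc j * T a * E a j ^+ N) * N%:R <= 4^-1.
  have h : nm (cc j * T a * E a j ^+ N) <= nm (T a) * 2 ^+ N.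
    rewrite nmM nmM nm_rt mul1r ler_wpM2l ?nm_ge0 // nmX lerXn2r ?nnegrE ?nm_ge0 ?ler0n //.
    by have [] := El a j.
  have h' : nm (cc j * T a * E a j ^+ N) * N%:R <= nm (T a) * 2 ^+ N * N%:R by rewrite ler_wpM2r.
  have := t4 a; rewrite (_ : nm (T a) * _ = 4 * (nm (T a) * 2 ^+ N * N%:R)); last by ring.
  by lra.
have small' a j : nm (cc j * T a * E a j ^+ N) <= 4^-1.
  apply: le_trans (small a j); rewrite ler_peMr ?nm_ge0 //.
have DE a j : D j a = L%:R - (L%:R - N%:R) * (cc j * T a * E a j ^+ N).
  rewrite /D /den_at (_ : E a j ^+ L = 1 - cc j * T a * E a j ^+ N); last by rewrite -(EE a j) addrK.
  by rewrite /cc; ring.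
have L1 : 1 <= L%:R :> R by rewrite ler1n.
have Dlow j a : 2^-1 <= nm (D j a).
  rewrite DE; apply: le_trans (nm_sub _ _); rewrite nm_nat nmM -natrB // nm_nat.
  have h1 : (L - N)%:R * nm (cc j * T a * E a j ^+ N) <= (L - N)%:R * 4^-1 :> R.
    by rewrite ler_wpM2l.
  have h2 : (L - N)%:R <= L%:R :> R by rewrite ler_nat leq_subr.
  by lra.
have half0 : 0 < (2^-1 : R) by rewrite invr_gt0.
pose Jc a := jac_at w0 (T a) (E a).
have Jlow a : 2^-1 <= nm (Jc a).
  rewrite /Jc /jac_at; apply: le_trans (nm_sub _ _); rewrite nm1.
  have : nm (\sum_j cc j * T a * E a j ^+ N / D j a) <= 2^-1.
    apply: le_trans (nm_sum _ _ _) _.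
    apply: (@le_trans _ _ (\sum_(j < N) (2 * N%:R)^-1)).
      apply: ler_sum => j _; rewrite nmM nmV invfM.
      have Dp := lt_le_trans half0 (Dlow j a).
      rewrite ler_pdivrMr //; apply: (@le_trans _ _ (2^-1 / N%:R * 2^-1)).
        rewrite (_ : 2^-1 / N%:R * 2^-1 = 4^-1 / N%:R); last by field; rewrite pnatr_eq0 -lt0n.
        by rewrite ler_pdivlMr ?ltr0n.
      by apply: ler_wpM2l (Dlow j a); rewrite divr_ge0 ?invr_ge0 ?ler0n.
    have Nn0 : N%:R != 0 :> R by rewrite pnatr_eq0 -lt0n.
    rewrite sumr_const card_ord -[X in X <= _]mulr_natl invfM mulrCA (mulfV Nn0) mulr1; exact: lexx.
  by rewrite /D /cc; lra.
(* The truncated series is an approximate root with defect O(t^M); [trinomial_close] compares it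
   with the true one. *)
have eqE j : eqO T M (fun a => E a j) (fun a => eh.[cc j * T a]).
  have [k k0 Hk] := eqO_poly T1 (cc1 j) ehE.
  exists (2 * k); first exact: mulr_ge0.
  move=> a; have [_ ta1 _ taz _] := rhoP _ (Tr a).
  have nmc : nm (cc j * T a) = nm (T a) by rewrite nmM nm_rt mul1r.
  have [Er _] := ED a j.
  have yr : nm (eh.[cc j * T a] - 1) <= r by rewrite -eh0; apply: H1; rewrite nmc.
  have := @trinomial_close R L N L_gt0 NL _ _ (cc j * T a) (cc j * T a)
    (eh.[cc j * T a] ^+ L + cc j * T a * eh.[cc j * T a] ^+ N - 1) Er yr.
  rewrite nmc subrr nm0 mulr0 add0r => /(_ taz (EE a j)) H.
  apply: (le_trans (H _)); first by rewrite [RHS]addrC subrK.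
  by rewrite -[X in _ <= X]mulrA ler_wpM2l //; have := Hk a; rewrite !hornerE.
have bdE j : bdO (fun a => E a j) by exists 2 => // a; have [] := El a j.
have bdEV j : bdO (fun a => (E a j)^-1).
  by apply: (@bdO_low _ _ _ 2^-1) => // a; have [] := El a j.
have bdp (p : {poly C}) j : bdO (fun a => p.[cc j * T a]) by apply: bdO_poly.
have eqI j : eqO T M (fun a => (E a j)^-1) (fun a => ih.[cc j * T a]).
  have h1 : eqO T M (fun a => E a j * ih.[cc j * T a]) (fun=> 1).
    apply: (@eqO_trans _ _ T M (fun a => eh.[cc j * T a] * ih.[cc j * T a])).
      by apply: eqOM => //; exact: eqOxx.
    by apply: eqO_ext (eqO_poly T1 (cc1 j) ihE) => a; rewrite ?hornerM ?hornerC.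
  apply: eqO_sym; have := eqOM T1 (eqOxx T M (fun a => (E a j)^-1)) h1 (bdEV j) (bdOM (bdE j) (bdp ih j)).
  apply: eqO_ext => a; last by rewrite mulr1.
  by rewrite mulKf //; have [] := El a j.
have eqZ j (n : int) : eqO T M (fun a => E a j ^ n) (fun a => (zpow_series eh ih n).[cc j * T a]).
  case: n => n /=.
    by apply: eqO_ext (eqOX T1 n (eqE j) (bdE j)) => a //; rewrite horner_exp.
  apply: eqO_ext (eqOX T1 n.+1 (eqI j) (bdEV j)) => a; last by rewrite horner_exp.
  by rewrite exprVn.
have bdT j : bdO (fun a => cc j * T a).
  by exists 1 => // a; rewrite nmM nm_rt mul1r T1.
have bdzE j : bdO (fun a => cc j * T a * E a j ^+ N) := bdOM (bdT j) (bdOX N (bdE j)).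
have bdLE j : bdO (fun a => L%:R * E a j ^+ L) := bdOM (bdO_cst _ L%:R) (bdOX L (bdE j)).
have bdNE j : bdO (fun a => N%:R * (cc j * T a * E a j ^+ N)) := bdOM (bdO_cst _ N%:R) (bdzE j).
have bdD j : bdO (D j) := bdOD (bdLE j) (bdNE j).
have bdDV j : bdO (fun a => (D j a)^-1) by apply: (@bdO_low _ _ _ 2^-1).
pose dh : {poly C} := den_series L N eh.
have hT j p a : ('X * p).[cc j * T a] = cc j * T a * p.[cc j * T a] by rewrite !hornerE.
have eqzE j : eqO T M (fun a => cc j * T a * E a j ^+ N) (fun a => cc j * T a * eh.[cc j * T a] ^+ N).
  by apply: (eqOM T1 (eqOxx T M _) (eqOX T1 N (eqE j) (bdE j)) (bdT j) (bdOX N (bdE j))).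
have eqLE j : eqO T M (fun a => L%:R * E a j ^+ L) (fun a => L%:R * eh.[cc j * T a] ^+ L).
  by apply: (eqOM T1 (eqOxx T M _) (eqOX T1 L (eqE j) (bdE j)) (bdO_cst _ L%:R) (bdOX L (bdE j))).
have eqD j : eqO T M (D j) (fun a => dh.[cc j * T a]).
  apply: eqO_ext (eqOD (eqLE j) (eqOM T1 (eqOxx T M (fun=> N%:R)) (eqzE j) (bdO_cst _ N%:R) (bdzE j))) => a //.
  by rewrite /dh /den_series hornerD !hornerZ hT !horner_exp.
have divD j (f : A -> C) (p q : {poly C}) : eqX M (p * dh) q -> eqO T M f (fun a => q.[cc j * T a]) ->
    bdO f -> eqO T M (fun a => f a / D j a) (fun a => p.[cc j * T a]).
  move=> pq fq bf.
  have h1 : eqO T M (fun a => p.[cc j * T a] * D j a) f.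
    apply: (eqO_trans (eqOM T1 (eqOxx T M _) (eqD j) (bdp p j) (bdD j))).
    apply: eqO_trans _ (eqO_sym fq).
    by apply: eqO_ext (eqO_poly T1 (cc1 j) pq) => a //; rewrite hornerM.
  apply: eqO_sym; have := eqOM T1 h1 (eqOxx T M (fun a => (D j a)^-1)) (bdOM (bdp p j) (bdD j)) (bdDV j).
  apply: eqO_ext => a //; rewrite mulfK // -nm_gt0; exact: lt_le_trans half0 (Dlow j a).
have eqW j : eqO T M (fun a => L%:R * E a j ^+ L / D j a) (fun a => (weight_series N eh ih).[cc j * T a]).
  apply: divD (weight_den L_gt0 N_gt0 ehE ihE) _ (bdLE j).
  by apply: eqO_ext (eqLE j) => a //; rewrite hornerZ horner_exp.
have eqU j : eqO T M (fun a => - (cc j * T a * E a j ^+ N) / D j a) (fun a => (dlog_eta eh ih).[cc j * T a]).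
  apply: divD (dlog_den L_gt0 N_gt0 ehE ihE) _ _.
    have := eqOM T1 (eqOxx T M (fun=> -1)) (eqzE j) (bdO_cst _ (-1)) (bdzE j).
    by apply: eqO_ext => a; rewrite mulN1r // hornerN hT horner_exp.
  by apply: bdO_ext (bdOM (bdO_cst _ (-1)) (bdzE j)) => a; rewrite mulN1r.
have eqJ : eqO T M Jc (fun a => v.[T a]).
  have one : nm (1 : C) <= 1 by rewrite nm1.
  have h1 := eqO_poly T1 one (dlog_prod ihE (index_enum 'I_N) cc).
  have h2 : eqO T M (fun a => \sum_j - (cc j * T a * E a j ^+ N) / D j a) (fun a => ('X * tau^`() * sigma).[T a]).
    apply: (eqO_trans (eqO_sum (index_enum 'I_N) eqU)); apply: eqO_sym; apply: eqO_ext h1 => a.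
      by rewrite mul1r.
    rewrite horner_sum; apply: eq_bigr => j _.
    by rewrite horner_comp hornerZ hornerX mul1r.
  have := eqOD (eqOxx T M (fun=> 1)) h2; apply: eqO_ext => a.
    rewrite /Jc /jac_at -sumrN; congr (_ + _).
    by apply: eq_bigr => j _; rewrite mulNr.
  by rewrite /v hornerD hornerC.
have bdJ : bdO Jc.
  have one : nm (1 : C) <= 1 by rewrite nm1.
  apply: (bd_eqO T1 (eqO_sym eqJ)); apply: bdO_ext (bdO_poly T1 v one) => a.
  by rewrite mul1r.
have vlow a : 2^-1 <= nm v.[T a].
  have [_ _ h _ _] := rhoP _ (Tr a); have := H2 _ h; rewrite v0.
  have := nm_sub 1 (1 - v.[T a]); rewrite subKr nm1 nm_distC; lra.
pose Kp : {poly C} := \prod_j ((zpow_series eh ih (c j) * weight_series N eh ih) \Po (cc j *: 'X)).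
have bdc j : bdO (fun a => E a j ^ c j) := bdOXz (c j) (bdE j) (bdEV j).
have bdW j : bdO (fun a => L%:R * E a j ^+ L / D j a) := bdOM (bdLE j) (bdDV j).
have eqK : eqO T M (fun a => \prod_j (E a j ^ c j * (L%:R * E a j ^+ L / D j a))) (fun a => Kp.[T a]).
  have := eqO_prod T1 (index_enum 'I_N) (fun j => eqOM T1 (eqZ j (c j)) (eqW j) (bdc j) (bdW j)) (fun j => bdOM (bdc j) (bdW j)).
  apply: eqO_ext => a //; rewrite /Kp horner_prod; apply: eq_bigr => j _.
  by rewrite horner_comp !hornerE.
have tau0 : tau`_0 = 1.
  rewrite -horner_coef0 horner_prod big1 // => j _.
  by rewrite horner_comp hornerZ hornerX mulr0 horner_coef0.
have ts : eqX M (tau * sigma) 1.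
  rewrite /tau /sigma -big_split /=; elim: (index_enum 'I_N) => [|i s IH]; first by rewrite big_nil eqXxx.
  rewrite big_cons -[X in eqX _ _ X]mulr1; apply: eqXM => //.
  by rewrite -rmorphM /= -[X in eqX _ _ X](comp_polyC 1 (cc i *: 'X)); apply: eqX_scale.
have lag := lagrange_expansion Kp tau0 ts.
pose eps a := T a * \prod_j E a j.
have eqeps : eqO T M eps (fun a => T a * tau.[T a]).
  apply: (eqOM T1 (eqOxx T M T)).
  - have := eqO_prod T1 (index_enum 'I_N) eqE bdE; apply: eqO_ext => a //.
    by rewrite /tau horner_prod; apply: eq_bigr => j _; rewrite horner_comp !hornerE.
  - by exists 1.
  - exact: bdO_prod.
have bdeps : bdO eps.
  by apply: bdOM; [exists 1 | exact: bdO_prod].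
have one : nm (1 : C) <= 1 by rewrite nm1.
have main : eqO T M (fun a => (\prod_j (E a j ^ c j * (L%:R * E a j ^+ L / D j a))) / Jc a)
    (fun a => \sum_(q < M) lagrange_coef eh ih rt c w0 q * eps a ^+ q).
  apply: (@eqO_trans _ _ T M (fun a => Kp.[T a] / v.[T a])).
    apply: eqOM => //; first exact: eqOV half0 Jlow vlow eqJ.
      exact: bdO_prod (fun j => bdOM (bdc j) (bdW j)).
    exact: bdO_low half0 Jlow.
  apply: (@eqO_trans _ _ T M (fun a => (\sum_(q < M) lagrange_coef eh ih rt c w0 q * (T a * tau.[T a]) ^+ q))); last first.
    apply: eqO_sum => q; apply: eqO_sym; apply: eqOM => //; [exact: eqOxx | exact: eqOX | exact: bdO_cst | exact: bdOX].
  have h1 := eqO_poly T1 one lag.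
  have bv : bdO (fun a => (v.[T a])^-1) := bdO_low half0 vlow.
  have bK : bdO (fun a => Kp.[1 * T a]) := bdO_poly T1 Kp one.
  have := eqOM T1 h1 (eqOxx T M (fun a => (v.[T a])^-1)) bK bv.
  apply: eqO_ext => a; first by rewrite mul1r.
  rewrite mul1r horner_sum mulr_suml; apply: eq_bigr => q _.
  rewrite hornerZ hornerM horner_exp hornerM hornerX -/v -mulrA mulfK.
    by rewrite /lagrange_coef -/Kp.
  by rewrite -nm_gt0; exact: lt_le_trans half0 (vlow a).
have [k k0 Hk] := main; exists k => // t e eta tr ld te.
pose a : A := exist _ (t, eta) (conj tr ld).
have nz (x : C) : 2^-1 <= nm x -> x != 0.
  by move=> h; rewrite -nm_gt0; exact: lt_le_trans half0 h.
split; [by move=> j; exact: nz (Dlow j a) | exact: nz (Jlow a) |].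
by have := Hk a; rewrite /eps /T /E /= te.
Qed.

End Asymptotics.

(** The roots are s0 z^i with z a primitive L-th root of unity, so their power sums are geometric
    sums. *)
Lemma roots_of (C : numClosedFieldType) (L : nat) (sg : C) : (0 < L)%N -> sg != 0 ->
  exists rt : 'I_L -> C, [/\ forall i, rt i ^+ L = sg, injective rt,
    forall x, x ^+ L = sg -> exists i, x = rt i &
    forall p : int, ~~ (L%:Z %| p)%Z -> \sum_i rt i ^ p = 0].
Proof.
move=> L0 sg0.
have [z zP] : exists z : C, L.-primitive_root z.
  have [rs ps] := closed_field_poly_normal ('X^L - 1 : {poly C}).
  have m1 : lead_coef ('X^L - 1 : {poly C}) = 1 by apply/monicP/monicXnsubC.
  rewrite m1 scale1r in ps.
  have : has L.-primitive_root rs.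
    apply: cyclic.has_prim_root => //.
    - by apply/allP => x xs; rewrite /root_of_unity ps root_prod_XsubC.
    - by rewrite -separable_prod_XsubC -ps separable_Xn_sub_1 // pnatr_eq0 -lt0n.
    - by rewrite -ltnS -(size_prod_XsubC rs id) -ps size_XnsubC.
  by move=> /hasP[z _ zP]; exists z.
pose s0 := L.-root sg.
have s0L : s0 ^+ L = sg by rewrite rootCK.
have s00 : s0 != 0 by apply: contraNneq sg0 => s00; rewrite -s0L s00 expr0n; case: (L) L0.
have z0 : z != 0 by apply: contra_eq_neq (prim_expr_order zP) => ->; rewrite expr0n; case: (L) L0 => //= *; rewrite eq_sym oner_neq0.
exists (fun i => s0 * z ^+ i); split.
- by move=> i; rewrite exprMn s0L -exprM mulnC exprM (prim_expr_order zP) expr1n mulr1.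
- move=> i j /(mulfI s00) /eqP; rewrite (eq_prim_root_expr zP) !modn_small // => /eqP ij.
  exact/val_inj.
- move=> x xL; have xs : (x / s0) ^+ L = 1 by rewrite exprMn exprVn xL s0L mulfV.
  by have [i ie] := prim_rootP zP xs; exists i; rewrite -ie mulrC divfK.
move=> p Lp.
have zp : z ^ p != 1.
  apply: contra Lp => /eqP zp1; rewrite dvdzE /= (prim_order_dvd zP); apply/eqP.
  by case: p zp1 => n //= /eqP; rewrite invr_eq1 => /eqP.
have S0 : \sum_(i < L) (z ^ p) ^+ i = 0.
  apply: (mulfI (_ : z ^ p - 1 != 0)); first by rewrite subr_eq0.
  by rewrite -subrX1 exprnP exprzAC -exprnP (prim_expr_order zP) exp1rz subrr mulr0.
rewrite (eq_bigr (fun i : 'I_L => s0 ^ p * (z ^ p) ^+ i)).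
  by rewrite -mulr_sumr S0 mulr0.
by move=> i _; rewrite exprzMl ?unitfE ?expf_neq0 // !exprnP exprzAC.
Qed.

(** * Definable sets over an algebraically closed field *)

Section QuantifierElimination.
Variable F : closedFieldType.
Implicit Types (t : GRing.term F) (f : GRing.formula F) (e : seq F).

(** Inverses are removed first by [to_rform]; what remains is a ring formula, whose atoms
    [term_poly] can read as polynomials. *)
Lemma closed_field_qe f :
  exists2 g, GRing.qf_form g && GRing.rformula g & forall e, GRing.holds e f <-> GRing.qf_eval e g.
Proof.
have F_closed : GRing.closed_field_axiom F by exact: solve_monicpoly.
have wf : GRing.wf_QE_proj (@ClosedFieldQE.ex_elim F) := @ClosedFieldQE.wf_ex_elim F.
have ok := ClosedFieldQE.holds_ex_elim F_closed.
have rf := GRing.to_rform_rformula f.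
exists (GRing.quantifier_elim (@ClosedFieldQE.ex_elim F) (GRing.to_rform f)).
  exact: (GRing.quantifier_elim_wf wf rf).
move=> e; split=> [/GRing.to_rformP H|H].
  exact/(GRing.quantifier_elim_rformP wf ok e rf).
by apply/GRing.to_rformP/(GRing.quantifier_elim_rformP wf ok e rf).
Qed.

(* The outer variable stands for 'X_1 and the inner one for 'X_0. *)
Fixpoint term_poly t : {poly {poly F}} :=
  match t with
  | GRing.Var 0 => 'X%:P
  | GRing.Var 1 => 'X
  | GRing.Var _ => 0
  | GRing.Const c => c%:P%:P
  | GRing.NatConst n => n%:R
  | GRing.Add t1 t2 => term_poly t1 + term_poly t2
  | GRing.Opp t1 => - term_poly t1
  | GRing.NatMul t1 n => term_poly t1 *+ n
  | GRing.Mul t1 t2 => term_poly t1 * term_poly t2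
  | GRing.Inv t1 => 0
  | GRing.Exp t1 n => term_poly t1 ^+ n
  end.

Definition ev2 (p : {poly {poly F}}) (x y : F) := p.[y%:P].[x].

Lemma term_polyE t x y : GRing.rterm t -> GRing.eval [:: x; y] t = ev2 (term_poly t) x y.
Proof.
rewrite /ev2; elim: t => //=.
- by move=> [|[|n]] _ /=; rewrite ?hornerE ?nth_nil.
- by move=> c _; rewrite !hornerE.
- by move=> n _; rewrite -!polyC_natr !hornerE.
- by move=> t1 IH1 t2 IH2 /andP[/IH1 -> /IH2 ->]; rewrite !hornerE.
- by move=> t1 IH1 /IH1 ->; rewrite !hornerE.
- by move=> t1 IH1 n /IH1 ->; rewrite !(hornerMn).
- by move=> t1 IH1 t2 IH2 /andP[/IH1 -> /IH2 ->]; rewrite !hornerE.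
- by move=> t1 IH1 n /IH1 ->; rewrite !horner_exp.
Qed.

(** Where the difference of its two sides does not vanish, an atom is false; if that difference is
    the zero polynomial, it is always true. The exceptional polynomials of subformulas are
    multiplied. *)
Lemma generic_qf2 f : GRing.qf_form f -> GRing.rformula f ->
  exists2 p : {poly {poly F}}, p != 0 &
  forall x y x' y', ev2 p x y != 0 -> ev2 p x' y' != 0 ->
    GRing.qf_eval [:: x; y] f = GRing.qf_eval [:: x'; y'] f.
Proof.
have EM p q x y : ev2 (p * q) x y = ev2 p x y * ev2 q x y by rewrite /ev2 !hornerM.
elim: f => //=.
- by move=> b _ _; exists 1 => //; exact: oner_neq0.
- move=> t1 t2 _ /andP[r1 r2].
  have [p0|p0] := eqVneq (term_poly t1 - term_poly t2) 0.
    exists 1; first exact: oner_neq0.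
    move=> x y x' y' _ _; rewrite !term_polyE //.
    by move/eqP: p0; rewrite subr_eq0 => /eqP ->; rewrite !eqxx.
  exists (term_poly t1 - term_poly t2) => // x y x' y'.
  rewrite /ev2 !hornerE !term_polyE // !subr_eq0 /ev2.
  by move=> /negbTE -> /negbTE ->.
- move=> f1 IH1 f2 IH2 /andP[q1 q2] /andP[r1 r2].
  have [p1 p10 H1] := IH1 q1 r1; have [p2 p20 H2] := IH2 q2 r2.
  exists (p1 * p2); first by rewrite mulf_neq0.
  move=> x y x' y'; rewrite !EM !mulf_eq0 !negb_or => /andP[a b] /andP[c d].
  by rewrite (H1 x y x' y') // (H2 x y x' y').
- move=> f1 IH1 f2 IH2 /andP[q1 q2] /andP[r1 r2].
  have [p1 p10 H1] := IH1 q1 r1; have [p2 p20 H2] := IH2 q2 r2.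
  exists (p1 * p2); first by rewrite mulf_neq0.
  move=> x y x' y'; rewrite !EM !mulf_eq0 !negb_or => /andP[a b] /andP[c d].
  by rewrite (H1 x y x' y') // (H2 x y x' y').
- move=> f1 IH1 f2 IH2 /andP[q1 q2] /andP[r1 r2].
  have [p1 p10 H1] := IH1 q1 r1; have [p2 p20 H2] := IH2 q2 r2.
  exists (p1 * p2); first by rewrite mulf_neq0.
  move=> x y x' y'; rewrite !EM !mulf_eq0 !negb_or => /andP[a b] /andP[c d].
  by rewrite (H1 x y x' y') // (H2 x y x' y').
- move=> f1 IH1 q1 r1; have [p1 p10 H1] := IH1 q1 r1.
  by exists p1 => // x y x' y' a b; rewrite (H1 x y x' y').
Qed.

(** A separate argument for fixed [y], because the polynomial of [generic_qf2] may vanish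
    identically on that line. *)
Lemma generic_qf1 f y : GRing.qf_form f -> GRing.rformula f ->
  exists2 p : {poly F}, p != 0 &
  forall x x', p.[x] != 0 -> p.[x'] != 0 ->
    GRing.qf_eval [:: x; y] f = GRing.qf_eval [:: x'; y] f.
Proof.
elim: f => //=.
- by move=> b _ _; exists 1 => //; exact: oner_neq0.
- move=> t1 t2 _ /andP[r1 r2].
  have [p0|p0] := eqVneq (term_poly t1 - term_poly t2).[y%:P] 0.
    exists 1; first exact: oner_neq0.
    move=> x x' _ _; rewrite !term_polyE // /ev2.
    by move/eqP: p0; rewrite !hornerE subr_eq0 => /eqP ->; rewrite !eqxx.
  exists (term_poly t1 - term_poly t2).[y%:P] => // x x'.
  rewrite !hornerE !term_polyE // !subr_eq0 /ev2.
  by move=> /negbTE -> /negbTE ->.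
- move=> f1 IH1 f2 IH2 /andP[q1 q2] /andP[r1 r2].
  have [p1 p10 H1] := IH1 q1 r1; have [p2 p20 H2] := IH2 q2 r2.
  exists (p1 * p2); first by rewrite mulf_neq0.
  move=> x x'; rewrite !hornerM !mulf_eq0 !negb_or => /andP[a b] /andP[c d].
  by rewrite (H1 x x') // (H2 x x').
- move=> f1 IH1 f2 IH2 /andP[q1 q2] /andP[r1 r2].
  have [p1 p10 H1] := IH1 q1 r1; have [p2 p20 H2] := IH2 q2 r2.
  exists (p1 * p2); first by rewrite mulf_neq0.
  move=> x x'; rewrite !hornerM !mulf_eq0 !negb_or => /andP[a b] /andP[c d].
  by rewrite (H1 x x') // (H2 x x').
- move=> f1 IH1 f2 IH2 /andP[q1 q2] /andP[r1 r2].
  have [p1 p10 H1] := IH1 q1 r1; have [p2 p20 H2] := IH2 q2 r2.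
  exists (p1 * p2); first by rewrite mulf_neq0.
  move=> x x'; rewrite !hornerM !mulf_eq0 !negb_or => /andP[a b] /andP[c d].
  by rewrite (H1 x x') // (H2 x x').
- move=> f1 IH1 q1 r1; have [p1 p10 H1] := IH1 q1 r1.
  by exists p1 => // x x' a b; rewrite (H1 x x').
Qed.

(** Working with the semantics lets formulas be assembled from closure lemmas, without ever being
    displayed. *)
Definition definable (P : seq F -> Prop) := exists f, forall e, GRing.holds e f <-> P e.
Definition tdefinable (g : seq F -> F) := exists t, forall e, GRing.eval e t = g e.

Lemma definable_ext (P Q : seq F -> Prop) : (forall e, P e <-> Q e) -> definable P -> definable Q.
Proof. by move=> H [f Hf]; exists f => e; rewrite Hf. Qed.
Lemma tdefinable_ext g h : g =1 h -> tdefinable g -> tdefinable h.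
Proof. by move=> H [t Ht]; exists t => e; rewrite Ht. Qed.
Lemma definable_eq g h : tdefinable g -> tdefinable h -> definable (fun e => g e = h e).
Proof. by move=> [t Ht] [s Hs]; exists (GRing.Equal t s) => e /=; rewrite Ht Hs. Qed.
Lemma definable_and P Q : definable P -> definable Q -> definable (fun e => P e /\ Q e).
Proof. by move=> [f Hf] [g Hg]; exists (GRing.And f g) => e /=; rewrite Hf Hg. Qed.
Lemma definable_imp P Q : definable P -> definable Q -> definable (fun e => P e -> Q e).
Proof. by move=> [f Hf] [g Hg]; exists (GRing.Implies f g) => e /=; rewrite Hf Hg. Qed.
Lemma definable_not P : definable P -> definable (fun e => ~ P e).
Proof. by move=> [f Hf]; exists (GRing.Not f) => e /=; rewrite Hf. Qed.
Lemma definable_neq g h : tdefinable g -> tdefinable h -> definable (fun e => g e != h e).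
Proof.
move=> tg th; apply: definable_ext (definable_not (definable_eq tg th)) => e.
by split=> [/eqP|/eqP].
Qed.
Lemma definable_forall_fin (I : finType) (P : I -> seq F -> Prop) :
  (forall i, definable (P i)) -> definable (fun e => forall i, P i e).
Proof.
move=> H; have [f Hf] := choice H.
exists (foldr (fun i g => GRing.And (f i) g) (GRing.Bool true) (enum I)) => e.
apply: (@iff_trans _ (forall i, i \in enum I -> P i e)); last first.
  by split=> Hi i; [apply: Hi; rewrite mem_enum | move=> _; apply: Hi].
elim: (enum I) => [|i s IH] /=; first by split.
rewrite Hf IH; split=> [[Hi Hs] j|Hj].
  by rewrite inE => /orP[/eqP -> //|/Hs].
by split=> [|j js]; apply: Hj; rewrite inE ?eqxx ?js ?orbT.
Qed.
Lemma definable_exists_fin (I : finType) (P : I -> seq F -> Prop) :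
  (forall i, definable (P i)) -> definable (fun e => exists i, P i e).
Proof.
move=> H; have H' := definable_not (definable_forall_fin (fun i => definable_not (H i))).
apply: definable_ext H' => e; split; last by move=> [i Hi] /(_ i).
by move=> /existsNP[i /contrapT Hi]; exists i.
Qed.
Lemma tdefinable_var i : tdefinable (fun e => e`_i).
Proof. by exists (GRing.Var F i). Qed.
Lemma tdefinable_cst c : tdefinable (fun e => c).
Proof. by exists (GRing.Const c). Qed.
Lemma tdefinableD g h : tdefinable g -> tdefinable h -> tdefinable (fun e => g e + h e).
Proof. by move=> [t Ht] [s Hs]; exists (GRing.Add t s) => e /=; rewrite Ht Hs. Qed.
Lemma tdefinableM g h : tdefinable g -> tdefinable h -> tdefinable (fun e => g e * h e).
Proof. by move=> [t Ht] [s Hs]; exists (GRing.Mul t s) => e /=; rewrite Ht Hs. Qed.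
Lemma tdefinableN g : tdefinable g -> tdefinable (fun e => - g e).
Proof. by move=> [t Ht]; exists (GRing.Opp t) => e /=; rewrite Ht. Qed.
Lemma tdefinableV g : tdefinable g -> tdefinable (fun e => (g e)^-1).
Proof. by move=> [t Ht]; exists (GRing.Inv t) => e /=; rewrite Ht. Qed.
Lemma tdefinableX g n : tdefinable g -> tdefinable (fun e => g e ^+ n).
Proof. by move=> [t Ht]; exists (GRing.Exp t n) => e /=; rewrite Ht. Qed.
Lemma tdefinableXz g (n : int) : tdefinable g -> tdefinable (fun e => g e ^ n).
Proof. by case: n => n H; [exact: tdefinableX | apply: tdefinableV; exact: tdefinableX]. Qed.
Lemma tdefinable_sum (I : Type) (s : seq I) (g : I -> seq F -> F) :
  (forall i, tdefinable (g i)) -> tdefinable (fun e => \sum_(i <- s) g i e).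
Proof.
move=> H; elim: s => [|i s IH].
  by apply: tdefinable_ext (tdefinable_cst 0) => e; rewrite big_nil.
by apply: tdefinable_ext (tdefinableD (H i) IH) => e; rewrite big_cons.
Qed.
Lemma tdefinable_prod (I : Type) (s : seq I) (g : I -> seq F -> F) :
  (forall i, tdefinable (g i)) -> tdefinable (fun e => \prod_(i <- s) g i e).
Proof.
move=> H; elim: s => [|i s IH].
  by apply: tdefinable_ext (tdefinable_cst 1) => e; rewrite big_nil.
by apply: tdefinable_ext (tdefinableM (H i) IH) => e; rewrite big_cons.
Qed.

End QuantifierElimination.

Section Blocks.
Variable F : closedFieldType.

Lemma env_block (e : seq F) k n (w : 'I_n -> F) :
  exists e', (forall i : 'I_n, e'`_(k + i) = w i) /\ {in [predC iota k n], GRing.same_env e e'}.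
Proof.
pose g j := if (k <= j)%N then oapp w e`_j (insub (j - k)%N) else e`_j.
exists (mkseq g (maxn (size e) (k + n))); split=> [i|j].
  have ki : (k + i < maxn (size e) (k + n))%N by rewrite leq_max ltn_add2l ltn_ord orbT.
  by rewrite nth_mkseq // /g leq_addr addKn insubT //= => H; congr w; apply/val_inj.
rewrite inE mem_iota negb_and -ltnNge -leqNgt => jk.
have gj : g j = e`_j.
  rewrite /g; case: leqP => // kj; rewrite insubF //; apply/negbTE; rewrite -leqNgt.
  by move: jk; rewrite ltnNge kj /= leq_subRL.
have [js|js] := ltnP j (maxn (size e) (k + n)); first by rewrite nth_mkseq.
rewrite [RHS]nth_default ?size_mkseq // nth_default //.
by apply: leq_trans js; rewrite leq_maxl.
Qed.

Lemma definable_exists_block (P : seq F -> Prop) k n : definable P ->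
  definable (fun e => exists2 e', {in [predC iota k n], GRing.same_env e e'} & P e').
Proof.
move=> [f Hf]; exists (foldr (@GRing.Exists F) f (iota k n)) => e.
apply: (iff_trans (iff_sym (@GRing.foldExistsP F f (iota k n) e))).
by split=> -[e' He' /Hf]; exists e'.
Qed.

Lemma definable_forall_block (P : seq F -> Prop) k n : definable P ->
  definable (fun e => forall e', {in [predC iota k n], GRing.same_env e e'} -> P e').
Proof.
move=> [f Hf]; exists (foldr (@GRing.Forall F) f (iota k n)) => e.
apply: (iff_trans (iff_sym (@GRing.foldForallP F f (iota k n) e))).
by split=> H e' /H /Hf.
Qed.

End Blocks.

(** * A first-order formula for a sum over all solutions *)

Section Enumeration.
Variables (F : closedFieldType) (N m : nat).
Variables (sol nd : F -> {ffun 'I_N -> F} -> Prop) (term : F -> {ffun 'I_N -> F} -> F).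
Hypothesis sol_def : forall off : 'I_N -> nat, definable (fun e : seq F => sol e`_0 [ffun i => e`_(off i)]).
Hypothesis nd_def : forall off : 'I_N -> nat, definable (fun e : seq F => nd e`_0 [ffun i => e`_(off i)]).
Hypothesis term_def : forall off : 'I_N -> nat, tdefinable (fun e : seq F => term e`_0 [ffun i => e`_(off i)]).

Definition enumerates (x : F) (W : 'I_m -> {ffun 'I_N -> F}) :=
  [/\ forall r, sol x (W r), injective W & forall w, sol x w -> exists r, w = W r].

(** A partial function of x, by [sum_value_uniq]. The condition [nd] (nonvanishing denominators) is
    included so that it is transferred together with the value of the sum. *)
Definition sum_value (x y : F) := exists W, [/\ enumerates x W, forall r, nd x (W r) & y = \sum_r term x (W r)].

Lemma enumerates_sum x W W' : enumerates x W -> enumerates x W' ->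
  \sum_r term x (W r) = \sum_r term x (W' r).
Proof.
move=> [s i c] [s' i' c'].
rewrite -(big_map W xpredT (term x)) -(big_map W' xpredT (term x)).
apply: perm_big; apply: uniq_perm.
- by rewrite map_inj_uniq // -[index_enum _]enumT enum_uniq.
- by rewrite map_inj_uniq // -[index_enum _]enumT enum_uniq.
move=> w; apply/mapP/mapP => -[r _ ->].
  by have [r' ->] := c' _ (s r); exists r' => //; rewrite mem_index_enum.
by have [r' ->] := c _ (s' r); exists r' => //; rewrite mem_index_enum.
Qed.

Lemma sum_value_uniq x y y' : sum_value x y -> sum_value x y' -> y = y'.
Proof. by move=> [W [H _ ->]] [W' [H' _ ->]]; exact: enumerates_sum. Qed.

(** Layout of the environment: x and y in places 0 and 1, then the m N coordinates of [W], then N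
    places for the arbitrary solution in the exhaustiveness clause. *)
Lemma sum_value_definable : exists f : GRing.formula F, forall x y, GRing.holds [:: x; y] f <-> sum_value x y.
Proof.
pose T : finType := ('I_m * 'I_N)%type.
pose K := #|T|.
pose off (r : 'I_m) (i : 'I_N) : nat := (2 + enum_rank ((r, i) : T))%N.
pose off2 (i : 'I_N) : nat := (2 + K + i)%N.
pose Wn (e : seq F) (r : 'I_m) : {ffun 'I_N -> F} := [ffun i => e`_(off r i)].
pose bodyB (e : seq F) := sol e`_0 [ffun i => e`_(off2 i)] -> exists r, forall i, e`_(off2 i) = e`_(off r i).
have defB : definable bodyB.
  exact: (definable_imp (sol_def off2) (definable_exists_fin (fun r => definable_forall_fin (fun i =>
    definable_eq (tdefinable_var _ (off2 i)) (tdefinable_var _ (off r i)))))).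
pose bodyA (e : seq F) := (forall r, sol e`_0 (Wn e r)) /\
  ((forall r r', r != r' -> exists i, e`_(off r i) != e`_(off r' i)) /\
  ((forall r, nd e`_0 (Wn e r)) /\ e`_1 = \sum_r term e`_0 (Wn e r))).
have defA : definable bodyA.
  apply: (definable_and (definable_forall_fin (fun r => sol_def (off r)))).
  apply: definable_and; last apply: (definable_and (definable_forall_fin (fun r => nd_def (off r)))).
    refine (definable_forall_fin (fun r => definable_forall_fin (fun r' =>
      definable_imp _ (definable_exists_fin (fun i =>
        definable_neq (tdefinable_var _ (off r i)) (tdefinable_var _ (off r' i))))))).
    by exists (GRing.Bool (r != r')).
  exact: (definable_eq (tdefinable_var _ 1) (tdefinable_sum _ (fun r => term_def (off r)))).
have [f Hf] := definable_exists_block 2 K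
  (definable_and defA (definable_forall_block (2 + K) N defB)).
exists f => x y; rewrite Hf; split.
  move=> [e He /= [[As [Ai [An Ay]]] B]].
  have e0 : e`_0 = x by rewrite -He ?inE ?mem_iota.
  have e1 : e`_1 = y by rewrite -He ?inE ?mem_iota.
  exists (Wn e); split; rewrite -?e0 -?e1 //; split=> //.
    move=> r r' rr; apply/eqP; apply: contraT => rr'; case: (Ai r r' rr') => i; move/ffunP/(_ i): rr.
    by rewrite !ffunE => ->; rewrite eqxx.
  move=> w sw; have [e' [e'w He']] := env_block e (2 + K) w.
  have e'0 : e'`_0 = e`_0 by rewrite -He' ?inE ?mem_iota.
  have e'off r i : e'`_(off r i) = e`_(off r i).
    by rewrite -He' // inE mem_iota /off; have := ltn_ord (enum_rank ((r, i) : T)); rewrite -/K; lia.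
  have : sol e'`_0 [ffun i => e'`_(off2 i)].
    by rewrite e'0 (_ : finfun _ = w) //; apply/ffunP => i; rewrite ffunE e'w.
  move=> /(B e' He')[r Hr]; exists r; apply/ffunP => i.
  by rewrite ffunE -e'w Hr e'off.
move=> [W [[Ws Wi Wc] Wn' ->]].
set y0 := \sum_r _.
have [e [eW He]] := env_block [:: x; y0] 2 (fun k : 'I_K => let p : T := enum_val k in W p.1 p.2).
have eoff r i : e`_(off r i) = W r i by rewrite /off eW enum_rankK.
have e0 : e`_0 = x by rewrite -He ?inE ?mem_iota.
have e1 : e`_1 = y0 by rewrite -He ?inE ?mem_iota.
have WE r : Wn e r = W r by apply/ffunP => i; rewrite ffunE eoff.
exists e => //; split.
  split; first by move=> r; rewrite e0 WE.
  split.
    move=> r r' rr; apply/existsP; apply: contraR rr => /existsPn H.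
    apply/eqP/Wi/ffunP => i; apply/eqP; have := H i; rewrite negbK !eoff //.
  by split; [move=> r; rewrite e0 WE | rewrite e1 e0; apply: eq_bigr => r _; rewrite WE].
move=> e' He' se'.
have e'0 : e'`_0 = e`_0 by rewrite -He' ?inE ?mem_iota.
have e'off r i : e'`_(off r i) = e`_(off r i).
  by rewrite -He' // inE mem_iota /off; have := ltn_ord (enum_rank ((r, i) : T)); rewrite -/K; lia.
move: se'; rewrite e'0 e0 => /Wc[r Hr]; exists r => i.
by move/ffunP/(_ i): Hr; rewrite ffunE => ->; rewrite e'off eoff.
Qed.

End Enumeration.

(** * Algebraic functions determined by their behaviour at infinity *)

Section Transfer.
Local Open Scope complex_scope.
Variable R : realType.
Implicit Types x y : R[i].

Lemma poly_lower_bound (p : {poly R[i]}) : p != 0 ->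
  exists c r : R, 0 < c /\ forall x, r < nm x -> c <= nm p.[x].
Proof.
move=> p0; have [s ps] := closed_field_poly_normal p.
exists (nm (lead_coef p)), (\sum_(a <- s) (nm a + 1)); split; first by rewrite nm_gt0 lead_coef_eq0.
move=> x xr.
have -> : p.[x] = lead_coef p * \prod_(a <- s) (x - a).
  by rewrite {1}ps hornerZ horner_prod; congr (_ * _); apply: eq_bigr => a _; rewrite hornerXsubC.
rewrite nmM ler_peMr ?nm_ge0 // nm_prod.
have {xr} : forall a, a \in s -> 1 <= nm (x - a).
  move=> a aS; apply: le_trans (nm_sub _ _); rewrite lerBrDr addrC.
  apply: ltW; apply: le_lt_trans xr; rewrite (big_rem a) //= lerDl sumr_ge0 // => i _.
  by rewrite addr_ge0 ?nm_ge0.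
elim: s {ps} => [|a s IH] H; first by rewrite big_nil.
rewrite big_cons mulr_ege1 ?H ?inE ?eqxx // IH // => b bs.
by apply: H; rewrite inE bs orbT.
Qed.

Lemma poly_upper_bound (p : {poly R[i]}) :
  exists2 c : R, 0 <= c & forall x, 1 <= nm x -> nm p.[x] <= c * nm x ^+ size p.
Proof.
exists (\sum_(i < size p) nm p`_i); first by apply: sumr_ge0 => i _; exact: nm_ge0.
move=> x x1; rewrite horner_coef; apply: le_trans (nm_sum _ _ _) _.
rewrite mulr_suml; apply: ler_sum => i _; rewrite nmM nmX ler_wpM2l ?nm_ge0 //.
by rewrite ler_weXn2l // ltnW.
Qed.

Variables (f : GRing.formula R[i]) (y0 : R[i]).
Let Good x y := GRing.holds [:: x; y] f.
Hypothesis Good_uniq : forall x y y', Good x y -> Good x y' -> y = y'.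
Hypothesis Good_ex : exists r : R, forall x, r < nm x -> exists y, Good x y.
Hypothesis Good_lim : forall n : nat, exists k r : R,
  forall x y, r < nm x -> Good x y -> nm (y - y0) * nm x ^+ n <= k.

(** If [Good x y0] holds at one generic x, it holds off a finite set. Otherwise the graph of [Good]
    lies on a curve; dividing its equation by the highest possible power of u = y - y0 leaves c(x) +
    u q(x, u) = 0 with c nonzero. For large x this fails, since u is smaller than any power of 1/x
    while q grows polynomially. *)
Lemma definable_limit : exists B : seq R[i], forall x, x \notin B -> Good x y0.
Proof.
have [g /andP[gq gr] Hg] := closed_field_qe f.
have [p1 p10 H1] := generic_qf1 y0 gq gr.
have [s ps] := closed_field_poly_normal p1.
have rt x : x \notin s -> p1.[x] != 0.
  apply: contra => /eqP H; have : root p1 x by apply/rootP.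
  by rewrite ps rootZ ?lead_coef_eq0 // root_prod_XsubC.
have [[x0 [x0s Gx0]]|NG] := pselect (exists x, p1.[x] != 0 /\ Good x y0).
  by exists s => x /rt xs; apply/Hg; rewrite (H1 x x0) //; apply/Hg.
exfalso.
have [p2 p20 H2] := generic_qf2 gq gr.
have ev2E (p : {poly {poly R[i]}}) x y : ev2 p x y = (map_poly (horner_eval x) p).[y].
  by rewrite -[y in RHS](hornerC y x) -/(horner_eval x _) horner_map.
(* A good point off the curve would make every generic y' good for the same x, against
   uniqueness. *)
have van x y : Good x y -> ev2 p2 x y = 0.
  move=> Gxy; apply/eqP; apply: contraT => e0.
  pose q := map_poly (horner_eval x) p2 * ('X - y%:P).
  have q0 : q != 0.
    rewrite mulf_neq0 ?polyXsubC_eq0 //.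
    by apply: contra e0 => /eqP q0; rewrite ev2E q0 horner0.
  have [s' qs'] := closed_field_poly_normal q.
  have [y' y's'] : exists y', y' \notin s'.
    pose ints := map (fun i : nat => i%:R : R[i]) (iota 0 (size s').+1).
    have [/allP H|/allPn[y' _ y's']] := boolP (all (mem s') ints); last by exists y'.
    have : uniq ints by rewrite map_inj_uniq ?iota_uniq // => i j /eqP; rewrite eqr_nat => /eqP.
    by move/uniq_leq_size => /(_ s' H); rewrite size_map size_iota ltnn.
  have : q.[y'] != 0.
    apply: contra y's' => /eqP H; have : root q y' by apply/rootP.
    by rewrite qs' rootZ ?lead_coef_eq0 // root_prod_XsubC.
  rewrite hornerM hornerXsubC mulf_eq0 negb_or -ev2E subr_eq0 => /andP[e0' yy'].
  case/eqP: yy'; apply: (Good_uniq (x := x)) => //.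
  by apply/Hg; rewrite (H2 _ _ x y) //; apply/Hg.
pose p3 := p2 \Po ('X + y0%:P%:P).
have p30 : p3 != 0.
  by rewrite -size_poly_gt0 size_comp_poly2 ?size_XaddC // size_poly_gt0.
have ev3 x u : ev2 p3 x u = ev2 p2 x (u + y0).
  by rewrite /ev2 /p3 horner_comp !hornerE rmorphD.
have [k pk] : exists k, p3`_k != 0.
  by exists (size p3).-1; rewrite -lead_coefE lead_coef_eq0.
have [i pi imin] := ex_minnP (ex_intro (fun k => p3`_k != 0) k pk).
pose p4 := drop_poly i p3.
have p3E : p3 = p4 * 'X^i.
  rewrite -[LHS](poly_take_drop i) (_ : take_poly i p3 = 0) ?add0r //.
  apply/polyP => j; rewrite coef_take_poly coef0; case: ifP => // ji.
  by apply/eqP; apply: contraTT ji => /imin; rewrite -leqNgt.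
pose c := p4`_0; pose p5 := drop_poly 1 p4.
have p4E : p4 = c%:P + p5 * 'X.
  rewrite -[LHS](poly_take_drop 1) expr1; congr (_ + _).
  by apply/polyP => -[|j]; rewrite coef_take_poly coefC.
have c0 : c != 0 by rewrite /c coef_drop_poly add0n.
have main x u : u != 0 -> Good x (u + y0) -> c.[x] = - (u * ev2 p5 x u).
  move=> u0 /van; rewrite -ev3 p3E /ev2 hornerM hornerXn -rmorphXn /= hornerM hornerC.
  move/eqP; rewrite mulf_eq0 expf_eq0 (negbTE u0) andbF orbF p4E !hornerE addr_eq0 => /eqP ->.
  by rewrite mulrC.
have [d [K [K0 HK]]] : exists d (K : R), 0 <= K /\ forall x u, 1 <= nm x -> nm u <= 1 -> nm (ev2 p5 x u) <= K * nm x ^+ d.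
  elim/poly_ind: p5 {p4E main} => [|q a [d [K [K0 HK]]]].
    by exists 0%N, 0; split=> // x u _ _; rewrite /ev2 !horner0 nm0 mul0r.
  have [K' K'0 HK'] := poly_upper_bound a.
  exists (maxn d (size a)), (K + K'); split=> [|x u x1 u1]; first by rewrite addr_ge0.
  rewrite /ev2 !hornerE; apply: le_trans (nmD _ _) _; rewrite mulrDl lerD //.
    rewrite nmM; apply: (@le_trans _ _ (K * nm x ^+ d)).
      apply: le_trans (HK _ _ x1 u1); rewrite ler_piMr ?nm_ge0 //.
    by rewrite ler_wpM2l // ler_weXn2l // leq_maxl.
  apply: le_trans (HK' _ x1) _; rewrite ler_wpM2l // ler_weXn2l // leq_maxr //.
have [cl [rl [cl0 Hcl]]] := poly_lower_bound c0.
have [r1 Hr1] := Good_ex.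
have [k2 [r2 Hr2]] := Good_lim d.+1.
have [rs Hrs] : exists rs : R, forall x, rs < nm x -> x \notin s.
  exists (\sum_(a <- s) nm a) => x xs; apply/negP => xs'; move: xs.
  by rewrite (big_rem x) //= ltNge lerDl sumr_ge0 // => *; exact: nm_ge0.
have k20 : 0 <= `|k2| by [].
(* Beyond all thresholds at once: the summand [|k2|] ensures |u| <= 1, and the last summand
   contradicts cl |x| <= |k2| K. *)
pose r := 1 + `|rl| + `|r1| + `|r2| + `|rs| + `|k2| + `|k2| * K / cl.
have r0 : 1 <= r.
  by rewrite /r -!addrA lerDl !addr_ge0 // divr_ge0 ?mulr_ge0 // ltW.
pose x : R[i] := (r + 1)%:C.
have xE : nm x = r + 1 by rewrite nmC //; lra.
have t0 : 0 <= `|k2| * K / cl by rewrite divr_ge0 ?mulr_ge0 // ltW.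
have [h1 h2 h3 h4] : [/\ rl <= `|rl|, r1 <= `|r1|, r2 <= `|r2| & rs <= `|rs|].
  by split; exact: ler_norm.
have [g1 g2 g3 g4] : [/\ 0 <= `|rl|, 0 <= `|r1|, 0 <= `|r2| & 0 <= `|rs|] by [].
have h5 : k2 <= `|k2| by exact: ler_norm.
have [y Gy] : exists y, Good x y by apply: Hr1; rewrite xE /r; lra.
have yy0 : y - y0 != 0.
  rewrite subr_eq0; apply/eqP => yE; apply: NG; exists x; split; last by rewrite -yE.
  by apply: rt; apply: Hrs; rewrite xE /r; lra.
have x1 : 1 <= nm x by rewrite xE; lra.
have x0 : 0 < nm x by lra.
have lim := Hr2 x y; rewrite {1}xE in lim.
have {}lim := lim ltac:(rewrite /r; lra) Gy.
have xd : 1 <= nm x ^+ d by rewrite exprn_ege1.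
have u1 : nm (y - y0) <= 1.
  rewrite -(ler_pM2r (x := nm x ^+ d.+1)) ?exprn_gt0 // mul1r; apply: le_trans lim _.
  apply: le_trans h5 _; rewrite exprS; apply: (@le_trans _ _ (nm x)).
    by rewrite xE /r; lra.
  by rewrite ler_peMr // ltW.
have E := main x (y - y0) yy0; rewrite subrK in E; have {}E := E Gy.
have := Hcl x; rewrite {1}xE E nmN nmM => /(_ ltac:(rewrite /r; lra)) C1.
have C2 := HK x _ x1 u1.
have C3 : cl * nm x <= `|k2| * K.
  apply: (@le_trans _ _ (nm (y - y0) * (K * nm x ^+ d) * nm x)).
    rewrite ler_pM2r //; apply: le_trans C1 _.
    by rewrite ler_wpM2l ?nm_ge0.
  rewrite (_ : _ * nm x = (nm (y - y0) * nm x ^+ d.+1) * K); last by rewrite exprS; ring.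
  by rewrite ler_wpM2r // (le_trans lim).
have : nm x <= `|k2| * K / cl by rewrite ler_pdivlMr // mulrC.
by rewrite xE /r; lra.
Qed.

End Transfer.

(** * Completeness *)

Lemma prodr_expz (K : fieldType) (I : Type) (s : seq I) (f : I -> K) (n : int) :
  \prod_(i <- s) f i ^ n = (\prod_(i <- s) f i) ^ n.
Proof. by elim/big_rec2: _ => [|i a b _ ->]; rewrite ?exp1rz // expfzMl. Qed.

Lemma expz_sum (K : fieldType) (I : Type) (s : seq I) (z : K) (n : I -> int) : z != 0 ->
  \prod_(i <- s) z ^ n i = z ^ (\sum_(i <- s) n i).
Proof. by move=> z0; elim/big_rec2: _ => [|i a b _ ->]; rewrite ?expr0z // expfzDr. Qed.

(** * A spectral term in the parameters t and eta *)

Section Completeness.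
Variables (R : realType) (L N : nat).
Local Notation C := R[i].
Hypotheses (L_gt0 : (0 < L)%N) (N_gt0 : (0 < N)%N) (NL : (N <= L)%N).
Variables (x y : config L N).
Local Notation index := {ffun 'I_N -> 'I_L}.

Definition bethe_term (zeta : C) (w : {ffun 'I_N -> C}) : C :=
  L%:R * bethe_G w y zeta * bethe_u w x zeta.
Definition nondegenerate (zeta : C) (w : {ffun 'I_N -> C}) : Prop :=
  (forall i, bethe_D L N (w i) != 0) /\ bethe_jac L w != 0.
Definition sgN : C := (-1) ^+ N.+1.

(** This and [cexpo] are the exponents of [rt (w0 j)] and of eta_j in the term of [s], indexed by
    the root [j] instead of the particle. The last sum in [cexpo] stems from the product of all
    eta_k contained in each zeta^-1 w_j. *)
Definition nexp (s : 'S_N) (j : 'I_N) : int := (pos x ((s^-1)%g j))%:Z - (pos y j)%:Z.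
Definition cexpo (s : 'S_N) (j : 'I_N) : int :=
  N%:Z * nexp s j + L%:Z * (j%:Z - ((s^-1)%g j)%:Z) - \sum_i nexp s i.

Section Expansion.
Variables (rt : 'I_L -> C) (w0 : index) (t eps : C) (eta : 'I_N -> C).
Hypotheses (rt0 : forall i, rt i != 0) (eps0 : eps != 0) (eta0 : forall j, eta j != 0).
Hypothesis etaE : forall j, eta j ^+ L + rt (w0 j) * t * eta j ^+ N = 1.
Hypothesis tE : t * \prod_j eta j = eps.
Hypothesis den0 : forall j, den_at rt w0 t eta j != 0.
Hypothesis jac0 : jac_at rt w0 t eta != 0.
Local Notation w := (root_of_data L eta).

Let one_a j : 1 - eta j ^+ L = rt (w0 j) * t * eta j ^+ N.
Proof. by rewrite -(etaE j) addrC addKr. Qed.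
Let t0 : t != 0. Proof. by apply: contraNneq eps0 => t0; rewrite -tE t0 mul0r. Qed.
Let oa0 j : 1 - eta j ^+ L != 0.
Proof. by rewrite one_a !mulf_neq0 ?expf_neq0. Qed.
Let P0 : \prod_j eta j != 0. Proof. by apply/prodf_neq0. Qed.

Lemma bethe_D_data j : bethe_D L N (w j) = den_at rt w0 t eta j / (1 - eta j ^+ L).
Proof.
rewrite /bethe_D ffunE /den_at -one_a; have := oa0 j.
by set a := eta j ^+ L => h; field.
Qed.

Lemma bethe_jac_data : bethe_jac L w = L%:R * jac_at rt w0 t eta.
Proof.
rewrite /bethe_jac /jac_at mulrBr mulr1 mulr_sumr; congr (_ - _); apply: eq_bigr => j _.
by rewrite bethe_D_data invfM invrK -one_a; ring.
Qed.

Lemma bethe_ratio_data j : (w j - 1) / bethe_D L N (w j) = eta j ^+ L / den_at rt w0 t eta j.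
Proof.
rewrite bethe_D_data ffunE; have := oa0 j; have := den0 j.
set a := eta j ^+ L; set d := den_at _ _ _ _ _ => d0 h; field.
by rewrite h d0.
Qed.

Lemma nondegenerate_data zeta : nondegenerate zeta w.
Proof.
split; first by move=> j; rewrite bethe_D_data mulf_neq0 ?invr_eq0.
by rewrite bethe_jac_data mulf_neq0 // pnatr_eq0 -lt0n.
Qed.

Lemma bethe_hu_data : bethe_h w y eps^-1 * bethe_u w x eps^-1 =
  \sum_(s : 'S_N) (-1) ^+ s * (\prod_j rt (w0 j) ^ nexp s j * \prod_j eta j ^ cexpo s j).
Proof.
pose b j := rt (w0 j) * eta j ^+ N / \prod_k eta k.
have b0 j : b j != 0 by rewrite /b !mulf_neq0 ?expf_neq0 ?invr_eq0.
have wb j : eps^-1^-1 * w j = (b j)^-1.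
  rewrite invrK ffunE one_a /b -tE; have := rt0 (w0 j); have := eta0 j; have := P0.
  set P := \prod_k _; set e := eta j => p0 e0 r0; field.
  by rewrite r0 t0 p0 expf_neq0.
rewrite /bethe_h /bethe_u mulr_sumr; apply: eq_bigr => s _.
rewrite /bethe_A -!mulrA mulrCA; congr (_ * _).
have -> : \prod_j (1 - (w (s j))^-1) ^ ((s j)%:Z - j%:Z) = \prod_j eta j ^ (L%:Z * (j%:Z - ((s^-1)%g j)%:Z)).
  rewrite (reindex_inj (@perm_inj _ s^-1)%g) /=; apply: eq_bigr => j _.
  by rewrite permKV ffunE invrK subKr exprnP exprz_exp.
have -> : \prod_i (eps^-1^-1 * w (s i)) ^- pos x i = \prod_j b j ^ (pos x ((s^-1)%g j))%:Z.
  rewrite (reindex_inj (@perm_inj _ s^-1)%g) /=; apply: eq_bigr => j _.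
  by rewrite permKV wb exprVn invrK.
have -> : \prod_i (eps^-1^-1 * w i) ^+ pos y i = \prod_j b j ^ (- (pos y j)%:Z).
  by apply: eq_bigr => j _; rewrite wb exprVn -exprnN.
rewrite -!big_split /=.
pose S := \sum_i nexp s i.
rewrite (eq_bigr (fun j => rt (w0 j) ^ nexp s j * (eta j ^ (N%:Z * nexp s j + L%:Z * (j%:Z - ((s^-1)%g j)%:Z))
   * (\prod_k eta k) ^ (- nexp s j)))); last first.
  move=> j _; rewrite mulrCA -[b j ^ _ * _]expfzDr // (addrC (- _)) -/(nexp s j).
  have -> : b j ^ nexp s j = rt (w0 j) ^ nexp s j * eta j ^ (N%:Z * nexp s j) * (\prod_k eta k) ^ (- nexp s j).
    by rewrite /b !expfzMl exprnP exprz_exp exprz_inv.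
  rewrite [eta j ^ (_ + _)]expfzDr // -!mulrA mulrCA; congr (_ * _).
  by rewrite mulrCA.
rewrite big_split [RHS]big_split /=; congr (_ * _); rewrite big_split /=.
rewrite expz_sum // sumrN -prodr_expz -big_split /=; apply: eq_bigr => j _.
by rewrite -expfzDr.
Qed.

(** The factor L in [bethe_term] cancels the one in [bethe_jac], and L^-N compensates for writing
    each ratio as L eta^L / den, normalised to 1 at t = 0. *)
Lemma bethe_term_data : bethe_term eps^-1 w = (L%:R ^+ N)^-1 *
  \sum_(s : 'S_N) (-1) ^+ s * (\prod_j rt (w0 j) ^ nexp s j *
    ((\prod_j (eta j ^ cexpo s j * (L%:R * eta j ^+ L / den_at rt w0 t eta j))) / jac_at rt w0 t eta)).
Proof.
have L0 : L%:R != 0 :> C by rewrite pnatr_eq0 -lt0n.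
rewrite /bethe_term /bethe_G bethe_jac_data.
under eq_bigr => j _ do rewrite bethe_ratio_data.
set Q := \prod_j (eta j ^+ L / _).
have QE : \prod_j (L%:R * eta j ^+ L / den_at rt w0 t eta j) = L%:R ^+ N * Q.
  rewrite -[N in L%:R ^+ N]card_ord -prodr_const -big_split /=; apply: eq_bigr => j _.
  by rewrite mulrA.
under [in RHS]eq_bigr => s _ do rewrite big_split /= QE.
have comm (a b c d e : C) : a * (b * c * d) * e = (b * e) * (a * c * d) by ring.
rewrite comm bethe_hu_data mulr_suml mulr_sumr; apply: eq_bigr => s _.
clear QE; move: (\prod_j rt _ ^ _) (\prod_j eta j ^ _) Q ((-1) ^+ s) => p1 p2 q sg.
have LN0 := expf_neq0 N L0.
move: jac0 LN0 L0; move: (jac_at _ _ _ _) ((L%:R : C) ^+ N) (L%:R : C) => J LN l J0 LN0 l0.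
by field; rewrite l0 J0 LN0.
Qed.

End Expansion.
End Completeness.

(** * Vanishing of all coefficients but one *)

Section Completeness2.
Variables (R : realType) (L N : nat).
Local Notation C := R[i].
Hypotheses (L_gt0 : (0 < L)%N) (N_gt0 : (0 < N)%N) (NL : (N <= L)%N).
Variables (x y : config L N).
Local Notation index := {ffun 'I_N -> 'I_L}.

Lemma pos_mono (X : config L N) (i j : 'I_N) : (i < j)%N -> (pos X i < pos X j)%N.
Proof.
move=> ij; have iN := ltn_ord i.
have tr : transitive (fun a b : 'I_L => (a < b)%N) by move=> b a c; apply: ltn_trans.
have x0 : 'I_L := pos X i.
rewrite /pos !(tnth_nth x0).
by apply: (sorted_ltn_nth tr x0 (valP X)) => //; rewrite inE size_tuple.
Qed.

Section MainSum.
Variables (M : nat) (rt : 'I_L -> C) (eh ih : {poly C}).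
Hypotheses (rt0 : forall i, rt i != 0)
  (rt_sum : forall p : int, ~~ (L%:Z %| p)%Z -> \sum_i rt i ^ p = 0).
Hypotheses (eh0 : eh`_0 = 1) (ih0 : ih`_0 = 1).
Hypothesis (ehE : eqX M (eh ^+ L + 'X * eh ^+ N) 1).
Hypothesis (ihE : eqX M (eh * ih) 1).

(** Translates [bethe_exponents], applied to s^-1. The quotients [k j] are nonnegative because n_j +
    r_j >= - y_j > - L. *)
Lemma exponents_alternative (s : 'S_N) (r : 'I_N -> nat) :
  (forall j, (L%:Z %| nexp x y s j + (r j)%:Z)%Z) ->
  (exists (j : 'I_N) (m : nat), cexpo x y s j - (\sum_i r i)%N%:Z + N%:Z * (r j)%:Z = L%:Z * m%:Z /\ (m < r j)%N)
  \/ [/\ s = 1%g, x = y & forall j, r j = 0%N].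
Proof.
move=> D; pose k j : nat := `|((nexp x y s j + (r j)%:Z) %/ L)%Z|%N.
have kE j : nexp x y s j + (r j)%:Z = L%:Z * (k j)%:Z.
  have d := divzK (D j); rewrite /k; set q := ((_ %/ _)%Z) in d *.
  have q0 : (0 <= q)%R.
    rewrite leNgt; apply/negP => q0; have : q <= -1 by lia.
    move: d; rewrite /nexp; have := ltn_ord (pos y j); move: (pos y j : nat) (pos x _ : nat) (r j) => a b c aL d h.
    have : q * L%:Z <= - L%:Z by nia.
    by lia.
  by rewrite -d gez0_abs // mulrC.
have h := @bethe_exponents L N (fun i => pos x i) (fun i => pos y i) (@pos_mono x) (fun i => ltn_ord _) (@pos_mono y) r k s^-1%g NL.
have [|[j [m [E mr]]]|[s1 xy r0]] := h.
- by move=> j; have := kE j; rewrite /nexp; lia.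
- left; exists j, m; split=> //.
  have -> : (\sum_i r i)%N%:Z = \sum_i (r i)%:Z by rewrite (big_morph Posz PoszD erefl).
  have ks : \sum_i (nexp x y s i + (r i)%:Z) = L%:Z * (\sum_i k i)%N%:Z.
    rewrite (eq_bigr (fun i => L%:Z * (k i)%:Z)) => [|i _]; last exact: kE.
    by rewrite -mulr_sumr (big_morph Posz PoszD erefl).
  move: ks; rewrite big_split /= => ks.
  rewrite /cexpo; move: (\sum_i nexp _ _ _ _) (\sum_i (r i)%:Z) ks => n q ks.
  have kj := kE j; move: (\sum_i k i)%N E ks => K E ks.
  have E' : j%:Z + N%:Z * (k j)%:Z = m%:Z + ((s^-1)%g j)%:Z + K%:Z by rewrite -PoszM -!PoszD E.
  have -> : m%:Z = j%:Z + N%:Z * (k j)%:Z - ((s^-1)%g j)%:Z - K%:Z by rewrite E'; ring.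
  rewrite (_ : N%:Z * nexp x y s j + _ - n - q + _ = N%:Z * (nexp x y s j + (r j)%:Z) + L%:Z * (j%:Z - ((s^-1)%g j)%:Z) - (n + q)); last by ring.
  by rewrite kj ks; ring.
right; split=> //; first by rewrite -[s]invgK s1 invg1.
apply/val_inj/eq_from_tnth => i; apply/val_inj; exact: xy.
Qed.

(** Only s = 1 and order q = 0 survive, and only for x = y; each of the L^N branches then
    contributes 1. *)
Lemma main_sum : (0 < M)%N -> forall eps : C,
  (L%:R ^+ N)^-1 * \sum_(w0 : index) \sum_(s : 'S_N) (-1) ^+ s * (\prod_j rt (w0 j) ^ nexp x y s j *
     \sum_(q < M) lagrange_coef eh ih rt (cexpo x y s) w0 q * eps ^+ q) = (x == y)%:R.
Proof.
move=> M0 eps.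
rewrite exchange_big /=.
have inner (s : 'S_N) : \sum_(w0 : index) (-1) ^+ s * (\prod_j rt (w0 j) ^ nexp x y s j *
     \sum_(q < M) lagrange_coef eh ih rt (cexpo x y s) w0 q * eps ^+ q) =
   L%:R ^+ N * ((s == 1%g) && (x == y))%:R.
  rewrite -mulr_sumr.
  rewrite (eq_bigr (fun w0 : index => \sum_(q < M) (\prod_j rt (w0 j) ^ nexp x y s j) * lagrange_coef eh ih rt (cexpo x y s) w0 q * eps ^+ q)); last first.
    by move=> w0 _; rewrite mulr_sumr; apply: eq_bigr => q _; rewrite mulrA.
  rewrite exchange_big /= (bigD1 (Ordinal M0)) //= [X in _ + X]big1 ?addr0; last first.
    move=> q q0; rewrite -mulr_suml (lagrange_coef_sum_eq0 L_gt0 ehE ihE rt0 rt_sum) ?mul0r //.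
    move=> r rq D; have [|[_ _ r0]] := exponents_alternative D; first by rewrite rq.
    by exfalso; case/negP: q0; apply/eqP/val_inj; rewrite /= -rq big1.
  rewrite -mulr_suml expr0 mulr1 (lagrange_coef_sum0 eh0 ih0 _ _ _ M0).
  have [/forallP D|/forallPn[j jD]] := boolP [forall j, (L%:Z %| nexp x y s j)%Z]; last first.
    rewrite (bigD1 j) //= rt_sum // mul0r mulr0.
    case: andP => [[/eqP s1 /eqP xy]|]; last by rewrite mulr0.
    by case/negP: jD; rewrite /nexp s1 invg1 perm1 xy subrr dvdz0.
  have [||[s1 xy _]] := @exponents_alternative s (fun=> 0%N).
  - by move=> j; rewrite addr0.
  - by move=> [j [m [_]]]; rewrite ltn0.
  rewrite s1 xy !eqxx /= mulr1 odd_perm1 expr0 mul1r.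
  rewrite (eq_bigr (fun=> L%:R)) ?prodr_const ?card_ord // => j _.
  rewrite (eq_bigr (fun=> 1)) ?sumr_const ?card_ord // => i _.
  by rewrite /nexp invg1 perm1 subrr expr0z.
rewrite (eq_bigr _ (fun s _ => inner s)) -mulr_sumr mulKf ?expf_neq0 ?pnatr_eq0 -?lt0n //.
rewrite (bigD1 1%g) //= eqxx /= big1 ?addr0 // => s /negbTE ->.
by [].
Qed.

End MainSum.
End Completeness2.

(** * Completeness outside a finite set *)

Section Completeness3.
Variables (R : realType) (L N : nat).
Local Notation C := R[i].
Hypotheses (L_gt0 : (0 < L)%N) (N_gt0 : (0 < N)%N) (NL : (N <= L)%N).
Variables (x y : config L N).
Local Notation index := {ffun 'I_N -> 'I_L}.
Local Notation sg := (sgN R N).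
Local Notation m := #|{: index}|.

(** Replacing each term by its expansion costs O(eps^(M+1)), as |t| <= 2|eps|, and the expansions
    sum exactly to the indicator. Precision [M.+1] keeps the order positive, as [main_sum] requires,
    also for M = 0. *)
Lemma near_infinity M : exists k r0 : R, forall zeta : C, r0 < nm zeta ->
  exists W : 'I_m -> {ffun 'I_N -> C}, [/\ enumerates (bethe_sys L sg) zeta W,
    forall r, nondegenerate L zeta (W r) &
    nm (\sum_r bethe_term x y zeta (W r) - (x == y)%:R) * nm zeta ^+ M <= k].
Proof.
have sg2 : sg * sg = 1 by rewrite -expr2 /sgN -exprM mulnC exprM sqrrN expr1n expr1n.
have sg0 : sg != 0 by apply: contra_eq_neq sg2 => ->; rewrite mul0r eq_sym oner_eq0.
have [rt [rt_pow rt_inj rt_all rt_sum]] := roots_of L_gt0 sg0.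
have rt1 := nm_rt L_gt0 sg2 rt_pow.
have rt0 i : rt i != 0 by rewrite -nm_eq0 rt1 oner_eq0.
have [eh eh0 ehE] := algebraic_series C N M.+1 L_gt0.
have [ih ih0 ihE] := inverse_mod M.+1 eh0.
have /choice[f Hf] : forall sw : 'S_N * index, exists rk : R * R, [/\ 0 < rk.1, 0 <= rk.2 &
   forall t eps eta, nm t <= rk.1 -> local_data rt sw.2 t eta -> t * \prod_j eta j = eps ->
  [/\ forall j, den_at rt sw.2 t eta j != 0, jac_at rt sw.2 t eta != 0 &
  nm ((\prod_j (eta j ^ cexpo x y sw.1 j * (L%:R * eta j ^+ L / den_at rt sw.2 t eta j))) / jac_at rt sw.2 t eta
     - \sum_(q < M.+1) lagrange_coef eh ih rt (cexpo x y sw.1) sw.2 q * eps ^+ q) <= rk.2 * nm t ^+ M.+1]].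
  move=> [s w0] /=; have [rho rho0 [k k0 H]] := bethe_term_asymptotics L_gt0 N_gt0 NL rt1 eh0 ehE ihE (cexpo x y s) w0.
  by exists (rho, k).
(* Then (1 + S)^-1 is a common lower bound for the finitely many radii. *)
pose S := \sum_(sw : 'S_N * index) (f sw).1^-1.
have S0 : 0 <= S by apply: sumr_ge0 => sw _; have [h _ _] := Hf sw; rewrite invr_ge0 ltW.
have rhoP sw : (1 + S)^-1 <= (f sw).1.
  have [h _ _] := Hf sw; rewrite -[X in _ <= X]invrK lef_pV2 ?posrE ?invr_gt0 //; last by rewrite ltr_wpDr.
  rewrite /S (bigD1 sw) //= addrCA lerDl addr_ge0 // sumr_ge0 // => sw' _.
  by have [h' _ _] := Hf sw'; rewrite invr_ge0 ltW.
pose K := \sum_(sw : 'S_N * index) (f sw).2.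
have [rho1 rho10 Henum] := bethe_sys_enum L_gt0 N_gt0 NL sg2 rt_pow rt_inj rt_all.
have LN0 : 0 < (L%:R ^+ N)^-1 :> R by rewrite invr_gt0 exprn_gt0 // ltr0n.
exists ((L%:R ^+ N)^-1 * (K * 2 ^+ M.+1)), (Num.max 1 (Num.max rho1^-1 (2 * (1 + S)))).
move=> zeta; rewrite !gt_max => /andP[z1 /andP[zr zS]].
have zp : 0 < nm zeta by lra.
have z0 : zeta != 0 by rewrite -nm_gt0.
pose eps := zeta^-1; have eps0 : eps != 0 by rewrite invr_eq0.
have ez : eps^-1 = zeta by rewrite invrK.
have epsr : nm eps < rho1 by rewrite nmV invf_plt ?posrE.
have epsS : 2 * nm eps <= (1 + S)^-1.
  rewrite nmV -[X in _ <= X]mul1r ler_pdivlMr ?ltr_wpDr // mulrAC ler_pdivrMr // mul1r ltW //.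
have eps1 : nm eps <= 1 by rewrite nmV invf_le1 // ltW.
have [t [eta [Hd Hs Hi Hc]]] := Henum eps eps0 epsr.
rewrite ez in Hs Hc.
have r2 := near_radius_le R L_gt0.
have eta0 w0 j : eta w0 j != 0.
  by have [_ /(_ j)[h _] _] := Hd w0; have [] := nm_near1 h r2.
have tsmall sw : nm (t sw.2) <= (f sw).1.
  by have [h _ _] := Hd sw.2; apply: le_trans h (le_trans epsS (rhoP sw)).
have HT sw := let: And3 _ _ h := Hf sw in let: And3 _ a b := Hd sw.2 in h _ eps _ (tsmall sw) a b.
have den0 w0 j : den_at rt w0 (t w0) (eta w0) j != 0 by have [h _ _] := HT (1%g, w0).
have jac0 w0 : jac_at rt w0 (t w0) (eta w0) != 0 by have [_ h _] := HT (1%g, w0).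
have dE w0 j : eta w0 j ^+ L + rt (w0 j) * t w0 * eta w0 j ^+ N = 1 by have [_ /(_ j)[_ h] _] := Hd w0.
have tE w0 : t w0 * \prod_j eta w0 j = eps by have [] := Hd w0.
exists (fun r => root_of_data L (eta (enum_val r))); split.
- split=> [r|r r' /Hi /enum_val_inj //|w sw]; first exact: Hs.
  by have [w0 ->] := Hc w sw; exists (enum_rank w0); rewrite enum_rankK.
- by move=> r; apply: (nondegenerate_data L_gt0 rt0 eps0 (eta0 _) (dE _) (tE _) (den0 _) (jac0 _)).
rewrite -(big_enum_val (A := {: index}) (fun w0 => bethe_term x y zeta (root_of_data L (eta w0)))) /=.
rewrite -ez.
under eq_bigr => w0 _ do rewrite (bethe_term_data L_gt0 x y rt0 eps0 (eta0 _) (dE _) (tE _) (den0 _) (jac0 _)).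
rewrite -(main_sum L_gt0 N_gt0 NL x y rt0 rt_sum eh0 ih0 ehE ihE (ltn0Sn M) eps).
rewrite -mulr_sumr -mulrBr -sumrB nmM ez.
have nLN : nm ((L%:R ^+ N)^-1 : C) = (L%:R ^+ N)^-1 by rewrite nmV nmX nm_nat.
rewrite nLN.
rewrite -mulrA ler_wpM2l ?(ltW LN0) //.
have step : nm (\sum_(w0 : index) (\sum_(s : 'S_N) (-1) ^+ s * (\prod_j rt (w0 j) ^ nexp x y s j *
    ((\prod_j (eta w0 j ^ cexpo x y s j * (L%:R * eta w0 j ^+ L / den_at rt w0 (t w0) (eta w0) j))) / jac_at rt w0 (t w0) (eta w0)))
   - \sum_(s : 'S_N) (-1) ^+ s * (\prod_j rt (w0 j) ^ nexp x y s j *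
     \sum_(q < M.+1) lagrange_coef eh ih rt (cexpo x y s) w0 q * eps ^+ q))) <= K * (2 * nm eps) ^+ M.+1.
  apply: le_trans (nm_sum _ _ _) _.
  apply: (@le_trans _ _ (\sum_(w0 : index) \sum_(s : 'S_N) (f (s, w0)).2 * (2 * nm eps) ^+ M.+1)); last first.
    by rewrite exchange_big pair_big /= -mulr_suml; rewrite (eq_bigr (fun sw => (f sw).2)) // => -[].
  apply: ler_sum => w0 _; rewrite -sumrB; apply: le_trans (nm_sum _ _ _) _; apply: ler_sum => s _.
  rewrite -mulrBr -mulrBr nmM nmM nm_prod.
  have -> : nm ((-1 : C) ^+ s) = 1 by rewrite nmX nmN nm1 expr1n.
  rewrite big1 ?mul1r; last first.
    move=> j _; case: (nexp x y s j) => n; first by rewrite nmX rt1 expr1n.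
    by rewrite /exprz nmV nmX rt1 expr1n invr1.
  have [_ _ h] := HT (s, w0); apply: le_trans h _.
  have [_ k0 _] := Hf (s, w0); rewrite ler_wpM2l //= lerXn2r ?nnegrE ?nm_ge0 ?mulr_ge0 ?nm_ge0 //.
  by have [] := Hd w0.
apply: le_trans (ler_wpM2r _ step) _; first by rewrite exprn_ge0 // nm_ge0.
rewrite exprMn -!mulrA ler_wpM2l //.
  by apply: sumr_ge0 => sw _; have [_ h _] := Hf sw.
rewrite -[X in _ <= X]mulr1 ler_wpM2l ?exprn_ge0 //.
rewrite exprS -mulrA nmV -exprMn mulVf ?expr1n ?mulr1; last by rewrite nm_eq0.
by rewrite -nmV.
Qed.

Definition ffun_at (off : 'I_N -> nat) (e : seq C) : {ffun 'I_N -> C} := [ffun i => e`_(off i)].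

Lemma tdef_at off j : tdefinable (fun e : seq C => ffun_at off e j).
Proof. by apply: tdefinable_ext (tdefinable_var _ (off j)) => e; rewrite ffunE. Qed.

Lemma sys_definable off : definable (fun e : seq C => bethe_sys L sg e`_0 (ffun_at off e)).
Proof.
have c c' := tdefinable_cst (c' : C).
have w1 j : tdefinable (fun e : seq C => 1 - (ffun_at off e j)^-1).
  exact: tdefinableD (c 1) (tdefinableN (tdefinableV (tdef_at off j))).
pose P i (e : seq C) := ffun_at off e i != 0 /\ (1 - (ffun_at off e i)^-1 != 0 /\
  ffun_at off e i ^+ L * (1 - (ffun_at off e i)^-1) ^+ N = sg * e`_0 ^+ L * \prod_j (1 - (ffun_at off e j)^-1)).
have H i : definable (P i).
  apply: (definable_and (definable_neq (tdef_at off i) (c 0))).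
  apply: (definable_and (definable_neq (w1 i) (c 0))).
  apply: definable_eq (tdefinableM (tdefinableX L (tdef_at off i)) (tdefinableX N (w1 i))) _.
  exact: tdefinableM (tdefinableM (c sg) (tdefinableX L (tdefinable_var _ 0))) (tdefinable_prod _ w1).
apply: definable_ext (definable_forall_fin H) => e.
by split=> h i; have := h i; rewrite /P => -[a]; [case | move=> b d].
Qed.

Lemma D_definable off j : tdefinable (fun e : seq C => bethe_D L N (ffun_at off e j)).
Proof.
have c c' := tdefinable_cst (c' : C).
exact: tdefinableD (tdefinableM (c L%:R) (tdef_at off j)) (c (- (L%:R - N%:R))).
Qed.

Lemma jac_definable off : tdefinable (fun e : seq C => bethe_jac L (ffun_at off e)).
Proof.
have c c' := tdefinable_cst (c' : C).
exact: tdefinableD (c L%:R) (tdefinableN (tdefinable_sum _ (fun j =>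
  tdefinableM (c L%:R) (tdefinableV (D_definable off j))))).
Qed.

Lemma nd_definable off : definable (fun e : seq C => nondegenerate L e`_0 (ffun_at off e)).
Proof.
have c c' := tdefinable_cst (c' : C).
exact: definable_and (definable_forall_fin (fun j => definable_neq (D_definable off j) (c 0)))
  (definable_neq (jac_definable off) (c 0)).
Qed.

Lemma term_definable off : tdefinable (fun e : seq C => bethe_term x y e`_0 (ffun_at off e)).
Proof.
have c c' := tdefinable_cst (c' : C).
have zv := tdefinableV (tdefinable_var C 0).
have zw j : tdefinable (fun e : seq C => (e`_0)^-1 * ffun_at off e j) := tdefinableM zv (tdef_at off j).
have h : tdefinable (fun e : seq C => bethe_h (ffun_at off e) y e`_0).
  exact: tdefinable_prod _ (fun j => tdefinableX _ (zw j)).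
have w1 j : tdefinable (fun e : seq C => 1 - (ffun_at off e j)^-1).
  exact: tdefinableD (c 1) (tdefinableN (tdefinableV (tdef_at off j))).
have A s : tdefinable (fun e : seq C => bethe_A s (ffun_at off e)).
  exact: tdefinableM (c ((-1) ^+ s)) (tdefinable_prod _ (fun j => tdefinableXz _ (w1 (s j)))).
have u : tdefinable (fun e : seq C => bethe_u (ffun_at off e) x e`_0).
  exact: tdefinable_sum _ (fun s => tdefinableM (A s) (tdefinable_prod _ (fun i =>
    tdefinableV (tdefinableX _ (zw (s i)))))).
have ratio : tdefinable (fun e : seq C => \prod_i ((ffun_at off e i - 1) / bethe_D L N (ffun_at off e i))).
  exact: tdefinable_prod _ (fun i => tdefinableM (tdefinableD (tdef_at off i) (c (-1))) (tdefinableV (D_definable off i))).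
exact: tdefinableM (tdefinableM (c L%:R) (tdefinableM (tdefinableM h ratio) (tdefinableV (jac_definable off)))) u.
Qed.

(** [near_infinity] provides the existence and the limit required by [definable_limit]. The number
    of solutions is the same L^N for all large zeta, so the length of [W] can be fixed in the
    formula. *)
Lemma bethe_completeness : exists B : seq C, forall zeta, zeta \notin B ->
  exists W : 'I_m -> {ffun 'I_N -> C}, [/\ enumerates (bethe_sys L sg) zeta W,
    forall r, nondegenerate L zeta (W r) & \sum_r bethe_term x y zeta (W r) = (x == y)%:R].
Proof.
have [f Hf] := @sum_value_definable C N m (bethe_sys L sg) (@nondegenerate R L N) (bethe_term x y)
  sys_definable nd_definable term_definable.
have [|||B HB] := @definable_limit R f (x == y)%:R.
- by move=> z v v' /Hf h /Hf; apply: sum_value_uniq h.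
- have [k [r0 H]] := near_infinity 0; exists r0 => z /H[W [We Wn _]].
  by exists (\sum_r bethe_term x y z (W r)); apply/Hf; exists W.
- move=> n; have [k [r0 H]] := near_infinity n; exists k, r0 => z v /H[W [We Wn Wl]] /Hf Hv.
  have -> // : v = \sum_r bethe_term x y z (W r).
  by apply: sum_value_uniq Hv _; exists W.
by exists B => z /HB /Hf[W [We Wn Wl]]; exists W.
Qed.

End Completeness3.

(** * The forward equation *)

Local Open Scope classical_set_scope.
Local Open Scope ring_scope.
Local Open Scope complex_scope.

Section FiniteSums.
Variables (R : realType) (S : eqType).
Implicit Types (F G : seq S).

Lemma sum_sub (V : nmodType) F G (f : S -> V) : uniq F -> uniq G -> {subset F <= G} ->
  \sum_(s <- G) f s = \sum_(s <- F) f s + \sum_(s <- G | s \notin F) f s.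
Proof.
move=> uF uG FG; rewrite (bigID (mem F)) /=; congr (_ + _).
rewrite -big_filter; apply: perm_big; apply: uniq_perm => //; first exact: filter_uniq.
by move=> s; rewrite mem_filter; case sF: (s \in F) => //=; rewrite FG.
Qed.

Lemma sum_subset_le F G (f : S -> R) : uniq F -> uniq G -> {subset F <= G} ->
  (forall s, 0 <= f s) -> \sum_(s <- F) f s <= \sum_(s <- G) f s.
Proof.
by move=> uF uG FG f0; rewrite (sum_sub _ uF uG FG) lerDl sumr_ge0.
Qed.

Lemma small_step (T : eqType) (l : seq T) (P : T -> R -> Prop) :
  (forall x, x \in l -> exists2 h0, 0 < h0 & forall h, 0 < h < h0 -> P x h) ->
  exists2 h0, 0 < h0 & forall h, 0 < h < h0 -> forall x, x \in l -> P x h.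
Proof.
elim: l => [|y l IH] H; first by exists 1.
have [h1 h10 H1] := H y (mem_head _ _).
have [x xl|h2 h20 H2] := IH; first by apply: H; rewrite inE xl orbT.
exists (Num.min h1 h2); first by rewrite lt_min h10.
move=> h /andP[h0]; rewrite lt_min => /andP[hh1 hh2] x; rewrite inE => /orP[/eqP ->|].
  by apply: H1; rewrite h0.
by apply: H2; rewrite h0.
Qed.

End FiniteSums.

Lemma nm_le_reim (R : realType) (z : R[i]) : nm z <= `|complex.Re z| + `|complex.Im z|.
Proof.
case: z => x y /=; rewrite -[X in _ <= X]ger0_norm ?addr_ge0 // -sqrtr_sqr ler_wsqrtr //.
rewrite -(real_normK (num_real x)) -(real_normK (num_real y)).
by have := normr_ge0 x; have := normr_ge0 y; nra.
Qed.

(** * Expectations through finite subsets *)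

Section Expectation.
Variables (R : realType) (S : eqType) (m : S -> R).
Local Notation C := R[i].
Hypothesis m0 : forall s, 0 <= m s.
Hypothesis mle : forall F, uniq F -> \sum_(s <- F) m s <= 1.
Hypothesis mge : forall d : R, 0 < d -> exists2 F, uniq F & 1 - d <= \sum_(s <- F) m s.

(** [v] is the mean of a function bounded by 1, characterised by finite sums whose error is
    controlled by the missing mass. The factor 2 comes from treating real and imaginary parts
    separately in [expect_ex]. *)
Definition expect (f : S -> C) (v : C) := forall F, uniq F ->
  nm (v - \sum_(s <- F) (m s)%:C * f s) <= 2 * (1 - \sum_(s <- F) m s).

(** Finite sums minus the missing mass never exceed finite sums plus the missing mass; the value is
    the supremum of the former. *)
Lemma expect_real (f : S -> R) : (forall s, `|f s| <= 1) ->
  exists v, forall F, uniq F -> `|v - \sum_(s <- F) m s * f s| <= 1 - \sum_(s <- F) m s.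
Proof.
move=> f1.
have cmp F G : uniq F -> uniq G ->
    \sum_(s <- F) m s * f s - (1 - \sum_(s <- F) m s) <=
    \sum_(s <- G) m s * f s + (1 - \sum_(s <- G) m s).
  move=> uF uG; pose H := undup (F ++ G).
  have uH : uniq H := undup_uniq _.
  have FH : {subset F <= H} by move=> s; rewrite mem_undup mem_cat => ->.
  have GH : {subset G <= H} by move=> s; rewrite mem_undup mem_cat orbC => ->.
  have tail K : uniq K -> {subset K <= H} ->
      `|\sum_(s <- H) m s * f s - \sum_(s <- K) m s * f s| <= 1 - \sum_(s <- K) m s.
    move=> uK KH; rewrite (sum_sub _ uK uH KH) addrAC subrr add0r.
    apply: le_trans (ler_norm_sum _ _ _) _.
    have := mle uH; rewrite (sum_sub _ uK uH KH) -lerBrDl => le1.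
    apply: le_trans _ le1; apply: ler_sum => s _.
    by rewrite normrM (ger0_norm (m0 s)) ler_piMr.
  have := tail _ uF FH; have := tail _ uG GH.
  by rewrite !ler_norml => /andP[? ?] /andP[? ?]; lra.
pose A := [set r : R | exists2 F, uniq F & r = \sum_(s <- F) m s * f s - (1 - \sum_(s <- F) m s)].
have ub G : uniq G -> ubound A (\sum_(s <- G) m s * f s + (1 - \sum_(s <- G) m s)).
  by move=> uG _ [F uF ->]; exact: cmp.
have A0 : A !=set0 by eexists; exists [::].
exists (sup A) => F uF; rewrite ler_norml lerBlDr lerBrDr; apply/andP; split; last first.
  by rewrite addrC; apply: ge_sup => //; exact: ub.
rewrite addrC; apply: ub_le_sup; last by exists F.
by eexists; exact: (ub [::]).
Qed.

Lemma expect_ex (f : S -> C) : (forall s, nm (f s) <= 1) -> exists v, expect f v.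
Proof.
move=> f1.
have reim (z : C) : `|complex.Re z| <= nm z /\ `|complex.Im z| <= nm z.
  case: z => x y /=; rewrite -!sqrtr_sqr; split; apply: ler_wsqrtr; rewrite ?lerDl ?lerDr sqr_ge0 //.
have [|u uP] := @expect_real (fun s => complex.Re (f s)).
  by move=> s; apply: le_trans (reim _).1 (f1 s).
have [|v vP] := @expect_real (fun s => complex.Im (f s)).
  by move=> s; apply: le_trans (reim _).2 (f1 s).
exists (u +i* v) => F uF.
have sE : \sum_(s <- F) (m s)%:C * f s =
    (\sum_(s <- F) m s * complex.Re (f s)) +i* (\sum_(s <- F) m s * complex.Im (f s)).
  elim: F {uF} => [|s F IH]; first by rewrite !big_nil.
  by rewrite !big_cons IH; case: (f s) => x y; simpc.
apply: le_trans (nm_le_reim _) _; rewrite sE /=.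
by have := uP F uF; have := vP F uF; lra.
Qed.

Lemma expect_uniq f v v' : expect f v -> expect f v' -> v = v'.
Proof.
move=> ev ev'; apply/eqP; rewrite -subr_eq0 -nm_eq0 eq_le nm_ge0 andbT.
apply/ler_addgt0Pr => e e0; rewrite add0r.
have e40 : 0 < e / 4 by lra.
have [F uF Fe] := mge e40.
have := ev F uF; have := ev' F uF.
have -> : v - v' = (v - \sum_(s <- F) (m s)%:C * f s) - (v' - \sum_(s <- F) (m s)%:C * f s) by ring.
by have := nmB (v - \sum_(s <- F) (m s)%:C * f s) (v' - \sum_(s <- F) (m s)%:C * f s); lra.
Qed.

End Expectation.

(** * Transition functions with bounded exit rates *)

Section Transition.
Variables (R : realType) (S : countType) (rate : S -> S -> R) (Pt : R -> S -> S -> R).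
Hypothesis tf : transition_function rate Pt.
Local Notation C := R[i].
Implicit Types (s r : S) (F G : seq S).

Lemma esum_finite_le (a : S -> R) (v : R) F : (forall s, 0 <= a s) -> uniq F ->
  (\esum_(s in [set: S]) (a s)%:E = v%:E)%E -> \sum_(s <- F) a s <= v.
Proof.
move=> a0 uF e; rewrite -lee_fin -e -sumEFin; apply: esum_ge.
by exists [set` F]; [split=> //; exact: finite_seq | rewrite fsbig_seq].
Qed.

Lemma Pt_sum_le t s F : 0 <= t -> uniq F -> \sum_(r <- F) Pt t s r <= 1.
Proof.
by move=> t0 uF; apply: esum_finite_le => // [r|]; [exact: tf_ge0 tf _ _ _ t0 | exact: tf_sum1 tf _ _ t0].
Qed.

Lemma Pt_sum_ge t s (d : R) : 0 <= t -> 0 < d ->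
  exists2 F, uniq F & 1 - d <= \sum_(r <- F) Pt t s r.
Proof.
move=> t0 d0; have := tf_sum1 tf s t0; rewrite /esum => e.
have : ((1 - d)%:E < ereal_sup [set (\sum_(x \in A) (Pt t s x)%:E)%E | A in fsets [set: S]])%E.
  by rewrite e lte_fin; lra.
move=> /ereal_sup_gt[_ [A [fA _] <-]]; rewrite fsbig_finite //= sumEFin lte_fin => /ltW h.
by exists (finmap.enum_fset (fset_set A)) => //; exact: finmap.fset_uniq.
Qed.

Lemma Pt_chapman_ge t u s s' F : 0 <= t -> 0 <= u -> uniq F ->
  \sum_(r <- F) Pt t s r * Pt u r s' <= Pt (t + u) s s'.
Proof.
move=> t0 u0 uF; apply: esum_finite_le => // [r|].
  by rewrite mulr_ge0 // (tf_ge0 tf).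
by rewrite -(tf_chapman tf).
Qed.

Lemma Pt_rate s s' (e : R) : 0 < e -> exists2 h0, 0 < h0 & forall h, 0 < h < h0 ->
  `|Pt h s s' - (s == s')%:R - h * rate s s'| <= h * e.
Proof.
move=> e0; have := @tf_rate _ _ _ _ tf s s' => /cvgrPdist_le /(_ e e0).
rewrite /at_right near_withinE /prop_near1 /= => -[h0 /= h00 H].
exists h0 => // h /andP[hp hh0].
have := H h; rewrite /ball /= sub0r normrN gtr0_norm // => /(_ hh0 hp).
have -> : Pt h s s' - (s == s')%:R - h * rate s s' =
  - (h * (rate s s' - h^-1 * (Pt h s s' - (s == s')%:R))).
  by field; rewrite gt_eqF.
by rewrite normrN normrM gtr0_norm // ler_pM2l.
Qed.

Variable q : R.
Hypothesis rate_ge : forall s, - q <= rate s s.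

Lemma Pt_le1 t s s' : 0 <= t -> Pt t s s' <= 1.
Proof. by move=> t0; have := @Pt_sum_le t s [:: s'] t0 isT; rewrite big_seq1. Qed.

(** By Chapman-Kolmogorov 1 - P_u(s, s) is subadditive along multiples of u, so the infinitesimal
    bound extends to every h. It is uniform in [s] because the exit rates are bounded. *)
Lemma Pt_diag_ge h s : 0 <= h -> 1 - Pt h s s <= q * h.
Proof.
rewrite le_eqVlt => /orP[/eqP <-|h0]; first by rewrite (tf_start tf) eqxx mulr1n; lra.
have pw (u : R) n : 0 <= u -> 1 - Pt (u *+ n) s s <= n%:R * (1 - Pt u s s).
  move=> u0; elim: n => [|n IH]; first by rewrite mulr0n (tf_start tf) eqxx mulr1n; lra.
  have := @Pt_chapman_ge u (u *+ n) s s [:: s] u0 (mulrn_wge0 n u0) isT.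
  rewrite big_seq1 -mulrS => ch.
  have a1 := Pt_le1 s s u0; have b1 := Pt_le1 s s (mulrn_wge0 n u0).
  have a0 := tf_ge0 tf s s u0.
  have : 0 <= (1 - Pt u s s) * (1 - Pt (u *+ n) s s) by rewrite mulr_ge0 ?subr_ge0.
  by rewrite -natr1 mulrDl mul1r; lra.
apply/ler_addgt0Pr => e e0.
have [h1 h10 H] := Pt_rate s s (divr_gt0 e0 h0).
have [n nP] : exists n : nat, h / h1 < n.+1%:R.
  exists (Num.truncn (h / h1)); have := @truncnS_gt _ (h / h1) => //.
have n0 : 0 < n.+1%:R :> R by rewrite ltr0n.
have u0 : 0 < h / n.+1%:R by rewrite divr_gt0.
have := H (h / n.+1%:R); rewrite u0 ltr_pdivrMr // -ltr_pdivrMl // [h1^-1 * h]mulrC nP => /(_ isT).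
rewrite eqxx mulr1n ler_norml => /andP[lo _].
have hn : (h / n.+1%:R) *+ n.+1 = h by rewrite -mulr_natr divfK // gt_eqF.
have := pw (h / n.+1%:R) n.+1 (ltW u0); rewrite hn => le.
apply: le_trans le _; rewrite mulrC -ler_pdivlMr //.
have := rate_ge s; move: lo; set v := h / _; set p := Pt _ _ _ => lo rq.
have -> : (q * h + e) / n.+1%:R = v * q + v * (e / h) by rewrite /v; field; rewrite !gt_eqF.
have : v * - q <= v * rate s s by rewrite ler_pM2l.
lra.
Qed.

Variable succ : S -> seq S.
Hypothesis succ_uniq : forall s, uniq (s :: succ s).
Hypothesis rate_sum0 : forall s, \sum_(r <- s :: succ s) rate s r = 0.
Hypothesis q0 : 0 <= q.
Variables (s0 : S) (f : S -> C).
Hypothesis f1 : forall s, nm (f s) <= 1.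
Local Notation m t := (Pt t s0).

Lemma nm_sum_le (F : seq S) (P : pred S) (a : S -> R) : (forall s, 0 <= a s) ->
  nm (\sum_(s <- F | P s) (a s)%:C * f s) <= \sum_(s <- F | P s) a s.
Proof.
move=> a0; apply: le_trans (nm_sum _ _ _) _; apply: ler_sum => s _.
by rewrite nmM nmC // ler_piMr.
Qed.

(** From states of [F] the transitions to listed successors are kept; from all other states only the
    bound q h on the probability of leaving is used. Sums are compared over a finite [G] containing
    [F], its successors and almost all the mass at both times. *)
Lemma expect_step F t h v v' : 0 <= t -> 0 <= h -> uniq F ->
  expect (m t) f v -> expect (m (t + h)) f v' ->
  nm (v' - v - \sum_(s <- F) (m t s)%:C *
      (\sum_(r <- s :: succ s) (Pt h s r)%:C * f r - f s)) <=
  2 * (\sum_(s <- F) m t s * (1 - \sum_(r <- s :: succ s) Pt h s r)) +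
  3 * (q * h) * (1 - \sum_(s <- F) m t s).
Proof.
move=> t0 h0 uF ev ev'; apply/ler_addgt0Pr => e e0.
have th0 : 0 <= t + h by rewrite addr_ge0.
have e50 : 0 < e / 5 by lra.
have [G0 uG0 G0e] := Pt_sum_ge s0 t0 e50.
have [G1 uG1 G1e] := Pt_sum_ge s0 th0 e50.
pose G := undup (F ++ flatten [seq s :: succ s | s <- F] ++ G0 ++ G1).
have uG : uniq G := undup_uniq _.
have FG : {subset F <= G} by move=> s; rewrite mem_undup mem_cat => ->.
have G0G : {subset G0 <= G} by move=> s sG; rewrite mem_undup !mem_cat sG !orbT.
have G1G : {subset G1 <= G} by move=> s sG; rewrite mem_undup !mem_cat sG !orbT.
have sG s : s \in F -> {subset s :: succ s <= G}.
  move=> sF r rs; rewrite mem_undup !mem_cat; apply/or3P/Or32.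
  by apply/flattenP; exists (s :: succ s) => //; exact: map_f.
have m0 s : 0 <= m t s by exact: (tf_ge0 tf).
have m0' s : 0 <= m (t + h) s by exact: (tf_ge0 tf).
have P0 s r : 0 <= Pt h s r by exact: (tf_ge0 tf).
have mG : 1 - e / 5 <= \sum_(s <- G) m t s by apply: le_trans G0e _; exact: sum_subset_le.
have mG' : 1 - e / 5 <= \sum_(s <- G) m (t + h) s by apply: le_trans G1e _; exact: sum_subset_le.
pose n r := \sum_(s <- G) m t s * Pt h s r.
have nle r : n r <= m (t + h) r by exact: Pt_chapman_ge.
pose sg s := \sum_(r <- G) Pt h s r.
pose tau s := \sum_(r <- s :: succ s) Pt h s r.
pose bt s := \sum_(r <- G) (Pt h s r)%:C * f r - f s.
pose be s := \sum_(r <- s :: succ s) (Pt h s r)%:C * f r - f s.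
have sg1 s : sg s <= 1 by exact: Pt_sum_le.
(* mass reaching [G] at time [t + h] but not through [G] at time [t] *)
have lost : nm (\sum_(r <- G) (m (t + h) r)%:C * f r - \sum_(r <- G) (n r)%:C * f r) <=
    e / 5 + \sum_(s <- G) m t s * (1 - sg s).
  rewrite -sumrB (eq_bigr (fun r => (m (t + h) r - n r)%:C * f r)); last first.
    by move=> r _; rewrite -mulrBl -rmorphB.
  apply: le_trans (nm_sum_le _ _ _) _; first by move=> r; rewrite subr_ge0.
  rewrite sumrB.
  have -> : \sum_(r <- G) n r = \sum_(s <- G) m t s * sg s.
    by rewrite exchange_big; apply: eq_bigr => s _; rewrite mulr_sumr.
  have -> : \sum_(s <- G) m t s * (1 - sg s) = \sum_(s <- G) m t s - \sum_(s <- G) m t s * sg s.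
    by rewrite -sumrB; apply: eq_bigr => s _; rewrite mulrBr mulr1.
  by have := Pt_sum_le s0 th0 uG; lra.
have moved : \sum_(r <- G) (n r)%:C * f r - \sum_(s <- G) (m t s)%:C * f s =
    \sum_(s <- G) (m t s)%:C * bt s.
  rewrite [RHS](eq_bigr (fun s => \sum_(r <- G) (m t s * Pt h s r)%:C * f r - (m t s)%:C * f s)).
    rewrite sumrB exchange_big; congr (_ - _); apply: eq_bigr => r _ /=.
    by rewrite rmorph_sum mulr_suml.
  move=> s _; rewrite mulrBr mulr_sumr; congr (_ - _); apply: eq_bigr => r _.
  by rewrite rmorphM mulrA.
have diag s : 1 - Pt h s s <= q * h by exact: Pt_diag_ge.
have Pdiag s : s \in G -> sg s = Pt h s s + \sum_(r <- G | r \notin [:: s]) Pt h s r.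
  move=> sG'; rewrite /sg (@sum_sub _ _ [:: s] G) ?big_seq1 //.
  by move=> r; rewrite inE => /eqP ->.
have inF s : s \in F -> nm (bt s - be s) + (1 - sg s) <= 2 * (1 - tau s).
  move=> sF; have e1 : bt s - be s = \sum_(r <- G | r \notin s :: succ s) (Pt h s r)%:C * f r.
    by rewrite /bt /be (sum_sub _ (succ_uniq s) uG (sG s sF)); ring.
  have e2 : sg s = tau s + \sum_(r <- G | r \notin s :: succ s) Pt h s r.
    exact: (sum_sub _ (succ_uniq s) uG (sG s sF)).
  have := @nm_sum_le G (fun r => r \notin s :: succ s) _ (P0 s).
  rewrite -e1; have := sg1 s.
  have : 0 <= \sum_(r <- G | r \notin s :: succ s) Pt h s r by rewrite sumr_ge0.
  by lra.
have outF s : s \in G -> nm (bt s) + (1 - sg s) <= 3 * (q * h).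
  move=> sG'; have e1 : bt s = (Pt h s s - 1)%:C * f s
      + \sum_(r <- G | r \notin [:: s]) (Pt h s r)%:C * f r.
    rewrite /bt (@sum_sub _ _ [:: s] G) ?big_seq1 //; first by rewrite rmorphB rmorph1; ring.
    by move=> r; rewrite inE => /eqP ->.
  have := nmD ((Pt h s s - 1)%:C * f s) (\sum_(r <- G | r \notin [:: s]) (Pt h s r)%:C * f r).
  rewrite -e1; have := @nm_sum_le G (fun r => r \notin [:: s]) _ (P0 s).
  have : nm ((Pt h s s - 1)%:C * f s) <= 1 - Pt h s s.
    have le1 := Pt_le1 s s h0.
    rewrite -nmN -mulNr -rmorphN opprB nmM nmC ?subr_ge0 //.
    by rewrite ler_piMr // subr_ge0.
  have := sg1 s; have := Pdiag s sG'; have := diag s.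
  have : 0 <= \sum_(r <- G | r \notin [:: s]) Pt h s r by rewrite sumr_ge0.
  by lra.
have -> : v' - v - \sum_(s <- F) (m t s)%:C * be s =
  (v' - \sum_(r <- G) (m (t + h) r)%:C * f r) - (v - \sum_(s <- G) (m t s)%:C * f s)
  + (\sum_(r <- G) (m (t + h) r)%:C * f r - \sum_(r <- G) (n r)%:C * f r)
  + (\sum_(s <- F) (m t s)%:C * (bt s - be s) + \sum_(s <- G | s \notin F) (m t s)%:C * bt s).
  have -> : \sum_(s <- F) (m t s)%:C * (bt s - be s) =
      \sum_(s <- F) (m t s)%:C * bt s - \sum_(s <- F) (m t s)%:C * be s.
    by rewrite -sumrB; apply: eq_bigr => s _; rewrite mulrBr.
  have := sum_sub (fun s => (m t s)%:C * bt s) uF uG FG; rewrite -moved => sE.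
  move: sE; set a1 := \sum_(r <- G) (n r)%:C * f r; set a2 := \sum_(s <- G) (m t s)%:C * f s.
  set a3 := \sum_(s <- F) (m t s)%:C * bt s; set a4 := \sum_(s <- G | s \notin F) _ => sE.
  have -> : a4 = a1 - a2 - a3 by rewrite sE; ring.
  by ring.
apply: le_trans (nmD _ _) _; apply: le_trans (lerD (nmD _ _) (nmD _ _)) _.
apply: le_trans (lerD (lerD (nmB _ _) (le_refl _)) (le_refl _)) _.
have h1 := ev G uG; have h2 := ev' G uG.
have h3 : nm (\sum_(s <- F) (m t s)%:C * (bt s - be s)) <= \sum_(s <- F) m t s * nm (bt s - be s).
  by apply: le_trans (nm_sum _ _ _) _; apply: ler_sum => s _; rewrite nmM nmC.
have h4 : nm (\sum_(s <- G | s \notin F) (m t s)%:C * bt s) <= \sum_(s <- G | s \notin F) m t s * nm (bt s).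
  by apply: le_trans (nm_sum _ _ _) _; apply: ler_sum => s _; rewrite nmM nmC.
have h5 : \sum_(s <- F) m t s * nm (bt s - be s) + \sum_(s <- F) m t s * (1 - sg s) <=
    2 * (\sum_(s <- F) m t s * (1 - tau s)).
  rewrite -big_split mulr_sumr big_seq [X in _ <= X]big_seq /=; apply: ler_sum => s sF.
  by rewrite -mulrDr mulrCA ler_wpM2l // inF.
have h6 : \sum_(s <- G | s \notin F) m t s * nm (bt s) +
    \sum_(s <- G | s \notin F) m t s * (1 - sg s) <= 3 * (q * h) * (1 - \sum_(s <- F) m t s).
  have : \sum_(s <- G | s \notin F) m t s <= 1 - \sum_(s <- F) m t s.
    by rewrite lerBrDl -(sum_sub _ uF uG FG) Pt_sum_le.
  move/(ler_wpM2l (_ : 0 <= 3 * (q * h))) => H; apply: le_trans _ (H _); last first.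
    by rewrite !mulr_ge0.
  rewrite -big_split mulr_sumr big_seq_cond [X in _ <= X]big_seq_cond /=; apply: ler_sum => s /andP[sG' _].
  by rewrite -mulrDr [X in _ <= X]mulrC ler_wpM2l // outF.
have h7 := sum_sub (fun s => m t s * (1 - sg s)) uF uG FG.
by move: lost; rewrite h7; lra.
Qed.

Lemma expect_lipschitz t h v v' : 0 <= t -> 0 <= h ->
  expect (m t) f v -> expect (m (t + h)) f v' -> nm (v' - v) <= 3 * q * h.
Proof.
move=> t0 h0 ev ev'; have := @expect_step [::] t h v v' t0 h0 isT ev ev'.
by rewrite !big_nil; rewrite !subr0 mulr0 add0r mulr1 mulrA.
Qed.

Definition drift s : C := \sum_(r <- s :: succ s) (rate s r)%:C * f r.

(** The rate expansion is uniform over the finitely many transitions from [F]; the mass outside [F]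
    is estimated by its exit rate alone. *)
Lemma expect_deriv F t d : 0 <= t -> uniq F -> 0 < d ->
  exists2 h0, 0 < h0 & forall h, 0 < h < h0 -> forall v v',
  expect (m t) f v -> expect (m (t + h)) f v' ->
  nm (v' - v - h%:C * \sum_(s <- F) (m t s)%:C * drift s) <=
    h * (d + 3 * q * (1 - \sum_(s <- F) m t s)).
Proof.
move=> t0 uF d0.
pose n s : R := (size (s :: succ s))%:R.
pose M := \sum_(s <- F) n s.
have M0 : 0 <= M by rewrite sumr_ge0.
pose e := d / (3 * M + 1).
have e0 : 0 < e by rewrite divr_gt0 //; lra.
have [h0 h00 H] := @small_step R S F
  (fun s h => forall r, r \in s :: succ s -> `|Pt h s r - (s == r)%:R - h * rate s r| <= h * e)
  (fun s _ => @small_step R S (s :: succ s) _ (fun r _ => Pt_rate s r e0)).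
exists h0 => // h hh v v' ev ev'; have /andP[hp _] := hh.
have m0 s : 0 <= m t s by exact: (tf_ge0 tf).
have m1 s : m t s <= 1 by exact: Pt_le1.
have := @expect_step F t h v v' t0 (ltW hp) uF ev ev'.
set A := \sum_(s <- F) _ * (_ - f s); set B := \sum_(s <- F) m t s * _ => le.
have nsucc s r : r \in succ s -> s != r.
  by move=> rs; apply: contraTneq rs => <-; have /andP[] := succ_uniq s.
have delta s (g : S -> C) : \sum_(r <- s :: succ s) (s == r)%:R * g r = g s.
  rewrite big_cons eqxx mul1r big_seq big1 ?addr0 // => r rs.
  by rewrite (negbTE (nsucc s r rs)) mul0r.
have deltaR s : \sum_(r <- s :: succ s) (s == r)%:R = 1 :> R.
  rewrite big_cons eqxx big_seq big1 ?addr0 // => r rs.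
  by rewrite (negbTE (nsucc s r rs)).
have sumle s : s \in F -> \sum_(r <- s :: succ s) `|Pt h s r - (s == r)%:R - h * rate s r| <= n s * (h * e).
  move=> sF; rewrite big_seq; apply: le_trans (ler_sum _ _) _.
    by move=> r rs; exact: (H h hh s sF r rs).
  rewrite -big_seq big_const_seq count_predT iter_addr addr0 /n mulr_natl //.
have hA : nm (A - h%:C * \sum_(s <- F) (m t s)%:C * drift s) <= M * (h * e).
  rewrite mulr_sumr -sumrB /M mulr_suml; apply: le_trans (nm_sum _ _ _) _.
  rewrite big_seq [X in _ <= X]big_seq; apply: ler_sum => s sF.
  have -> : (m t s)%:C * (\sum_(r <- s :: succ s) (Pt h s r)%:C * f r - f s)
      - h%:C * ((m t s)%:C * drift s) =
      (m t s)%:C * \sum_(r <- s :: succ s) (Pt h s r - (s == r)%:R - h * rate s r)%:C * f r.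
    rewrite mulrCA -mulrBr; congr (_ * _); rewrite /drift mulr_sumr -[in LHS](delta s f) -!sumrB.
    apply: eq_bigr => r _; rewrite !rmorphB rmorphM /= rmorph_nat; ring.
  rewrite nmM nmC //; apply: le_trans (_ : _ <= 1 * (n s * (h * e))) _; last by rewrite mul1r.
  apply: ler_pM => //; first exact: nm_ge0.
  apply: le_trans (nm_sum _ _ _) _; apply: le_trans _ (sumle s sF); apply: ler_sum => r _.
  by rewrite nmM -[X in _ <= X]mulr1 ler_pM ?nm_ge0 // -lecR -normCE normc_def /= expr0n addr0 sqrtr_sqr.
have hB : B <= M * (h * e).
  rewrite /B /M mulr_suml big_seq [X in _ <= X]big_seq; apply: ler_sum => s sF.
  have -> : 1 - \sum_(r <- s :: succ s) Pt h s r =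
      - \sum_(r <- s :: succ s) (Pt h s r - (s == r)%:R - h * rate s r).
    by rewrite !sumrB deltaR -mulr_sumr rate_sum0; ring.
  apply: le_trans (ler_norm _) _; rewrite normrM ger0_norm // normrN.
  apply: le_trans (_ : _ <= 1 * (n s * (h * e))) _; last by rewrite mul1r.
  apply: ler_pM => //; exact: le_trans (ler_norm_sum _ _ _) (sumle s sF).
have Mh : 3 * (M * (h * e)) <= h * d.
  have : e * (3 * M + 1) = d by rewrite /e divfK // gt_eqF //; lra.
  by move=> ed; rewrite -ed; have : 0 < h * e by [rewrite mulr_gt0]; nra.
set D := h%:C * _ in hA *.
have -> : v' - v - D = (v' - v - A) + (A - D) by ring.
apply: le_trans (nmD _ _) _; lra.
Qed.

End Transition.

Lemma sum_flips (R : realType) (S : eqType) (N : nat) (l : seq S) (s : S) (A B : 'I_N -> S)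
    (p q : R) (g : S -> R[i]) :
  uniq l -> s \in l -> (forall i, A i \in l) -> (forall i, B i \in l) ->
  \sum_(r <- l) (\sum_(i < N) (p * ((A i == r)%:R - (s == r)%:R) +
    q * ((B i == r)%:R - (s == r)%:R)))%:C * g r =
  \sum_(i < N) (p%:C * (g (A i) - g s) + q%:C * (g (B i) - g s)).
Proof.
move=> ul sl Al Bl.
have pick a : a \in l -> \sum_(r <- l) (a == r)%:R * g r = g a.
  move=> aI; rewrite (bigD1_seq a) //= eqxx mul1r big1 ?addr0 // => r /negbTE ra.
  by rewrite eq_sym ra mul0r.
transitivity (\sum_(i < N) \sum_(r <- l)
    (p%:C * ((A i == r)%:R * g r - (s == r)%:R * g r) +
     q%:C * ((B i == r)%:R * g r - (s == r)%:R * g r))).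
  rewrite exchange_big; apply: eq_bigr => r _ /=.
  rewrite rmorph_sum mulr_suml; apply: eq_bigr => i _.
  have bC (b : bool) : (b%:R : R)%:C = b%:R :> R[i] by case: b.
  move: (g r) (A i == r) (B i == r) (s == r) => a b1 b2 b3.
  by rewrite rmorphD /= 2!rmorphM /= 2!rmorphB /= !bC; ring.
apply: eq_bigr => i _; rewrite big_split /=; congr (_ + _); rewrite -mulr_sumr sumrB.
  by rewrite !pick.
by rewrite !pick.
Qed.

(** * The generating series of the total current *)

Section Currents.
Variables (R : realType) (L N : nat) (p q : R) (zeta : R[i]).
Hypothesis (p0 : 0 <= p) (q0 : 0 <= q) (pq : p + q = 1) (zeta1 : nm zeta = 1).
Local Notation C := R[i].
Implicit Types (s r : state L N) (x y : config L N) (i : 'I_N).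

(** Suppressed jumps return [s] itself, and on a full ring all particles push to the same state;
    hence the filter and the removal of duplicates. *)
Definition jumps s : seq (state L N) :=
  [seq r <- undup ([seq right_jump i s | i <- enum 'I_N] ++ [seq left_push i s | i <- enum 'I_N])
     | r != s].

Lemma jumps_uniq s : uniq (s :: jumps s).
Proof. by rewrite /= mem_filter eqxx /= filter_uniq // undup_uniq. Qed.

Lemma right_jump_in i s : right_jump i s \in s :: jumps s.
Proof.
rewrite inE mem_filter mem_undup mem_cat (map_f (right_jump^~ s)) ?mem_enum //= andbT.
by case: eqP.
Qed.

Lemma left_push_in i s : left_push i s \in s :: jumps s.
Proof.
rewrite inE mem_filter mem_undup mem_cat (map_f (left_push^~ s)) ?mem_enum // orbT andbT.
by case: eqP.
Qed.

Lemma sum_rate s (g : state L N -> C) :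
  \sum_(r <- s :: jumps s) (pushASEP_rate p q s r)%:C * g r =
  \sum_(i < N) (p%:C * (g (right_jump i s) - g s) + q%:C * (g (left_push i s) - g s)).
Proof.
apply: sum_flips; rewrite ?jumps_uniq ?mem_head //.
- by move=> i; exact: right_jump_in.
- by move=> i; exact: left_push_in.
Qed.

Lemma rate_sum0 s : \sum_(r <- s :: jumps s) pushASEP_rate p q s r = 0.
Proof.
apply: complexI; rewrite rmorph_sum rmorph0 /=.
transitivity (\sum_(r <- s :: jumps s) (pushASEP_rate p q s r)%:C * 1).
  by apply: eq_bigr => r _; rewrite mulr1.
by rewrite (sum_rate s (fun=> 1)) big1 // => i _; rewrite subrr !mulr0 addr0.
Qed.

Lemma rate_ge s : - N%:R <= pushASEP_rate p q s s.
Proof.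
rewrite -[N in - N%:R]card_ord -sumr_const -sumrN; apply: ler_sum => i _.
have b (c : bool) : 0 <= (c%:R : R) <= 1 by rewrite ler0n lern1; case: c.
rewrite eqxx; move: (right_jump i s == s) (left_push i s == s) => b1 b2.
have /andP[b10 _] := b b1; have /andP[b20 _] := b b2.
have := mulr_ge0 p0 b10; have := mulr_ge0 q0 b20; move: pq; rewrite mulr1n; lra.
Qed.

(** Its mean at time t is the generating series of the total current at configuration [x]. *)
Definition twist x s : C := zeta ^ total_current s.2 * (s.1 == x)%:R.

Let z0 : zeta != 0. Proof. by rewrite -nm_eq0 zeta1 oner_eq0. Qed.

Lemma nm_expz (k : int) : nm (zeta ^ k) = 1.
Proof.
by case: k => n; rewrite ?NegzE ?exprnN ?nmV nmX zeta1 expr1n ?invr1.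
Qed.

Lemma twist_le1 x s : nm (twist x s) <= 1.
Proof. by rewrite /twist nmM nm_expz mul1r; case: eqP; rewrite ?nm1 ?nm0. Qed.

Lemma current_right s i : total_current [ffun x => s.2 x + (x == pos s.1 i)%:Z] = total_current s.2 + 1.
Proof.
rewrite /total_current; under eq_bigr do rewrite ffunE.
rewrite big_split /=; congr (_ + _); rewrite (bigD1 (pos s.1 i)) //= eqxx big1 ?addr0 //.
by move=> x /negbTE ->.
Qed.

Lemma current_left s i : total_current
    [ffun x => s.2 x - #|[set j in pushed s.1 i | ord_pred (pos s.1 j) == x]|%:Z] =
  total_current s.2 - #|pushed s.1 i|%:Z.
Proof.
rewrite /total_current; under eq_bigr do rewrite ffunE.
rewrite sumrB; congr (_ - _).
rewrite -(big_morph Posz PoszD (erefl _)); congr Posz.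
rewrite -sum1_card (partition_big (fun j => ord_pred (pos s.1 j)) xpredT) //=.
by apply: eq_bigr => x _; rewrite -sum1dep_card.
Qed.

Lemma twist_drift x s :
  drift (pushASEP_rate p q) jumps (twist x) s =
  zeta ^ total_current s.2 * jump_kernel p q zeta s.1 x.
Proof.
rewrite /drift sum_rate big_split /= -!mulr_sumr /jump_kernel mulrDr ![_ ^ _ * (_ * _)]mulrCA.
congr (_ * _ + _ * _); rewrite mulr_sumr; apply: eq_bigr => i _.
  rewrite /right_jump; case: displace => [X|] /=; last by rewrite subrr mulr0.
  by rewrite /twist /= current_right expfzDr // expr1z; ring.
rewrite /left_push; case: displace (@displace_pushed _ _ s.1 i) => [X|//] _ /=.
by rewrite /twist /= current_left expfzDr // exprnN; ring.
Qed.

Lemma twist_sum (a : config L N -> C) s : \sum_y twist y s * a y = zeta ^ total_current s.2 * a s.1.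
Proof.
rewrite (bigD1 s.1) //= /twist eqxx mulr1 big1 ?addr0 // => y /negbTE ys.
by rewrite eq_sym ys mulr0 mul0r.
Qed.

Variable Pt : R -> state L N -> state L N -> R.
Hypothesis tf : transition_function (pushASEP_rate p q) Pt.
Variables (s0 : state L N) (g : config L N -> R -> C).
Hypothesis gP : forall x t, 0 <= t -> expect (Pt t s0) (twist x) (g x t).

Lemma twist_lipschitz x t h : 0 <= t -> 0 <= h -> nm (g x (t + h) - g x t) <= 3 * N%:R * h.
Proof.
move=> t0 h0.
apply: (expect_lipschitz tf rate_ge jumps_uniq (ler0n _ _) (twist_le1 x) t0 h0 (gP x t0)).
by apply: gP; rewrite addr_ge0.
Qed.

(** The drift of [twist x] is a finite combination of the functions [twist y], so the sum over [F]
    in [expect_deriv] approximates the generator applied to their means. *)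
Lemma twist_forward x t d : 0 <= t -> 0 < d -> exists2 h0, 0 < h0 & forall h, 0 < h < h0 ->
  nm (g x (t + h) - g x t - h%:C * generator p q zeta (g^~ t) x) <= h * d.
Proof.
move=> t0 d0.
pose K := \sum_y nm (jump_kernel p q zeta y x).
have K0 : 0 <= K by rewrite sumr_ge0 // => y _; exact: nm_ge0.
(* 3N pays for the mass outside [F], 2K for replacing partial sums by means; together they use half
   of [d]. *)
pose e := d / (2 * (3 * N%:R + 2 * K + 1)).
have D0 : 0 < 3 * N%:R + 2 * K + 1 by have := ler0n R N; lra.
have e0 : 0 < e by rewrite divr_gt0 // mulr_gt0.
have [F uF Fe] := Pt_sum_ge tf s0 t0 e0.
have d20 : 0 < d / 2 by lra.
have [h0 h00 H] := expect_deriv tf rate_ge jumps_uniq rate_sum0 (ler0n _ _) s0 (twist_le1 x) t0 uF d20.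
exists h0 => // h hh; have /andP[hp _] := hh.
have := H h hh _ _ (gP x t0) (gP x (addr_ge0 t0 (ltW hp))).
set A := \sum_(s <- F) _ * _ => le.
have AE : A = \sum_y (\sum_(s <- F) (Pt t s0 s)%:C * twist y s) * jump_kernel p q zeta y x.
  under [RHS]eq_bigr do rewrite mulr_suml.
  rewrite exchange_big; apply: eq_bigr => s _ /=; rewrite twist_drift -(twist_sum (fun y => jump_kernel p q zeta y x)) mulr_sumr.
  by apply: eq_bigr => y _; rewrite mulrA.
have close : nm (A - generator p q zeta (g^~ t) x) <= 2 * e * K.
  rewrite -generator_adjoint AE -sumrB /K mulr_sumr; apply: le_trans (nm_sum _ _ _) _.
  apply: ler_sum => y _; rewrite -mulrBl nmM ler_wpM2r ?nm_ge0 //.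
  by rewrite nm_distC; apply: le_trans (gP y t0 uF) _; lra.
set G := generator _ _ _ _ _ in close *.
have -> : g x (t + h) - g x t - h%:C * G = (g x (t + h) - g x t - h%:C * A) + h%:C * (A - G) by ring.
apply: le_trans (nmD _ _) _; apply: le_trans (lerD le (le_refl _)) _.
rewrite nmM (nmC (ltW hp)).
have eE : e * (3 * N%:R + 2 * K + 1) = d / 2 by rewrite /e; field; rewrite gt_eqF.
have tail : 3 * N%:R * (1 - \sum_(s <- F) Pt t s0 s) <= 3 * N%:R * e.
  by rewrite ler_wpM2l ?mulr_ge0 //; lra.
have total : d / 2 + 3 * N%:R * (1 - \sum_(s <- F) Pt t s0 s) + nm (A - G) <= d by lra.
by apply: le_trans _ (ler_wpM2l (ltW hp) total); rewrite [X in _ <= X]mulrDr.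
Qed.

End Currents.

(** Only right derivatives are controlled, so the bound d exp((K + 1) t) is followed up to the
    supremum of the times until which it holds: the left hypothesis carries it to the supremum, the
    right one beyond. The extra 1 in K + 1 absorbs [d]. *)
Lemma gronwall_right (R : realType) (psi : R -> R) (K : R) : 0 <= K -> psi 0 = 0 ->
  (forall t d, 0 <= t -> 0 < d -> exists2 h0, 0 < h0 & forall h, 0 < h < h0 ->
     psi (t + h) <= psi t + h * (K * psi t + d)) ->
  (forall t d, 0 < t -> 0 < d -> exists2 h0, 0 < h0 & forall h, 0 < h < h0 -> h <= t ->
     psi t <= psi (t - h) + d) ->
  forall t, 0 <= t -> psi t <= 0.
Proof.
move=> K0 p0 right left t t0; apply/ler_addgt0Pr => e e0; rewrite add0r.
pose M := expR ((K + 1) * t); have M0 : 0 < M := expR_gt0 _.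
pose d := e / M; have d0 : 0 < d by rewrite divr_gt0.
pose c s := d * expR ((K + 1) * s).
have cm s s' : s <= s' -> c s <= c s'.
  by move=> ss; rewrite ler_pM2l // ler_expR ler_wpM2l //; lra.
have cd s : 0 <= s -> d <= c s.
  by move=> s_0; have := cm 0 s s_0; rewrite /c mulr0 expR0 mulr1.
pose A := [set a : R | 0 <= a <= t /\ forall s, 0 <= s <= a -> psi s <= c s].
have A0 : A 0.
  split; first by rewrite lexx.
  move=> s /andP[s1 s2]; have -> : s = 0 by lra.
  by rewrite p0; apply: le_trans (ltW d0) (cd 0 (lexx _)).
have At : ubound A t by move=> a [/andP[]].
have Asup : has_sup A by split; [exists 0 | exists t].
pose a := sup A.
have a0 : 0 <= a by apply: ub_le_sup => //; exists t.
have at' : a <= t by apply: ge_sup => //; exists 0.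
have below s : 0 <= s -> s < a -> psi s <= c s.
  move=> s_0 sa; have sa0 : 0 < a - s by lra.
  have [b [_ bP] sb] := sup_adherent sa0 Asup.
  by apply: bP; rewrite s_0 /=; move: sb; rewrite -/a; lra.
have pa : psi a <= c a.
  have [a00|an0] := eqVneq a 0; first by rewrite a00; case: A0 => _; apply; rewrite lexx.
  have ap : 0 < a by rewrite lt_def an0.
  apply/ler_addgt0Pr => e' e'0; have [h0 h00 H] := left a e' ap e'0.
  pose h := Num.min (h0 / 2) a.
  have hp : 0 < h by rewrite lt_min ap andbT; lra.
  have hh : h <= h0 / 2 by rewrite ge_min lexx.
  have ha : h <= a by rewrite ge_min lexx orbT.
  apply: le_trans (H h _ ha) _; first by rewrite hp /=; lra.
  rewrite lerD2r; apply: le_trans (below _ _ _) (cm _ _ _); lra.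
have aA : A a.
  split; first by rewrite a0.
  move=> s /andP[s_0]; rewrite le_eqVlt => /orP[/eqP -> //|]; exact: below.
suff at_ : a = t.
  apply: le_trans (_ : _ <= c t) _; first by rewrite -at_.
  by rewrite /c /d divfK // gt_eqF.
apply/eqP; rewrite eq_le at' /= leNgt; apply/negP => ltat.
have [h0 h00 H] := right a d a0 d0.
pose h1 := Num.min h0 (t - a).
have h10 : 0 < h1 by rewrite lt_min h00; lra.
have h1h : h1 <= h0 by rewrite ge_min lexx.
have h1t : h1 <= t - a by rewrite ge_min lexx orbT.
suff : A (a + h1 / 2) by move=> /(ub_le_sup (ex_intro _ t At)); rewrite -/a; lra.
split; first by apply/andP; split; lra.
move=> s /andP[s_0 sa]; have [lesa|ltas] := leP s a; first by apply aA.2; rewrite s_0.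
pose h := s - a; have hp : 0 < h by rewrite /h; lra.
have -> : s = a + h by rewrite /h; ring.
apply: le_trans (H h _) _; first by rewrite hp /h /=; lra.
apply: le_trans (_ : _ <= c a * (1 + (K + 1) * h)) _; last first.
  have -> : c (a + h) = c a * expR ((K + 1) * h).
    by rewrite /c [(K + 1) * (a + h)]mulrDr expRD mulrA.
  rewrite ler_pM2l ?expR_ge1Dx //; exact: lt_le_trans d0 (cd a a0).
have := ler_wpM2l (ltW hp) (lerD (ler_wpM2l K0 pa) (cd a a0)).
by move: pa; set x := c a; lra.
Qed.

(** * The complex exponential near 0 *)

Section ComplexExponential.
Variable R : realType.
Local Notation C := R[i].

Lemma cexpD (x y : C) : cexp (x + y) = cexp x * cexp y.
Proof.
case: x y => a b [c d]; rewrite /cexp /= expRD cosD sinD; simpc.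
by congr (_ +i* _); ring.
Qed.

Lemma cexp0 : cexp (0 : C) = 1.
Proof. by rewrite /cexp /= expR0 cos0 sin0; simpc. Qed.

Lemma nm_cexp (z : C) : nm (cexp z) = expR (complex.Re z).
Proof.
rewrite /cexp nmM nmC ?expR_ge0 // /= cos2Dsin2 sqrtr1 mulr1 //.
Qed.

Lemma deriv_near0 (f : R -> R) (a d : R) : is_derive (0 : R) 1 f a -> 0 < d ->
  exists2 h0, 0 < h0 & forall h, 0 < h < h0 -> `|f h - f 0 - h * a| <= h * d.
Proof.
move=> [/cvgP df fa] d0; move: df; rewrite -[lim _]/('D_1 f 0) fa => /cvgrPdist_le/(_ d d0).
rewrite /prop_near1 /= => -[h0 /= h00 H].
exists h0 => // h /andP[hp hh0].
have := H h; rewrite /ball_ /= sub0r normrN gtr0_norm // gt_eqF // => /(_ hh0 isT).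
rewrite /GRing.scale /= mulr1 addr0 => le.
have -> : f h - f 0 - h * a = - (h * (a - h^-1 * (f h - f 0))) by field; rewrite gt_eqF.
by rewrite normrN normrM gtr0_norm // ler_pM2l.
Qed.

Lemma cexp_near0 (E : C) (d : R) : 0 < d -> exists2 h0, 0 < h0 & forall h, 0 < h < h0 ->
  nm (cexp (h%:C * E) - 1 - h%:C * E) <= h * d.
Proof.
case: E => a b d0; have d20 : 0 < d / 2 by lra.
have [h1 h10 H1] : exists2 h0, 0 < h0 & forall h, 0 < h < h0 ->
    `|expR (h * a) * cos (h * b) - expR (0 * a) * cos (0 * b) - h * a| <= h * (d / 2).
  apply: (@deriv_near0 (fun h => expR (h * a) * cos (h * b))) => //.
  by apply: is_derive_eq; rewrite /GRing.scale /= !mul0r expR0 cos0 sin0; ring.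
have [h2 h20 H2] : exists2 h0, 0 < h0 & forall h, 0 < h < h0 ->
    `|expR (h * a) * sin (h * b) - expR (0 * a) * sin (0 * b) - h * b| <= h * (d / 2).
  apply: (@deriv_near0 (fun h => expR (h * a) * sin (h * b))) => //.
  by apply: is_derive_eq; rewrite /GRing.scale /= !mul0r expR0 cos0 sin0; ring.
exists (Num.min h1 h2); first by rewrite lt_min h10.
move=> h /andP[hp]; rewrite lt_min => /andP[hh1 hh2].
have := H1 h; have := H2 h; rewrite hp hh1 hh2 !mul0r expR0 cos0 sin0 !mulr1 !mulr0 !subr0 => /(_ isT) B2 /(_ isT) B1.
apply: le_trans (nm_le_reim _) _.
have -> : cexp (h%:C * (a +i* b)) - 1 - h%:C * (a +i* b) =
    (expR (h * a) * cos (h * b) - 1 - h * a) +i* (expR (h * a) * sin (h * b) - h * b).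
  by rewrite /cexp; simpc; congr (_ +i* _); ring.
by rewrite /=; lra.
Qed.

End ComplexExponential.

(** * Uniqueness for the forward equation *)

Section Uniqueness.
Variables (R : realType) (L N : nat) (p q : R) (zeta : R[i]).
Local Notation C := R[i].
Implicit Types (x y : config L N).
Variables (I : finType) (c E : I -> C) (u : I -> config L N -> C).
Hypothesis eigen : forall r x, generator p q zeta (u r) x = E r * u r x.

Definition modes x (t : R) : C := \sum_r c r * u r x * cexp (t%:C * E r).

Lemma modes_generator x t :
  generator p q zeta (modes^~ t) x = \sum_r E r * (c r * u r x * cexp (t%:C * E r)).
Proof.
rewrite -generator_adjoint; under eq_bigr do rewrite /modes mulr_suml.
rewrite exchange_big; apply: eq_bigr => r _ /=.
transitivity (c r * cexp (t%:C * E r) * generator p q zeta (u r) x); last by rewrite eigen; ring.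
by rewrite -generator_adjoint mulr_sumr; apply: eq_bigr => y _; ring.
Qed.

Lemma cexp_step (t h : R) (e : C) : cexp ((t + h)%:C * e) = cexp (t%:C * e) * cexp (h%:C * e).
Proof. by rewrite rmorphD /= mulrDl cexpD. Qed.

Lemma modes_forward x t d : 0 < d -> exists2 h0, 0 < h0 & forall h, 0 < h < h0 ->
  nm (modes x (t + h) - modes x t - h%:C * generator p q zeta (modes^~ t) x) <= h * d.
Proof.
move=> d0; pose M := \sum_r nm (c r * u r x * cexp (t%:C * E r)).
have M0 : 0 <= M by rewrite sumr_ge0 // => r _; exact: nm_ge0.
have e0 : 0 < d / (M + 1) by rewrite divr_gt0 //; lra.
have [h0 h00 H] := small_step (l := enum I) (fun r _ => cexp_near0 (E r) e0).
exists h0 => // h hh; have /andP[hp _] := hh.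
rewrite modes_generator mulr_sumr -!sumrB; apply: le_trans (nm_sum _ _ _) _.
apply: le_trans (_ : _ <= M * (h * (d / (M + 1)))) _; last first.
  have ME : d / (M + 1) * (M + 1) = d by rewrite divfK // gt_eqF //; lra.
  by have := mulr_ge0 (ltW hp) (ltW e0); move: ME; set e := d / _ => <-; lra.
rewrite mulr_suml; apply: ler_sum => r _.
rewrite cexp_step; set a := _ * _ * cexp _.
have -> : c r * u r x * (cexp (t%:C * E r) * cexp (h%:C * E r)) - a - h%:C * (E r * a) =
  a * (cexp (h%:C * E r) - 1 - h%:C * E r) by rewrite /a; ring.
by rewrite nmM ler_wpM2l ?nm_ge0 // H // mem_enum.
Qed.

Lemma modes_left x t d : 0 < t -> 0 < d -> exists2 h0, 0 < h0 & forall h, 0 < h < h0 -> h <= t ->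
  nm (modes x t - modes x (t - h)) <= d.
Proof.
move=> t0 d0; pose k r := nm (c r * u r x) * expR (`|complex.Re (E r)| * t).
have k0 r : 0 <= k r by rewrite mulr_ge0 ?nm_ge0 ?expR_ge0.
pose M := \sum_r k r * (nm (E r) + 1).
have M0 : 0 <= M by rewrite sumr_ge0 // => r _; rewrite mulr_ge0 ?addr_ge0 ?nm_ge0.
have [h0 h00 H] := small_step (l := enum I) (fun r _ => cexp_near0 (E r) ltr01).
have e0 : 0 < d / (M + 1) by rewrite divr_gt0 //; lra.
exists (Num.min h0 (d / (M + 1))); first by rewrite lt_min h00.
move=> h /andP[hp]; rewrite lt_min => /andP[hh0 hd] ht.
rewrite /modes -sumrB; apply: le_trans (nm_sum _ _ _) _.
apply: le_trans (_ : _ <= M * h) _; last first.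
  have : (M + 1) * h <= d by rewrite mulrC -ler_pdivlMr ?(ltW hd) //; lra.
  by rewrite mulrDl mul1r; lra.
rewrite /M mulr_suml; apply: ler_sum => r _.
have -> : cexp (t%:C * E r) = cexp ((t - h)%:C * E r) * cexp (h%:C * E r) by rewrite -cexp_step subrK.
have -> : c r * u r x * (cexp ((t - h)%:C * E r) * cexp (h%:C * E r)) -
    c r * u r x * cexp ((t - h)%:C * E r) =
    c r * u r x * cexp ((t - h)%:C * E r) * (cexp (h%:C * E r) - 1) by ring.
rewrite nmM (nmM (c r * u r x)) nm_cexp -[X in _ <= X]mulrA; apply: ler_pM.
- by rewrite mulr_ge0 ?nm_ge0 ?expR_ge0.
- exact: nm_ge0.
- rewrite /k ler_wpM2l ?nm_ge0 // ler_expR.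
  have -> : complex.Re ((t - h)%:C * E r) = (t - h) * complex.Re (E r).
    by case: (E r) => a b; simpc.
  by have := ler_norm (complex.Re (E r)); have := normr_ge0 (complex.Re (E r)); nra.
have := H h; rewrite hp hh0 => /(_ isT r (mem_enum _ _)) near.
have -> : cexp (h%:C * E r) - 1 = (cexp (h%:C * E r) - 1 - h%:C * E r) + h%:C * E r by ring.
apply: le_trans (nmD _ _) _; rewrite (nmM h%:C) (nmC (ltW hp)).
by rewrite mulrDl mul1r; lra.
Qed.

Variables (g : config L N -> R -> C) (lip : R).
Hypothesis g_lip : forall x t h, 0 <= t -> 0 <= h -> nm (g x (t + h) - g x t) <= lip * h.
Hypothesis g_forward : forall x t d, 0 <= t -> 0 < d -> exists2 h0, 0 < h0 & forall h, 0 < h < h0 ->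
  nm (g x (t + h) - g x t - h%:C * generator p q zeta (g^~ t) x) <= h * d.
Hypothesis g_start : forall x, g x 0 = modes x 0.

(** Apply [gronwall_right] to the sum of |g - modes| over configurations. There are finitely many of
    them, although the state space with currents is infinite; [K] is the total modulus of the jump
    kernel. *)
Lemma forward_unique x t : 0 <= t -> g x t = modes x t.
Proof.
pose D y s := g y s - modes y s; pose psi s := \sum_y nm (D y s).
pose n : R := #|{: config L N}|%:R; have n0 : 0 <= n by exact: ler0n.
have nE (a : R) : \sum_(y : config L N) a = n * a by rewrite sumr_const mulr_natl.
pose K := \sum_(y : config L N) \sum_(z : config L N) nm (jump_kernel p q zeta z y).
have K0 : 0 <= K by apply: sumr_ge0 => y _; apply: sumr_ge0 => z _; exact: nm_ge0.
have lip0 : 0 <= lip.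
  by have := g_lip x (lexx 0) (@ler01 R); rewrite mulr1; apply: le_trans; exact: nm_ge0.
suff : 0 <= t -> psi t <= 0.
  move=> H t0; apply/eqP; rewrite -subr_eq0 -nm_eq0 eq_le nm_ge0 andbT.
  apply: le_trans _ (H t0); rewrite /psi (bigD1 x) //= lerDl sumr_ge0 // => y _; exact: nm_ge0.
apply: (gronwall_right K0).
- by rewrite /psi big1 // => y _; rewrite /D g_start subrr nm0.
- move=> {}t d t0 d0; pose e := d / (2 * (n + 1)).
  have e0 : 0 < e by rewrite divr_gt0 // mulr_gt0 //; lra.
  have [h1 h10 H1] := small_step (l := enum {: config L N}) (fun y _ => g_forward y t0 e0).
  have [h2 h20 H2] := small_step (l := enum {: config L N}) (fun y _ => modes_forward y t e0).
  exists (Num.min h1 h2); first by rewrite lt_min h10.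
  move=> h /andP[hp]; rewrite lt_min => /andP[hh1 hh2].
  have step y : nm (D y (t + h)) <= nm (D y t) +
      h * (\sum_z nm (D z t) * nm (jump_kernel p q zeta z y)) + 2 * (h * e).
    have := H1 h; rewrite hp hh1 => /(_ isT y (mem_enum _ _)) G1.
    have := H2 h; rewrite hp hh2 => /(_ isT y (mem_enum _ _)) G2.
    have gE : generator p q zeta (g^~ t) y - generator p q zeta (modes^~ t) y =
        \sum_z D z t * jump_kernel p q zeta z y.
      by rewrite -!generator_adjoint -sumrB; apply: eq_bigr => z _; rewrite /D mulrBl.
    have -> : D y (t + h) = D y t + h%:C * (\sum_z D z t * jump_kernel p q zeta z y) +
        ((g y (t + h) - g y t - h%:C * generator p q zeta (g^~ t) y) -
         (modes y (t + h) - modes y t - h%:C * generator p q zeta (modes^~ t) y)).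
      by rewrite -gE /D; ring.
    apply: le_trans (nmD _ _) _; apply: lerD.
      apply: le_trans (nmD _ _) _; rewrite lerD2l nmM (nmC (ltW hp)); apply: (ler_wpM2l (ltW hp)).
      by apply: le_trans (nm_sum _ _ _) _; apply: ler_sum => z _; rewrite nmM.
    by apply: le_trans (nmB _ _) _; lra.
  apply: le_trans (ler_sum _ (fun y _ => step y)) _.
  rewrite !big_split /= nE -mulr_sumr.
  have -> : h * (K * psi t + d) = h * (K * psi t) + h * d by rewrite mulrDr.
  rewrite addrA; apply: lerD; first (rewrite lerD2l; apply: (ler_wpM2l (ltW hp))).
    rewrite /K mulr_suml; apply: ler_sum => y _; rewrite mulr_suml; apply: ler_sum => z _.
    rewrite mulrC ler_wpM2l ?nm_ge0 // /psi (bigD1 z) //= lerDl sumr_ge0 // => w _; exact: nm_ge0.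
  have eE : e * (2 * (n + 1)) = d by rewrite /e divfK // gt_eqF // mulr_gt0 //; lra.
  by have := mulr_ge0 (ltW hp) (ltW e0); rewrite -eE; lra.
move=> {}t d t0 d0; have e0 : 0 < d / (2 * (n + 1)) by rewrite divr_gt0 // mulr_gt0 //; lra.
set e := d / _ in e0.
have [h1 h10 H1] := small_step (l := enum {: config L N}) (fun y _ => modes_left y t0 e0).
have e'0 : 0 < e / (lip + 1) by rewrite divr_gt0 //; lra.
exists (Num.min h1 (e / (lip + 1))); first by rewrite lt_min h10.
move=> h /andP[hp]; rewrite lt_min => /andP[hh1 hh2] ht.
have step y : nm (D y t) <= nm (D y (t - h)) + 2 * e.
  have th0 : 0 <= t - h by lra.
  have := g_lip y th0 (ltW hp); rewrite subrK => G1.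
  have := H1 h; rewrite hp hh1 => /(_ isT y (mem_enum _ _) ht) G2.
  have -> : D y t = D y (t - h) + ((g y t - g y (t - h)) - (modes y t - modes y (t - h))).
    by rewrite /D; ring.
  apply: le_trans (nmD _ _) _; rewrite lerD2l; apply: le_trans (nmB _ _) _.
  have : h * (lip + 1) <= e by rewrite -ler_pdivlMr; [exact: ltW | lra].
  by rewrite mulrDr mulr1 mulrC; lra.
apply: le_trans (ler_sum _ (fun y _ => step y)) _.
rewrite big_split /= nE lerD2l.
have eE : e * (2 * (n + 1)) = d by rewrite /e divfK // gt_eqF // mulr_gt0 //; lra.
by rewrite -eE; lra.
Qed.

End Uniqueness.

(** * From the transition function to the law of the total current *)

Section CountableLaw.
Variables (R : realType) (S : countType) (d : measure_display) (T : measurableType d).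
Variables (P : probability T R) (Z : T -> S).
Hypothesis mZ : forall s, measurable [set w | Z w = s].
Implicit Types (B D : pred S).

Lemma measurable_law B : measurable [set w | B (Z w)].
Proof.
have -> : [set w | B (Z w)] = \bigcup_n
    (if unpickle n is Some s then (if B s then [set w | Z w = s] else set0) else set0).
  apply/seteqP; split=> w /=.
    by move=> Bw; exists (pickle (Z w)) => //; rewrite pickleK Bw.
  move=> [n _]; case: unpickle => [s|//]; case: ifP => // Bs /= -> //.
by apply: bigcupT_measurable => n; case: unpickle => [s|//]; case: ifP.
Qed.

Definition law B : R := fine (P [set w | B (Z w)]).

Lemma law_fin B : P [set w | B (Z w)] = (law B)%:E.
Proof. by rewrite /law fineK // fin_num_measure //; exact: measurable_law. Qed.

Lemma law_ge0 B : 0 <= law B.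
Proof. exact: fine_ge0. Qed.

Lemma law_split B D : law B = law [pred s | B s && D s] + law [pred s | B s && ~~ D s].
Proof.
apply: EFin_inj; rewrite EFinD -!law_fin -measureU; try exact: measurable_law.
  congr (P _); apply/seteqP; split=> w /=.
    by move=> Bw; case Dw: (D (Z w)); [left | right]; rewrite Bw.
  by move=> [/andP[]|/andP[]].
by apply/seteqP; split=> w //= -[/andP[_ Dw] /andP[_]]; rewrite Dw.
Qed.

Lemma law_ext B D : B =1 D -> law B = law D.
Proof. by move=> /funext ->. Qed.

Lemma lawT : law xpredT = 1.
Proof.
have := law_fin xpredT; have -> : [set w | xpredT (Z w)] = setT by apply/seteqP; split.
by rewrite probability_setT => -[].
Qed.

Lemma law0 : law xpred0 = 0.
Proof.
have := law_fin xpred0; have -> : [set w | xpred0 (Z w)] = set0 by apply/seteqP; split.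
by rewrite measure0 => -[].
Qed.

Lemma law_seq B (F : seq S) : uniq F ->
  law [pred s | B s && (s \in F)] = \sum_(s <- F | B s) law (pred1 s).
Proof.
elim: F => [|r F IH] /=; first by rewrite big_nil => _; rewrite -law0; apply: law_ext => s /=; rewrite andbF.
move=> /andP[rF uF]; rewrite big_cons -IH // (law_split _ (pred1 r)).
have -> : law [pred s | [pred s | B s && (s \in r :: F)] s && ~~ pred1 r s] =
    law [pred s | B s && (s \in F)].
  apply: law_ext => s /=; rewrite inE; case: eqP => [->|_] /=; last by rewrite andbT.
  by rewrite (negbTE rF) !andbF.
case Br: (B r).
  congr (_ + _); apply: law_ext => s /=; rewrite inE; case: eqP => [->|_]; rewrite ?andbF //.
  by rewrite Br.
rewrite (_ : law _ = 0) ?add0r // -law0; apply: law_ext => s /=; rewrite inE.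
by case: eqP => [->|_]; rewrite ?andbF // Br.
Qed.

Lemma law_fibers (K : eqType) (key : S -> K) B (l : seq K) : uniq l ->
  \sum_(k <- l) law [pred s | B s && (key s == k)] <= law B.
Proof.
move=> ul; suff -> : \sum_(k <- l) law [pred s | B s && (key s == k)] =
    law [pred s | B s && (key s \in l)].
  by rewrite [X in _ <= X](law_split B [pred s | key s \in l]) lerDl law_ge0.
elim: l ul => [|k l IH] /=.
  by rewrite big_nil => _; rewrite -law0; apply: law_ext => s /=; rewrite andbF.
move=> /andP[kl ul]; rewrite big_cons IH // [RHS](law_split _ [pred s | key s == k]).
congr (_ + _); apply: law_ext => s /=; rewrite inE.
  by case: eqP; rewrite ?andbF ?andbT.
by case: eqP => [->|_] /=; rewrite ?andbT // (negbTE kl) andbF.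
Qed.

End CountableLaw.

Lemma int_sum_toP (R : realType) (a : int -> R[i]) (v : R[i]) :
  (forall e : R, 0 < e -> exists n0 : nat, forall n, (n0 <= n)%N ->
    nm (v - \sum_(k < n.*2.+1) a (k%:Z - n%:Z)) <= e) -> int_sum_to a v.
Proof.
move=> H; apply/cvgrPdist_le => e; rewrite ltcE /= => /andP[/eqP im re].
have [n0 Hn] := H _ re; exists n0 => // n /= /Hn le.
by rewrite normCE lecE /= -im eqxx.
Qed.

Section TotalCurrentLaw.
Variables (R : realType) (L N : nat) (zeta : R[i]).
Hypothesis zeta1 : nm zeta = 1.
Variables (d : measure_display) (T : measurableType d) (P : probability T R).
Variables (Z : T -> state L N) (m : state L N -> R).
Hypothesis mZ : forall s, measurable [set w | Z w = s].
Hypothesis mE : forall s, P [set w | Z w = s] = (m s)%:E.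
Hypothesis mge : forall e : R, 0 < e -> exists2 F, uniq F & 1 - e <= \sum_(s <- F) m s.

Lemma int_sum_twist x v : expect m (twist zeta x) v ->
  int_sum_to (fun Q : int => zeta ^ Q *
    (fine (P [set w | (Z w).1 = x /\ total_current (Z w).2 = Q]))%:C) v.
Proof.
move=> ev; apply: int_sum_toP => e e0; have e40 : 0 < e / 4 by lra.
have [F uF Fe] := mge e40.
have law1 s : law P Z (pred1 s) = m s.
  rewrite /law (_ : [set w | pred1 s (Z w)] = [set w | Z w = s]) ?mE //.
  by apply/seteqP; split=> w /= /eqP.
pose tot (s : state L N) := total_current s.2.
pose n0 := (\sum_(s <- F) `|tot s|)%N.
have n0P s : s \in F -> (`|tot s| <= n0)%N.
  by move=> sF; rewrite /n0 (big_rem s) //= leq_addr.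
exists n0 => n nn.
pose key (k : 'I_n.*2.+1) : int := k%:Z - n%:Z.
have keyI : injective key by move=> k k' /addIr [] /val_inj.
pose A k : pred (state L N) := [pred s | (s.1 == x) && (tot s == key k)].
have aE k : fine (P [set w | (Z w).1 = x /\ total_current (Z w).2 = key k]) = law P Z (A k).
  congr (fine (P _)); apply/seteqP; split=> w /=; first by move=> [e1 e2]; rewrite /A /tot /= e1 e2 !eqxx.
  by move=> /andP[/eqP ? /eqP].
under eq_bigr do rewrite -/(key _) aE.
have sE : \sum_(s <- F) (m s)%:C * twist zeta x s =
    \sum_k zeta ^ key k * (law P Z [pred s | A k s && (s \in F)])%:C.
  under [RHS]eq_bigr do rewrite (law_seq P mZ) // rmorph_sum mulr_sumr big_mkcond.
  rewrite exchange_big /= big_seq [RHS]big_seq; apply: eq_bigr => s sF.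
  have kP : (absz (tot s + n%:Z)%R < n.*2.+1)%N by have := leq_trans (n0P s sF) nn; lia.
  have kE : key (Ordinal kP) = tot s.
    by rewrite /key /=; have := leq_trans (n0P s sF) nn; lia.
  rewrite (bigD1 (Ordinal kP)) //= [X in _ + X]big1 ?addr0.
    rewrite /A /= kE eqxx andbT law1 /twist; case: eqP => _; last by rewrite !mulr0.
    by rewrite mulr1 mulrC.
  move=> k kk; case: ifP => // /andP[_ /eqP e1]; case/eqP: kk; apply: keyI.
  by rewrite kE -e1.
have -> : v - \sum_k zeta ^ key k * (law P Z (A k))%:C =
    (v - \sum_(s <- F) (m s)%:C * twist zeta x s) -
    \sum_k zeta ^ key k * (law P Z [pred s | A k s && ~~ (s \in F)])%:C.
  rewrite sE -addrA -opprD -big_split; congr (_ - _); apply: eq_bigr => k _ /=.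
  by rewrite -mulrDr -rmorphD /= -law_split.
apply: le_trans (nmB _ _) _.
have tail : nm (\sum_k zeta ^ key k * (law P Z [pred s | A k s && ~~ (s \in F)])%:C) <=
    1 - \sum_(s <- F) m s.
  apply: le_trans (nm_sum _ _ _) _.
  under eq_bigr do rewrite nmM (nm_expz zeta1) mul1r nmC ?law_ge0 //.
  pose B : pred (state L N) := [pred s | (s.1 == x) && ~~ (s \in F)].
  apply: le_trans (_ : _ <= law P Z B) _.
    have u : uniq (map key (enum 'I_n.*2.+1)) by rewrite map_inj_uniq ?enum_uniq.
    apply: le_trans (law_fibers P mZ tot B u); rewrite big_map big_enum /=.
    apply: ler_sum => k _; rewrite le_eqVlt; apply/orP; left; apply/eqP.
    by apply: law_ext => s; rewrite /A /B /= andbAC.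
  have := law_split P mZ xpredT (mem F); rewrite lawT //.
  have -> : law P Z [pred s | xpredT s && (mem F) s] = \sum_(s <- F) m s.
    rewrite -(eq_bigr _ (fun s _ => law1 s)) -(law_seq P mZ xpredT uF).
    exact: law_ext.
  move=> ->; rewrite addrAC subrr add0r.
  rewrite (law_split P mZ [pred s | xpredT s && ~~ (mem F) s] [pred s : state L N | s.1 == x]).
  rewrite [law P Z B](_ : _ = law P Z
      [pred s | [pred s | xpredT s && ~~ (mem F) s] s && [pred s : state L N | s.1 == x] s]).
    by rewrite lerDl law_ge0.
  by apply: law_ext => s; rewrite /B /= andbC.
have := ev F uF; lra.
Qed.

End TotalCurrentLaw.

(** * Spectral decomposition *)

Section Roots.
Variables (R : realType) (L N : nat) (zeta : R[i]).
Local Notation C := R[i].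
Hypotheses (L0 : (0 < L)%N) (N0 : (0 < N)%N) (z0 : zeta != 0).

(** The value of z^L forced by the equation [bethe_p] = 0. *)
Definition fugacity (w : {ffun 'I_N -> C}) : C :=
  sgN R N * zeta ^+ L * \prod_j (1 - (w j)^-1).

Lemma sgN_neq0 : sgN R N != 0.
Proof. by rewrite /sgN signr_eq0. Qed.

Lemma bethe_solutionsE (z : C) w :
  bethe_solutions L N zeta (z, w) <-> bethe_sys L (sgN R N) zeta w /\ z ^+ L = fugacity w.
Proof.
have sgE : sgN R N = - (-1) ^+ N by rewrite /sgN exprS mulN1r.
split=> [[/= zn pz qz]|[sys zE]].
  (* By the convention [0^-1 = 0], a zero of [w i] or of [1 - (w i)^-1] would make [bethe_q] equal
     to 1. *)
  have wn i : w i != 0.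
    apply/eqP => w0; have := qz i; rewrite /bethe_q w0 expr0n gtn_eqF //= invr0 mulr0 mul0r subr0.
    by apply/eqP/oner_neq0.
  have an i : 1 - (w i)^-1 != 0.
    apply/eqP => a0; have := qz i; rewrite /bethe_q a0 expr0n gtn_eqF //= invr0 mulr0 subr0.
    by apply/eqP/oner_neq0.
  have zL : z ^+ L != 0 by rewrite expf_neq0.
  have zE : z ^+ L = fugacity w.
    apply/eqP; rewrite -subr_eq0 /fugacity sgE; apply/eqP.
    have := congr1 ( *%R (z ^+ L)) pz; rewrite mulr0 /bethe_p => <-.
    by field.
  split=> // i; split=> //; rewrite -[RHS]zE.
  have := qz i; rewrite /bethe_q => /eqP; rewrite subr_eq0 => /eqP e.
  have wL : w i ^+ L != 0 by rewrite expf_neq0.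
  have aN : (1 - (w i)^-1) ^+ N != 0 by rewrite expf_neq0.
  move: (w i ^+ L) ((1 - (w i)^-1) ^+ N) (z ^+ L) e wL aN => X Y V e X0 Y0.
  by rewrite -[LHS]mulr1 e; field; rewrite X0 Y0.
have wn i : w i != 0 by case: (sys i).
have an i : 1 - (w i)^-1 != 0 by case: (sys i).
have fn : fugacity w != 0.
  by rewrite !mulf_neq0 ?sgN_neq0 ?expf_neq0 //; apply/prodf_neq0 => i _.
have zn : z != 0.
  by apply: contraNneq fn => zz; rewrite -zE zz expr0n gtn_eqF.
split=> //=.
  rewrite /bethe_p zE /fugacity sgE.
  have Pn : \prod_j (1 - (w j)^-1) != 0 by apply/prodf_neq0 => i _.
  have zL : zeta ^+ L != 0 by rewrite expf_neq0.
  have sn : (-1) ^+ N != 0 :> C by rewrite signr_eq0.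
  by field; rewrite Pn zL sn.
move=> i; have [_ _ e] := sys i; rewrite /bethe_q zE /fugacity -e.
by field; rewrite !expf_neq0.
Qed.

Lemma bethe_rootsE w : bethe_roots L N zeta w <-> bethe_sys L (sgN R N) zeta w.
Proof.
split=> [[z /bethe_solutionsE[]//]|sys].
have fn : fugacity w != 0.
  by rewrite !mulf_neq0 ?sgN_neq0 ?expf_neq0 //; apply/prodf_neq0 => i _; case: (sys i).
have [rt [rtE _ _ _]] := roots_of L0 fn.
by exists (rt (Ordinal L0)); apply/bethe_solutionsE.
Qed.

Variables (m : nat) (W : 'I_m -> {ffun 'I_N -> C}).
Hypothesis enumW : enumerates (bethe_sys L (sgN R N)) zeta W.

(** The fugacity of a root is nonzero, so each root is paired with exactly L distinct values of z,
    over which the summand is constant. *)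
Lemma bethe_solutions_sum (F : {ffun 'I_N -> C} -> C) :
  finite_set (bethe_solutions L N zeta) /\
  \sum_(zw \in bethe_solutions L N zeta) F zw.2 = \sum_r L%:R * F (W r).
Proof.
have [WS WI WA] := enumW.
have fn r : fugacity (W r) != 0.
  rewrite !mulf_neq0 ?sgN_neq0 ?expf_neq0 //; apply/prodf_neq0 => i _.
  by have [] := WS r i.
pose rt r := projT1 (cid (roots_of L0 (fn r))).
have rtP r : [/\ forall i, rt r i ^+ L = fugacity (W r), injective (rt r) &
    forall x, x ^+ L = fugacity (W r) -> exists i, x = rt r i].
  by rewrite /rt; case: cid => f [/= ? ? ? _].
pose sol (ri : 'I_m * 'I_L) := (rt ri.1 ri.2, W ri.1).
have solI : injective sol.
  move=> [r i] [r' i'] [/= e /WI rr]; move: e; rewrite -rr.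
  by have [_ inj _] := rtP r; move=> /inj ->.
have setE : bethe_solutions L N zeta = [set` map sol (enum {: 'I_m * 'I_L})].
  apply/seteqP; split=> -[z w] /=.
    move=> /bethe_solutionsE[/WA[r ->] zE]; have [_ _ sur] := rtP r.
    have [i ->] := sur z zE.
    by apply/mapP; exists (r, i); rewrite ?mem_enum.
  move=> /mapP[[r i] _ [-> ->]]; apply/bethe_solutionsE; split; first exact: WS.
  by have [] := rtP r.
have u : uniq (map sol (enum {: 'I_m * 'I_L})) by rewrite map_inj_uniq ?enum_uniq.
rewrite setE; split; first exact: finite_seq.
rewrite -fsbig_seq // big_map big_enum /= -(pair_bigA _ (fun r (i : 'I_L) => F (W r))) /=.
by apply: eq_bigr => r _; rewrite sumr_const card_ord mulr_natl.
Qed.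

End Roots.

Lemma expect_start (R : realType) (S : countType) (rate : S -> S -> R) Pt (f : S -> R[i]) s0 :
  transition_function rate Pt -> (forall s, nm (f s) <= 1) -> expect (Pt 0 s0) f (f s0).
Proof.
move=> tf f1 F uF; case s0F: (s0 \in F).
  have -> : \sum_(s <- F) (Pt 0 s0 s)%:C * f s = f s0.
    rewrite (bigD1_seq s0) //= (tf_start tf) eqxx mul1r big1 ?addr0 // => s /negbTE e.
    by rewrite (tf_start tf) eq_sym e mul0r.
  have -> : \sum_(s <- F) Pt 0 s0 s = 1.
    rewrite (bigD1_seq s0) //= (tf_start tf) eqxx big1 ?addr0 // => s /negbTE e.
    by rewrite (tf_start tf) eq_sym e.
  by rewrite !subrr nm0 mulr0.
have ne s : s \in F -> s0 == s = false by move=> sF; apply: contraFF s0F => /eqP ->.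
rewrite big_seq big1 => [|s /ne e]; last by rewrite (tf_start tf) e mul0r.
rewrite big_seq big1 => [|s /ne e]; last by rewrite (tf_start tf) e.
by rewrite !subr0 mulr1; apply: le_trans (f1 s0) _; lra.
Qed.

Theorem theorem1p2 (R : realType) (L N : nat) (p q : R)
  (L_ge1 : (1 <= L)%N) (N_ge1 : (1 <= N)%N) (N_le_L : (N <= L)%N)
  (p_ge0 : 0 <= p) (q_ge0 : 0 <= q) (pq1 : p + q = 1) :
  (forall (zeta : R[i]) (lambda : {ffun 'I_N -> R[i]}),
     `|zeta| = 1 -> bethe_roots L N zeta lambda ->
     forall X : config L N,
       generator p q zeta (fun X' => bethe_u lambda X' zeta) X
       = energy p q lambda * bethe_u lambda X zeta)
  /\
  (forall (Y : config L N)
     (d : measure_display) (T : measurableType d) (P : probability T R)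
     (X : R -> T -> config L N) (J : R -> T -> {ffun 'I_L -> int}),
     pushASEP P p q Y X J ->
     forall (x : config L N) (t : R), 0 <= t ->
     exists2 B : set R[i], finite_set B &
     forall zeta : R[i], `|zeta| = 1 -> ~ B zeta ->
     [/\ finite_set (bethe_solutions L N zeta),
         forall lambda : {ffun 'I_N -> R[i]}, bethe_roots L N zeta lambda ->
           (forall i, bethe_D L N (lambda i) != 0) /\
           bethe_jac L lambda != 0
       & int_sum_to
           (fun Q : int => zeta ^ Q *
              (fine (P [set w | X t w = x /\ total_current (J t w) = Q]))%:C)
           (('C(L, N)%:R)^-1 * (zeta ^+ L == 1)%:R
            + \sum_(zl \in bethe_solutions L N zeta)
                bethe_G zl.2 Y zeta * bethe_u zl.2 x zeta
                * cexp (t%:C * energy p q zl.2))]).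
Proof.
have nm_unit (zeta : R[i]) : `|zeta| = 1 -> nm zeta = 1.
  by move=> z1; apply: complexI; rewrite -normCE z1.
have unit_neq0 (zeta : R[i]) : `|zeta| = 1 -> zeta != 0.
  by move=> z1; rewrite -normr_eq0 z1 oner_eq0.
have eigen (zeta : R[i]) lambda (X : config L N) : `|zeta| = 1 -> bethe_sys L (sgN R N) zeta lambda ->
    generator p q zeta (fun X' => bethe_u lambda X' zeta) X = energy p q lambda * bethe_u lambda X zeta.
  move=> z1 sys; apply: bethe_eigenfunction => //; first exact: unit_neq0.
  - by move=> k; case: (sys k).
  - by move=> k; case: (sys k).
  - by move=> k; case: (sys k).
split=> [zeta lambda z1 roots X|Y d T P X J [meas [Pt tf cyl]] x t t0].
  by apply: eigen => //; apply/bethe_rootsE => //; exact: unit_neq0.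
(* One exceptional set per configuration: the initial condition has to be verified at every [y], not
   only at [x]. *)
have [B0 B0P] := choice (fun y => bethe_completeness R L_ge1 N_ge1 N_le_L y Y).
have [rt [_ _ rtP _]] := roots_of L_ge1 (oner_neq0 R[i]).
(* With the L-th roots of unity included, the indicator of zeta^L = 1 is zero off the exceptional
   set. *)
exists [set` flatten [seq B0 y | y <- enum {: config L N}] ++ map rt (enum 'I_L)].
  exact: finite_seq.
move=> zeta z1 /negP; rewrite mem_cat negb_or => /andP[/negP nB /negP nL].
have zL : zeta ^+ L == 1 = false.
  apply/eqP => /rtP[i zi]; apply: nL; apply/mapP; exists i => //.
  by rewrite mem_enum.
have nBy y : zeta \notin B0 y.
  apply/negP => zB; apply: nB; apply/flattenP; exists (B0 y) => //.
  by apply: map_f; rewrite mem_enum.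
have [W [enumW nondegW _]] := B0P x zeta (nBy x).
(* The enumerations obtained for different [y] may differ, but the sum does not depend on the
   enumeration. *)
have complete y : \sum_r bethe_term y Y zeta (W r) = (y == Y)%:R.
  have [W' [enumW' _ <-]] := B0P y zeta (nBy y).
  exact: enumerates_sum enumW enumW'.
have [WS _ WA] := enumW; have zn0 := unit_neq0 _ z1; have nz1 := nm_unit _ z1.
pose F w := bethe_G w Y zeta * bethe_u w x zeta * cexp (t%:C * energy p q w).
have [fin sumE] := bethe_solutions_sum L_ge1 N_ge1 zn0 enumW F.
split=> //.
  by move=> lambda /(bethe_rootsE L_ge1 N_ge1 zn0)/WA[r ->]; exact: nondegW.
rewrite zL mulr0 add0r sumE.
pose s0 : state L N := (Y, [ffun=> 0]).
have law_at s u : 0 <= u -> P [set w | (X u w, J u w) = s] = (Pt u s0 s)%:E.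
  move=> u0; have := cyl [:: (u, s)]; rewrite /= andbT setIT add0r mulr1.
  exact.
have tw1 (y : config L N) (s : state L N) : nm (twist zeta y s) <= 1 by exact: twist_le1.
have exg y u : exists v, 0 <= u -> expect (Pt u s0) (twist zeta y) v.
  (* For negative times the implication is void and 0 is a default value. *)
  have [u0|u0] := leP 0 u; last by exists 0; lra.
  have [v vP] := expect_ex (fun s => tf_ge0 tf s0 s u0)
    (fun F => @Pt_sum_le _ _ _ _ tf u s0 F u0) (tw1 y).
  by exists v.
pose g y u := projT1 (cid (exg y u)).
have gP y u : 0 <= u -> expect (Pt u s0) (twist zeta y) (g y u) := projT2 (cid (exg y u)).
have -> : \sum_r L%:R * F (W r) = g x t.
  pose c r := L%:R * bethe_G (W r) Y zeta.
  transitivity (modes c (fun r => energy p q (W r)) (fun r y => bethe_u (W r) y zeta) x t).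
    by apply: eq_bigr => r _; rewrite /F /c; ring.
  apply/esym/(@forward_unique R L N p q zeta _ _ _ _ _ g (3 * N%:R)) => //.
  - by move=> r y; exact: eigen.
  - by move=> y u h; exact: (twist_lipschitz p_ge0 q_ge0 pq1 nz1 tf gP).
  - by move=> y u e; exact: (twist_forward p_ge0 q_ge0 pq1 nz1 tf gP).
  (* All currents vanish at time 0, so the initial condition is the indicator of [Y], which is what
     completeness provides. *)
  move=> y; have -> : g y 0 = twist zeta y s0.
    apply: expect_uniq (expect_start s0 tf (tw1 y)); last exact: gP.
    by move=> e; exact: (Pt_sum_ge tf s0 (lexx 0)).
  rewrite /twist /total_current big1 ?expr0z ?mul1r; last by move=> i _; rewrite ffunE.
  rewrite eq_sym -complete; apply: eq_bigr => r _.
  by rewrite mul0r cexp0 mulr1.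
apply: (int_sum_twist nz1 (Z := fun w => (X t w, J t w)) (m := Pt t s0)).
- by move=> s; exact: meas.
- by move=> s; exact: law_at.
- by move=> e e0; exact: (Pt_sum_ge tf s0 t0 e0).
- exact: gP.
Qed.
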